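(* Let $k$ be an integer. There are no $\lambda_1^k$-critical $S^1$-invariant metrics on $S^2$; that is, there is no symplectic potential $s\in\mathrm{Spot}(]-1,1[)$ which is $\lambda_1^k$-critical.
   Context: $S^2$ is regarded as a toric symplectic manifold with its standard rotation action of $S^1=\mathbb{R}/2\pi\mathbb{Z}$ and a rotation-invariant area form $\omega$ (total area $4\pi$) normalised so that the moment map $x$ has image $[-1,1]$; the open moment polytope is $]-1,1[$. Away from the two poles there are coordinates $(x,\theta)\in\,]-1,1[\,\times\mathbb{R}/2\pi\mathbb{Z}$ with $\omega=dx\wedge d\theta$ and $S^1$ acting by translation of $\theta$. $\mathrm{Spot}(]-1,1[)$ is the set of $s\in C^\infty(]-1,1[)$ with $s''>0$ such that $s-\frac12\big[(1+x)\log(1+x)+(1-x)\log(1-x)\big]$ extends smoothly to $[-1,1]$. Each such $s$ determines a smooth $S^1$-invariant metric on $S^2$ with area form $\omega$, given away from the poles by $g_s=s''\,dx^2+\frac{1}{s''}\,d\theta^2$; every $S^1$-invariant metric on $S^2$ (of this total area) is described in this way by a symplectic potential, up to equivariant diffeomorphism. The integer $k$ corresponds to the character $e^{\mathbf{i}\theta}\mapsto e^{\mathbf{i}k\theta}$ of $S^1$. A function $F:S^2\to\mathbb{C}$ is $k$-equivariant if $F(e^{\mathbf{i}\theta}\cdot p)=e^{\mathbf{i}k\theta}F(p)$ for all $p$ and $\theta$. The Laplacian is $\Delta=d^*d$ (nonnegative), and $\lambda_1^k(s)$ is the smallest positive eigenvalue of the Laplacian of $g_s$ restricted to smooth $k$-equivariant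 complex functions ($k=0$ being the case of invariant functions). Criticality: for a one-parameter family $s_t\in\mathrm{Spot}(]-1,1[)$, real-analytic in $t$ near $0$, with $s_0=s$, the function $t\mapsto\lambda_1^k(s_t)$ has left and right derivatives at $t=0$. The potential $s$ (or the metric $g_s$) is $\lambda_1^k$-critical if for every such family $$\frac{d\lambda_1^k(s_t)}{dt}(0^-)\cdot\frac{d\lambda_1^k(s_t)}{dt}(0^+)\le 0 .$$ *)

(* Defs.v *)
From Stdlib Require Import Reals Lra ZArith.
From Coquelicot Require Import Coquelicot.
Local Open Scope R_scope.

(** A function on the open interval ]-1,1[ is represented by a function R -> R
    whose values outside ]-1,1[ are never used. *)

Definition smooth (f : R -> R) : Prop :=
  forall (n : nat) (x : R), ex_derive_n f n x.

Definition smooth_inside (f : R -> R) : Prop :=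
  forall (n : nat) (x : R), -1 < x < 1 -> ex_derive_n f n x.

(** Smoothness on the closed interval [-1,1], in the sense of being the
    restriction of a smooth function on R. *)
Definition extends_smoothly (f : R -> R) : Prop :=
  exists h : R -> R, smooth h /\ forall x, -1 < x < 1 -> f x = h x.

Definition Spot (s : R -> R) : Prop :=
  smooth_inside s /\
  (forall x, -1 < x < 1 -> 0 < Derive_n s 2 x) /\
  extends_smoothly
    (fun x => s x - / 2 * ((1 + x) * ln (1 + x) + (1 - x) * ln (1 - x))).

(** * Smooth functions on the sphere *)

Definition R3 : Type := (R * R * R)%type.

Inductive axis : Set := axis1 | axis2 | axis3.

Definition partial3 (i : axis) (f : R3 -> R) : R3 -> R := fun p =>
  let '(a, b, c) := p in
  match i with
  | axis1 => Derive (fun u => f (u, b, c)) a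
  | axis2 => Derive (fun u => f (a, u, c)) b
  | axis3 => Derive (fun u => f (a, b, u)) c
  end.

Definition ex_partial3 (i : axis) (f : R3 -> R) (p : R3) : Prop :=
  let '(a, b, c) := p in
  match i with
  | axis1 => ex_derive (fun u => f (u, b, c)) a
  | axis2 => ex_derive (fun u => f (a, u, c)) b
  | axis3 => ex_derive (fun u => f (a, b, u)) c
  end.

Fixpoint class_C (n : nat) (f : R3 -> R) : Prop :=
  (forall p : R3, continuous f p) /\
  match n with
  | O => True
  | S m => forall i : axis,
      (forall p : R3, ex_partial3 i f p) /\ class_C m (partial3 i f)
  end.

Definition smooth3 (f : R3 -> R) : Prop := forall n : nat, class_C n f.

Definition on_sphere (p : R3) : Prop :=
  let '(a, b, c) := p in a ^ 2 + b ^ 2 + c ^ 2 = 1.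

Definition S2 : Type := {p : R3 | on_sphere p}.

(** S^2 is a closed submanifold of R^3, so its smooth functions are the
    restrictions of the smooth functions on R^3. *)
Definition smooth_S2 (F : S2 -> C) : Prop :=
  exists G1 G2 : R3 -> R, smooth3 G1 /\ smooth3 G2 /\
    forall p : S2, F p = (G1 (proj1_sig p), G2 (proj1_sig p)).

(** * The circle action and equivariance *)

Definition rot (t : R) (p : R3) : R3 :=
  let '(a, b, c) := p in (cos t * a - sin t * b, sin t * a + cos t * b, c).

Lemma rot_on_sphere (t : R) (p : R3) : on_sphere p -> on_sphere (rot t p).
Proof.
destruct p as [[a b] c]; unfold rot, on_sphere; intros H.
pose proof (sin2_cos2 t) as T; unfold Rsqr in T.
transitivity ((sin t * sin t + cos t * cos t) * (a ^ 2 + b ^ 2) + c ^ 2).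
- ring.
- rewrite T; lra.
Qed.

Definition act (t : R) (p : S2) : S2 :=
  exist _ (rot t (proj1_sig p)) (rot_on_sphere t (proj1_sig p) (proj2_sig p)).

Definition cis (t : R) : C := (cos t, sin t).

Definition equivariant (k : Z) (F : S2 -> C) : Prop :=
  forall (t : R) (p : S2), F (act t p) = Cmult (cis (IZR k * t)) (F p).

(** * The metric of a symplectic potential and its Laplacian *)

(** The coordinates (x, theta): x is the height, which is the moment map of the
    rotation about the third axis for the standard area form, and that area
    form is dx /\ dtheta.  [clip] is the identity on [-1,1] and only serves to
    make [chart] total. *)
Definition clip (x : R) : R := Rmax (-1) (Rmin 1 x).

Definition radius (x : R) : R := sqrt (1 - x ^ 2).

Lemma chart_on_sphere (x t : R) :
  on_sphere (radius (clip x) * cos t, radius (clip x) * sin t, clip x).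
Proof.
assert (Hc : -1 <= clip x <= 1).
{ unfold clip, Rmax, Rmin.
  destruct (Rle_dec 1 x); destruct (Rle_dec (-1) _); lra. }
assert (H : 0 <= 1 - clip x ^ 2) by (simpl; nra).
assert (E : radius (clip x) * radius (clip x) = 1 - clip x ^ 2).
{ unfold radius; now apply sqrt_sqrt. }
pose proof (sin2_cos2 t) as T; unfold Rsqr in T.
unfold on_sphere.
replace ((radius (clip x) * cos t) ^ 2 + (radius (clip x) * sin t) ^ 2) with
  (radius (clip x) * radius (clip x) * (sin t * sin t + cos t * cos t)) by ring.
rewrite E, T; ring.
Qed.

Definition chart (x t : R) : S2 := exist _ _ (chart_on_sphere x t).

(** Delta = d^* d for the metric E dx^2 + 2 F dx dy + G dy^2, i.e.
    - 1/W (d_x ((G f_x - F f_y) / W) + d_y ((E f_y - F f_x) / W)),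
    where W is the area density. *)
Definition laplace_beltrami (E F G : R -> R -> R) (f : R -> R -> R) (x y : R) : R :=
  let W a b := sqrt (E a b * G a b - F a b ^ 2) in
  let fx a b := Derive (fun u => f u b) a in
  let fy a b := Derive (fun v => f a v) b in
  - ( Derive (fun a => (G a y * fx a y - F a y * fy a y) / W a y) x
    + Derive (fun b => (E x b * fy x b - F x b * fx x b) / W x b) y) / W x y.

(** The Laplacian of g_s = s'' dx^2 + (1 / s'') dtheta^2. *)
Definition laplace_pot (s : R -> R) : (R -> R -> R) -> R -> R -> R :=
  laplace_beltrami (fun x _ => Derive_n s 2 x) (fun _ _ => 0)
                   (fun x _ => / Derive_n s 2 x).

(** [H] is the Laplacian of [F] on (S^2, g_s).  Both are smooth on S^2, so the
    values of [H] at the poles are determined by continuity. *)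
Definition is_laplacian (s : R -> R) (F H : S2 -> C) : Prop :=
  smooth_S2 F /\ smooth_S2 H /\
  forall x t, -1 < x < 1 ->
    H (chart x t) =
      (laplace_pot s (fun x' t' => Re (F (chart x' t'))) x t,
       laplace_pot s (fun x' t' => Im (F (chart x' t'))) x t).

Definition is_eigenvalue (k : Z) (s : R -> R) (l : R) : Prop :=
  exists F : S2 -> C,
    smooth_S2 F /\ equivariant k F /\ (exists p, F p <> RtoC 0) /\
    is_laplacian s F (fun p => Cmult (RtoC l) (F p)).

Definition is_lambda1 (k : Z) (s : R -> R) (l : R) : Prop :=
  0 < l /\ is_eigenvalue k s l /\
  forall m, 0 < m -> is_eigenvalue k s m -> l <= m.

(** [iota] is Coquelicot's definite description. *)
Definition lambda1 (k : Z) (s : R -> R) : R :=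
  iota (fun l : R => is_lambda1 k s l).

(** * Criticality *)

(** For |t| small, s_t - s_0 is the sum of a power series in t whose
    coefficients are smooth on [-1,1], with convergence in the Frechet space
    C^infty([-1,1]): all x-derivatives converge uniformly. *)
Definition analytic_at0 (sf : R -> R -> R) : Prop :=
  exists (r : R) (a : nat -> R -> R), 0 < r /\
    (forall n, extends_smoothly (a n)) /\
    forall (t : R) (j : nat), Rabs t < r ->
      forall eps : R, 0 < eps ->
      exists N : nat, forall (m : nat) (x : R), (N <= m)%nat -> -1 < x < 1 ->
        Rabs (sum_n (fun n => Derive_n (a n) j x * t ^ n) m
              - Derive_n (fun y => sf t y - sf 0 y) j x) < eps.

Definition analytic_family (s : R -> R) (sf : R -> R -> R) : Prop :=
  locally 0 (fun t => Spot (sf t)) /\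
  (forall x, -1 < x < 1 -> sf 0 x = s x) /\
  analytic_at0 sf.

Definition is_left_derive0 (L : R -> R) (d : R) : Prop :=
  filterlim (fun t => (L t - L 0) / t) (at_left 0) (locally d).

Definition is_right_derive0 (L : R -> R) (d : R) : Prop :=
  filterlim (fun t => (L t - L 0) / t) (at_right 0) (locally d).

Definition lambda1_critical (k : Z) (s : R -> R) : Prop :=
  forall sf : R -> R -> R, analytic_family s sf ->
  forall dl dr : R,
    is_left_derive0 (fun t => lambda1 k (sf t)) dl ->
    is_right_derive0 (fun t => lambda1 k (sf t)) dr ->
    dl * dr <= 0.

(* Main.v *)
(** A [k]-equivariant eigenfunction [f(x) exp(i k theta)] solves [(u f')' = (k^2 s'' - lam) f]
    with [u = 1 / s'']. For [k <> 0] the first one is positive, and [p = u f' / f] solves the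
    Riccati equation [p' = (k^2 - p^2) s'' - lam] with [p = |k|], [- |k|] at the poles.
    Conversely, by Picone's identity, a bounded solution [p] shows that no eigenvalue is smaller
    than [lam]. Since the Riccati equation can be solved for [s''], a deformation of [p] prescribes
    the metric together with its first eigenvalue: with [z = (|k| - p) / (|k| + p)],
    [4 k^2 s'' = lam (z + 2 + 1 / z) - 2 |k| z' / z], and replacing [z] by [z exp(t x)] and
    [lam] by [lam exp(- t)] preserves the singularities of [s''] at the poles. This is an analytic
    family of potentials on which [lambda_1^k] is [lam exp(- t)], whose derivative at [0] is not [0].
    For [k = 0] the same works with [w = u f'], which is positive, vanishes at the poles and solves
    [w'' = - lam s'' w]: [P = w' / w] is replaced by [P + lam (exp(- t) - 1) x / 4].

    The first eigenfunction of [s] itself, smooth up to the poles, comes from a degenerate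
    Sturm-Liouville problem, solved by shooting from both endpoints. *)

Require Import Defs.
From Stdlib Require Import Reals ZArith Lra Lia FunctionalExtensionality Classical.
From Coquelicot Require Import Coquelicot.
Local Open Scope R_scope.

(** The deformation is dictated by the poles. Replacing [z] by [z exp(phi)] and [lam] by [lam T]
    changes [4 k^2 s''], up to smooth terms, by [lam z (T exp(phi) - 1) + lam (T exp(- phi) - 1) /
    z]. Since [z] has a simple zero at [-1] and a simple pole at [1], smoothness asks for
    [T exp(phi) = 1] at [1] and [T exp(- phi) = 1] at [-1]; [phi = t x], [T = exp(- t)] is the
    simplest choice. For [k = 0], [P] behaves like [- 2 x / (1 - x^2)], and adding [d] to [P]
    changes the coefficient of [1 / (1 - x^2)] in [s''] at a pole by [1 / T - 1 + 4 x d / (lam T)];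
    this vanishes at both poles for [d = lam (T - 1) x / 4]. The unknown of the shooting problem
    must not vanish at the poles. So [f] is divided by [1 / cosh (|k| s')], and [w] by [1 - x^2].
    Both divisors are strict supersolutions for [lam = 0], which is why the remaining potential [q]
    is positive and shooting starts from positive growing solutions. Smoothness on [[-1,1]] means
    having a smooth extension to the line, so every division is done either by extending a
    reciprocal or by splitting off a zero. *)

Ltac eqR := match goal with |- @eq _ ?a ?b => change (@eq R a b) end.

(** * Smooth functions on open subsets of the line *)

Lemma is_derive_eq (f : R -> R) (x d d' : R) : is_derive f x d -> d = d' -> is_derive f x d'.
Proof. now intros H <-. Qed.

Lemma is_derive_continuous (f : R -> R) (x l : R) : is_derive f x l -> continuous f x.
Proof.
intros H; apply continuity_pt_filterlim, derivable_continuous_pt.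
exists l; now apply is_derive_Reals.
Qed.

Lemma ex_derive_continuousR (f : R -> R) (x : R) : ex_derive f x -> continuous f x.
Proof. intros [l H]; now apply (is_derive_continuous f x l). Qed.

(** A tower of derivatives on [U] instead of iterated [Derive]: closure under products and
    composition is then an induction on [n], without formulas for higher derivatives. *)
Fixpoint Ck (U : R -> Prop) (n : nat) (f : R -> R) : Prop :=
  match n with
  | O => forall x, U x -> continuous f x
  | S m => exists f' : R -> R, (forall x, U x -> is_derive f x (f' x)) /\ Ck U m f'
  end.

Definition smooth_on (U : R -> Prop) (f : R -> R) : Prop := forall n, Ck U n f.

Definition reals : R -> Prop := fun _ => True.

Definition inside : R -> Prop := fun x => -1 < x < 1.

Lemma open_reals : open reals.
Proof. exact open_true. Qed.

Lemma open_inside : open inside.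
Proof. apply open_and; [apply open_gt | apply open_lt]. Qed.

Lemma Ck_ext (U : R -> Prop) (HU : open U) (n : nat) (f g : R -> R) :
  (forall x, U x -> f x = g x) -> Ck U n f -> Ck U n g.
Proof.
intros E; destruct n as [|n].
- intros H x Hx; apply (continuous_ext_loc _ f); [|now apply H].
  apply (filter_imp U); [intros y Hy; now apply E | now apply HU].
- intros [f' [D C]]; exists f'; split; [|exact C].
  intros x Hx; apply (is_derive_ext_loc f); [|now apply D].
  apply (filter_imp U); [intros y Hy; now apply E | now apply HU].
Qed.

Lemma Ck_pred (U : R -> Prop) (n : nat) : forall f, Ck U (S n) f -> Ck U n f.
Proof.
induction n as [|n IH]; intros f [f' [D C]].
- intros x Hx; apply ex_derive_continuousR; exists (f' x); now apply D.
- exists f'; split; [exact D | now apply IH].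
Qed.

Lemma Ck_plus (U : R -> Prop) (n : nat) :
  forall f g, Ck U n f -> Ck U n g -> Ck U n (fun x => f x + g x).
Proof.
induction n as [|n IH]; intros f g Hf Hg.
- intros x Hx; apply (continuous_plus f g); auto.
- destruct Hf as [f' [Df Cf]], Hg as [g' [Dg Cg]].
  exists (fun x => f' x + g' x); split; [|now apply IH].
  intros x Hx; apply (is_derive_plus f g); auto.
Qed.

Lemma Ck_mult (U : R -> Prop) (n : nat) :
  forall f g, Ck U n f -> Ck U n g -> Ck U n (fun x => f x * g x).
Proof.
induction n as [|n IH]; intros f g Hf Hg.
- intros x Hx; apply (continuous_mult f g); auto.
- pose proof (Ck_pred _ _ _ Hf) as Hf1; pose proof (Ck_pred _ _ _ Hg) as Hg1.
  destruct Hf as [f' [Df Cf]], Hg as [g' [Dg Cg]].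
  exists (fun x => f' x * g x + f x * g' x); split.
  + intros x Hx; apply is_derive_Reals, derivable_pt_lim_mult;
      apply is_derive_Reals; auto.
  + apply Ck_plus; now apply IH.
Qed.

Lemma Ck_comp (U V : R -> Prop) (n : nat) :
  forall f g, (forall x, U x -> V (g x)) -> Ck V n f -> Ck U n g ->
  Ck U n (fun x => f (g x)).
Proof.
induction n as [|n IH]; intros f g HUV Hf Hg.
- intros x Hx; apply continuous_comp; auto.
- pose proof (Ck_pred _ _ _ Hg) as Hg1.
  destruct Hf as [f' [Df Cf]], Hg as [g' [Dg Cg]].
  exists (fun x => g' x * f' (g x)); split.
  + intros x Hx; apply (is_derive_comp f g); auto.
  + apply Ck_mult; [exact Cg | now apply IH].
Qed.

Lemma Ck_const (U : R -> Prop) (n : nat) (c : R) : Ck U n (fun _ => c).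
Proof.
revert c; induction n as [|n IH]; intros c.
- intros x _; apply continuous_const.
- exists (fun _ => 0); split; [intros; apply (is_derive_const (V := R_NormedModule)) | apply IH].
Qed.

Lemma Ck_id (U : R -> Prop) (n : nat) : Ck U n (fun x => x).
Proof.
destruct n as [|n].
- intros x _; apply continuous_id.
- exists (fun _ => 1); split; [intros; apply (is_derive_id (K := R_AbsRing)) | apply Ck_const].
Qed.

Lemma Ck_Derive (U : R -> Prop) (HU : open U) (n : nat) (f : R -> R) :
  Ck U (S n) f -> Ck U n (Derive f).
Proof.
intros [f' [D C]]; apply (Ck_ext U HU n f'); [|exact C].
intros x Hx; symmetry; now apply is_derive_unique, D.
Qed.

Lemma Ck_ex_derive_n (U : R -> Prop) (HU : open U) (n : nat) :
  forall f, Ck U n f -> forall x, U x -> ex_derive_n f n x.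
Proof.
induction n as [|n IH]; intros f H x Hx; [exact I|].
destruct n as [|n].
- destruct H as [f' [D _]]; exists (f' x); now apply D.
- pose proof (IH _ (Ck_Derive _ HU _ _ H) x Hx) as E; simpl in E |- *.
  apply (ex_derive_ext (Derive_n (Derive f) n)); [|exact E].
  intros t; transitivity (Derive_n f (n + 1) t).
  + exact (Derive_n_comp f n 1 t).
  + now rewrite Nat.add_1_r.
Qed.

(** One order is lost because continuity of the last derivative is deduced from its
    differentiability. *)
Lemma ex_derive_n_Ck (U : R -> Prop) (n : nat) :
  forall f, (forall k x, (k <= S n)%nat -> U x -> ex_derive_n f k x) -> Ck U n f.
Proof.
induction n as [|n IH]; intros f H.
- intros x Hx; apply ex_derive_continuousR; now apply (H 1%nat).
- exists (Derive f); split.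
  + intros x Hx; apply Derive_correct, (H 1%nat); [lia | exact Hx].
  + apply IH; intros k x Hk Hx.
    destruct k as [|k]; [exact I|].
    pose proof (H (S (S k)) x ltac:(lia) Hx) as E; simpl in E |- *.
    apply (ex_derive_ext (Derive_n f (S k))); [|exact E].
    intros t; transitivity (Derive_n f (k + 1) t).
    * now rewrite Nat.add_1_r.
    * symmetry; exact (Derive_n_comp f k 1 t).
Qed.

Lemma smooth_on_iff (U : R -> Prop) (HU : open U) (f : R -> R) :
  smooth_on U f <-> forall n x, U x -> ex_derive_n f n x.
Proof.
split.
- intros H n x; now apply (Ck_ex_derive_n U HU).
- intros H n; apply ex_derive_n_Ck; auto.
Qed.

Notation Sm := (smooth_on reals).

Lemma smooth_iff (f : R -> R) : smooth f <-> Sm f.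
Proof.
rewrite (smooth_on_iff _ open_reals); split; intros H n x; [intros _|]; apply H; exact I.
Qed.

Lemma smooth_inside_iff (f : R -> R) : smooth_inside f <-> smooth_on inside f.
Proof. rewrite (smooth_on_iff _ open_inside); reflexivity. Qed.

Section Closure.
Variable U : R -> Prop.
Hypothesis HU : open U.

Lemma smooth_on_ext (f g : R -> R) :
  (forall x, U x -> f x = g x) -> smooth_on U f -> smooth_on U g.
Proof. intros E H n; now apply (Ck_ext U HU n f). Qed.

Lemma smooth_on_const (c : R) : smooth_on U (fun _ => c).
Proof. intros n; apply Ck_const. Qed.

Lemma smooth_on_id : smooth_on U (fun x => x).
Proof. intros n; apply Ck_id. Qed.

Lemma smooth_on_plus (f g : R -> R) :
  smooth_on U f -> smooth_on U g -> smooth_on U (fun x => f x + g x).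
Proof. intros Hf Hg n; now apply Ck_plus. Qed.

Lemma smooth_on_mult (f g : R -> R) :
  smooth_on U f -> smooth_on U g -> smooth_on U (fun x => f x * g x).
Proof. intros Hf Hg n; now apply Ck_mult. Qed.

Lemma smooth_on_opp (f : R -> R) : smooth_on U f -> smooth_on U (fun x => - f x).
Proof.
intros Hf; apply (smooth_on_ext (fun x => -1 * f x)); [intros; ring|].
apply smooth_on_mult; [apply smooth_on_const | exact Hf].
Qed.

Lemma smooth_on_minus (f g : R -> R) :
  smooth_on U f -> smooth_on U g -> smooth_on U (fun x => f x - g x).
Proof. intros Hf Hg; apply smooth_on_plus; [exact Hf | now apply smooth_on_opp]. Qed.

Lemma smooth_on_pow (f : R -> R) (m : nat) :
  smooth_on U f -> smooth_on U (fun x => f x ^ m).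
Proof.
intros Hf; induction m as [|m IH]; simpl.
- apply smooth_on_const.
- now apply smooth_on_mult.
Qed.

Lemma smooth_on_comp (V : R -> Prop) (f g : R -> R) :
  (forall x, U x -> V (g x)) -> smooth_on V f -> smooth_on U g ->
  smooth_on U (fun x => f (g x)).
Proof. intros HUV Hf Hg n; now apply (Ck_comp U V). Qed.

Lemma smooth_on_Derive (f : R -> R) : smooth_on U f -> smooth_on U (Derive f).
Proof. intros H n; apply Ck_Derive; auto. Qed.

Lemma smooth_on_Derive_n (f : R -> R) (j : nat) :
  smooth_on U f -> smooth_on U (Derive_n f j).
Proof.
intros H; induction j as [|j IH]; [exact H | now apply (smooth_on_Derive (Derive_n f j))].
Qed.

Lemma smooth_on_intro (f f' : R -> R) :
  (forall x, U x -> is_derive f x (f' x)) -> smooth_on U f' -> smooth_on U f.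
Proof.
intros D H [|n].
- intros x Hx; apply ex_derive_continuousR; exists (f' x); now apply D.
- exists f'; split; [exact D | apply H].
Qed.

Lemma smooth_on_ex_derive (f : R -> R) (x : R) : smooth_on U f -> U x -> ex_derive f x.
Proof. intros H Hx; destruct (H 1%nat) as [f' [D _]]; exists (f' x); now apply D. Qed.

Lemma smooth_on_is_derive (f : R -> R) (x : R) :
  smooth_on U f -> U x -> is_derive f x (Derive f x).
Proof. intros H Hx; now apply Derive_correct, smooth_on_ex_derive. Qed.

Lemma smooth_on_continuous (f : R -> R) (x : R) : smooth_on U f -> U x -> continuous f x.
Proof. intros H Hx; now apply (H O). Qed.

End Closure.

Lemma smooth_on_subset (U V : R -> Prop) (f : R -> R) :
  (forall x, V x -> U x) -> smooth_on U f -> smooth_on V f.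
Proof.
intros S H n; specialize (H n); revert f H; induction n as [|n IH]; intros f H.
- intros x Hx; apply H; auto.
- destruct H as [f' [D C]]; exists f'; split; auto.
Qed.

Lemma smooth_on_exp (U : R -> Prop) : smooth_on U exp.
Proof.
intros n; induction n as [|n IH].
- intros x _; apply ex_derive_continuousR; exists (exp x); apply is_derive_exp.
- exists exp; split; [intros x _; apply is_derive_exp | exact IH].
Qed.

Lemma smooth_on_inv (U : R -> Prop) (HU : open U) (f : R -> R) :
  (forall x, U x -> f x <> 0) -> smooth_on U f -> smooth_on U (fun x => / f x).
Proof.
intros N H n; induction n as [|n IH].
- intros x Hx; apply ex_derive_continuousR; apply ex_derive_inv.
  + apply (smooth_on_ex_derive U); auto.
  + now apply N.
- exists (fun x => - Derive f x * (/ f x * / f x)); split.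
  + intros x Hx.
    replace (- Derive f x * (/ f x * / f x)) with (- Derive f x / f x ^ 2)
      by (field; now apply N).
    apply is_derive_inv; [now apply (smooth_on_is_derive U) | now apply N].
  + apply Ck_mult; [apply (smooth_on_opp U HU), (smooth_on_Derive U HU), H|].
    now apply Ck_mult.
Qed.

Lemma smooth_on_div (U : R -> Prop) (HU : open U) (f g : R -> R) :
  (forall x, U x -> g x <> 0) -> smooth_on U f -> smooth_on U g ->
  smooth_on U (fun x => f x / g x).
Proof. intros N Hf Hg; apply smooth_on_mult; [exact Hf | now apply smooth_on_inv]. Qed.

Lemma Sm_comp (f g : R -> R) : Sm f -> Sm g -> Sm (fun x => f (g x)).
Proof. intros Hf Hg; now apply (smooth_on_comp reals reals). Qed.

Lemma Sm_is_derive (f : R -> R) (x : R) : Sm f -> is_derive f x (Derive f x).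
Proof. intros H; now apply (smooth_on_is_derive reals). Qed.

Lemma Sm_ex_derive (f : R -> R) (x : R) : Sm f -> ex_derive f x.
Proof. intros H; now apply (smooth_on_ex_derive reals). Qed.

Lemma Sm_continuous (f : R -> R) (x : R) : Sm f -> continuous f x.
Proof. intros H; now apply (smooth_on_continuous reals). Qed.

Lemma Sm_continuity_pt (f : R -> R) (x : R) : Sm f -> continuity_pt f x.
Proof. intros H; now apply continuity_pt_filterlim, Sm_continuous. Qed.

Lemma ex_RInt_cont (f : R -> R) (a b : R) : (forall y, continuous f y) -> ex_RInt f a b.
Proof. intros H; apply (ex_RInt_continuous (V := R_CompleteNormedModule)); auto. Qed.

Lemma is_derive_RInt0 (f : R -> R) (x : R) :
  (forall y, continuous f y) -> is_derive (fun x => RInt f 0 x) x (f x).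
Proof.
intros H; apply (is_derive_RInt f _ 0 x); [|apply H].
apply filter_forall; intros y; now apply (RInt_correct f 0 y), ex_RInt_cont.
Qed.

Lemma Sm_RInt (f : R -> R) : Sm f -> Sm (fun x => RInt f 0 x).
Proof.
intros H; apply (smooth_on_intro reals _ f); [|exact H].
intros x _; apply is_derive_RInt0; intros y; now apply Sm_continuous.
Qed.

Ltac smooth_tac :=
  repeat first
    [ assumption
    | apply open_reals | apply open_inside
    | apply smooth_on_const | apply smooth_on_id
    | apply smooth_on_plus | apply smooth_on_minus
    | apply smooth_on_opp | apply smooth_on_mult
    | apply smooth_on_pow | apply smooth_on_Derive
    | apply smooth_on_Derive_n
    | apply (smooth_on_comp _ reals exp); [intros; exact I | apply smooth_on_exp | ] ].

(** * Extension of reciprocals *)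

(** The flat function [exp (- / x)], with powers of [/ x] included so that the family is closed
    under differentiation up to linear combinations. *)
Definition flat_pow (n : nat) (x : R) : R :=
  if Rlt_dec 0 x then exp (- / x) / x ^ n else 0.

(** Induction on [n]: the derivative of [(n+1)! exp z - z^(n+1)] is [n + 1] times the same
    difference for [n]. *)
Lemma pow_le_fact_exp (n : nat) (y : R) : 0 <= y -> y ^ n <= INR (Factorial.fact n) * exp y.
Proof.
revert y; induction n as [|n IH]; intros y Hy.
- simpl; rewrite Rmult_1_l; pose proof (exp_ineq1_le y); lra.
- assert (EF : INR (Factorial.fact (S n)) = INR (S n) * INR (Factorial.fact n)).
  { rewrite <- mult_INR; reflexivity. }
  assert (PF : 0 <= INR (Factorial.fact (S n))) by apply pos_INR.
  set (F := INR (Factorial.fact (S n))) in *.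
  set (g := fun z => F * exp z - z ^ S n).
  assert (D : forall z, is_derive g z
      (INR (S n) * (INR (Factorial.fact n) * exp z - z ^ n))).
  { intros z; unfold g; auto_derive; [easy|].
    rewrite EF.
    change (match n with O => 1 | S _ => INR n + 1 end) with (INR (S n)); ring. }
  destruct (Rle_lt_or_eq_dec 0 y Hy) as [Hy'|<-].
  + destruct (MVT_gen g 0 y _ (fun z _ => D z)) as [c [Hc E]].
    * intros z _; apply continuity_pt_filterlim, ex_derive_continuousR.
      eexists; apply D.
    * rewrite Rmin_left, Rmax_right in Hc by lra.
      assert (0 <= INR (S n) * (INR (Factorial.fact n) * exp c - c ^ n)).
      { apply Rmult_le_pos; [apply pos_INR|].
        pose proof (IH c (proj1 Hc)); lra. }
      assert (G0 : 0 <= g 0).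
      { unfold g; rewrite exp_0, pow_i by lia.
        pose proof (pos_INR (Factorial.fact (S n))); lra. }
      assert (0 <= g y) by nra.
      unfold g in *; lra.
  + rewrite pow_i by lia; rewrite exp_0; lra.
Qed.

Lemma flat_pow_bound (n : nat) (x : R) :
  Rabs (flat_pow n x) <= INR (Factorial.fact (S n)) * Rabs x.
Proof.
unfold flat_pow; destruct (Rlt_dec 0 x) as [Hx|Hx].
- assert (Hp : 0 < x ^ n) by now apply pow_lt.
  rewrite Rabs_pos_eq.
  2: { apply Rlt_le, Rdiv_lt_0_compat; [apply exp_pos | exact Hp]. }
  rewrite (Rabs_pos_eq x) by lra.
  assert (Hi : 0 < / x) by now apply Rinv_0_lt_compat.
  pose proof (pow_le_fact_exp (S n) (/ x) (Rlt_le _ _ Hi)) as P.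
  rewrite exp_Ropp.
  rewrite pow_inv in P.
  assert (Hp' : 0 < x ^ S n) by now apply pow_lt.
  pose proof (exp_pos (/ x)) as He.
  apply (Rmult_le_reg_l (/ x ^ S n * exp (/ x))).
  { apply Rmult_lt_0_compat; [now apply Rinv_0_lt_compat | exact He]. }
  replace (/ x ^ S n * exp (/ x) * (/ exp (/ x) / x ^ n)) with
    (/ x ^ S n * / x ^ n) by (field; repeat split; lra).
  replace (/ x ^ S n * exp (/ x) * (INR (Factorial.fact (S n)) * x)) with
    (/ x ^ n * (INR (Factorial.fact (S n)) * exp (/ x))) by (simpl; field; split; lra).
  rewrite (Rmult_comm (/ x ^ S n)).
  apply Rmult_le_compat_l; [left; now apply Rinv_0_lt_compat | exact P].
- rewrite Rabs_R0; apply Rmult_le_pos; [apply pos_INR | apply Rabs_pos].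
Qed.

Lemma flat_pow_is_derive (n : nat) (x : R) :
  is_derive (flat_pow n) x (flat_pow (S (S n)) x - INR n * flat_pow (S n) x).
Proof.
destruct (Rtotal_order x 0) as [Hx|[->|Hx]].
- assert (N : forall m y, y < 0 -> flat_pow m y = 0).
  { intros m y Hy; unfold flat_pow; destruct (Rlt_dec 0 y); [lra | easy]. }
  rewrite !N by lra; replace (0 - INR n * 0) with 0 by ring.
  apply (is_derive_ext_loc (fun _ => 0)).
  + apply (filter_imp (fun y => y < 0)); [intros y Hy; symmetry; now apply N|].
    now apply open_lt.
  + apply (is_derive_const (V := R_NormedModule)).
- assert (N : forall m, flat_pow m 0 = 0).
  { intros m; unfold flat_pow; destruct (Rlt_dec 0 0); [lra | easy]. }
  rewrite !N; replace (0 - INR n * 0) with 0 by ring.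
  apply is_derive_Reals; intros eps Heps.
  set (M := INR (Factorial.fact (S (S n))) + 1).
  assert (HM : 0 < M).
  { unfold M; pose proof (pos_INR (Factorial.fact (S (S n)))); lra. }
  assert (Hd : 0 < eps / M) by now apply Rdiv_lt_0_compat.
  exists (mkposreal _ Hd); simpl; intros h Hh Hlt.
  rewrite N, Rplus_0_l.
  (* The difference quotient at [0] is the next member of the family, which is [O(h)]. *)
  replace ((flat_pow n h - 0) / h - 0) with (flat_pow (S n) h).
  2: { unfold flat_pow; destruct (Rlt_dec 0 h); [simpl; field | field]; auto.
       split; [apply pow_nonzero; lra | lra]. }
  apply (Rle_lt_trans _ (INR (Factorial.fact (S (S n))) * Rabs h)).
  { apply flat_pow_bound. }
  apply (Rle_lt_trans _ (M * Rabs h)).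
  { apply Rmult_le_compat_r; [apply Rabs_pos | unfold M; lra]. }
  apply (Rmult_lt_compat_l M) in Hlt; [|exact HM].
  replace (M * (eps / M)) with eps in Hlt by (field; lra); exact Hlt.
- assert (P : forall m y, 0 < y -> flat_pow m y = exp (- / y) / y ^ m).
  { intros m y Hy; unfold flat_pow; destruct (Rlt_dec 0 y); [easy | lra]. }
  rewrite !P by lra.
  apply (is_derive_ext_loc (fun y => exp (- / y) / y ^ n)).
  + apply (filter_imp (fun y => 0 < y)); [intros y Hy; symmetry; now apply P|].
    now apply open_gt.
  + assert (Hp : x ^ n <> 0) by (apply pow_nonzero; lra).
    auto_derive; [repeat split; try lra; exact Hp|].
    destruct n as [|n]; [simpl; field; lra|].
    simpl pow in *; simpl Init.Nat.pred.
    assert (x ^ n <> 0) by (apply pow_nonzero; lra).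
    field; repeat split; try lra; exact H.
Qed.

Lemma flat_pow_smooth (n : nat) : Sm (flat_pow n).
Proof.
intros k; revert n; induction k as [|k IH]; intros n.
- intros x _; apply ex_derive_continuousR; eexists; apply flat_pow_is_derive.
- eexists; split; [intros x _; apply flat_pow_is_derive|].
  apply (Ck_plus reals k); [apply IH|].
  apply (Ck_ext reals open_reals k (fun x => - INR n * flat_pow (S n) x)).
  + intros x _; ring.
  + apply Ck_mult; [apply Ck_const | apply IH].
Qed.

(** [f^2] plus a flat function of [(x-a)(x-b)] never vanishes, and equals [f^2]
    on [a,b]. *)
Lemma recip_extension (a b : R) (f : R -> R) :
  Sm f -> (forall x, a <= x <= b -> 0 < f x) ->
  exists g, Sm g /\ forall x, a <= x <= b -> g x = / f x.
Proof.
intros Hf Pf.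
set (e := fun x => flat_pow 0 ((x - a) * (x - b))).
assert (He : Sm e) by (apply (Sm_comp (flat_pow 0)); [apply flat_pow_smooth | smooth_tac]).
assert (Pe : forall x, 0 <= e x).
{ intros x; unfold e, flat_pow; destruct (Rlt_dec _ _); [|lra].
  simpl; pose proof (exp_pos (- / ((x - a) * (x - b)))); lra. }
assert (Zin : forall x, a <= x <= b -> e x = 0).
{ intros x Hx; unfold e, flat_pow; destruct (Rlt_dec _ _); [nra | easy]. }
assert (Zout : forall x, e x = 0 -> (x - a) * (x - b) <= 0).
{ intros x; unfold e, flat_pow; destruct (Rlt_dec _ _); [|lra].
  simpl; pose proof (exp_pos (- / ((x - a) * (x - b)))); lra. }
destruct (Rle_dec a b) as [Hab|Hab].
2: { exists (fun _ => 0); split; [smooth_tac | intros; lra]. }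
assert (N : forall x, f x ^ 2 + e x <> 0).
{ intros x H.
  assert (e x = 0) by (pose proof (Pe x); nra).
  specialize (Zout x H0); pose proof (Pf x ltac:(nra)); nra. }
exists (fun x => f x / (f x ^ 2 + e x)); split.
- apply smooth_on_div; [apply open_reals | intros x _; apply N | exact Hf | smooth_tac].
- intros x Hx; rewrite (Zin x Hx); pose proof (Pf x Hx); field; lra.
Qed.

Lemma continuous_bounded (f : R -> R) (a b : R) :
  (forall y, continuous f y) -> exists M, 0 < M /\ forall y, a <= y <= b -> Rabs (f y) <= M.
Proof.
intros H.
destruct (Rle_dec a b) as [Hab|Hab]; [|exists 1; split; [lra | intros; lra]].
destruct (continuity_ab_maj (fun y => Rabs (f y)) a b Hab) as [c [Hc _]].
- intros y _; apply (continuity_pt_comp f Rabs).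
  + apply continuity_pt_filterlim, H.
  + apply Rcontinuity_abs.
- exists (Rabs (f c) + 1); split; [pose proof (Rabs_pos (f c)); lra|].
  intros y Hy; specialize (Hc y Hy); lra.
Qed.

Lemma Ck_continuous (U : R -> Prop) (n : nat) (f : R -> R) (x : R) :
  Ck U n f -> U x -> continuous f x.
Proof.
intros H Hx; induction n as [|n IH]; [now apply H | apply IH; now apply Ck_pred].
Qed.

(** * The averaging operator [y |-> y^-(m+1) * RInt (fun z => z^m * G z) 0 y] *)

(** The substitution [z = s * y] removes the division by a power of [y], so that [y = 0] is not a
    special case for smoothness. *)
Definition Kop (m : nat) (G : R -> R) (y : R) : R := RInt (fun s : R => s ^ m * G (s * y)) 0 1.

Lemma continuous_pow (m : nat) (x : R) : continuous (fun s : R => s ^ m) x.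
Proof. apply ex_derive_continuousR; auto_derive; easy. Qed.

Lemma continuous_multR (f g : R -> R) (x : R) :
  continuous f x -> continuous g x -> continuous (fun y => f y * g y) x.
Proof. apply (continuous_mult f g). Qed.

Lemma RInt_plusR (f g : R -> R) (a b : R) : ex_RInt f a b -> ex_RInt g a b ->
  RInt (fun x => f x + g x) a b = RInt f a b + RInt g a b.
Proof. apply (RInt_plus (V := R_CompleteNormedModule)). Qed.

Lemma RInt_minusR (f g : R -> R) (a b : R) : ex_RInt f a b -> ex_RInt g a b ->
  RInt (fun x => f x - g x) a b = RInt f a b - RInt g a b.
Proof. apply (RInt_minus (V := R_CompleteNormedModule)). Qed.

Lemma RInt_scalR (f : R -> R) (c a b : R) : ex_RInt f a b ->
  RInt (fun x => c * f x) a b = c * RInt f a b.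
Proof. apply (RInt_scal (V := R_CompleteNormedModule)). Qed.

Lemma Kop_integrand_continuous (m : nat) (G : R -> R) (y : R) :
  (forall x, continuous G x) -> forall s : R, continuous (fun s : R => s ^ m * G (s * y)) s.
Proof.
intros H s; apply continuous_multR; [apply continuous_pow|].
apply continuous_comp; [|apply H].
apply continuous_multR; [apply continuous_id | apply continuous_const].
Qed.

Lemma abs_scaled_le (s y : R) : 0 <= s <= 1 -> Rabs (s * y) <= Rabs y.
Proof.
intros Hs; rewrite Rabs_mult, (Rabs_pos_eq s) by lra; pose proof (Rabs_pos y); nra.
Qed.

Lemma Kop_diff (m : nat) (G1 G2 : R -> R) (y1 y2 e : R) :
  (forall x, continuous G1 x) -> (forall x, continuous G2 x) ->
  (forall s, 0 <= s <= 1 -> Rabs (G1 (s * y1) - G2 (s * y2)) <= e) ->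
  Rabs (Kop m G1 y1 - Kop m G2 y2) <= e.
Proof.
intros C1 C2 H; unfold Kop.
pose proof (Kop_integrand_continuous m G1 y1 C1) as I1.
pose proof (Kop_integrand_continuous m G2 y2 C2) as I2.
pose proof (ex_RInt_cont _ 0 1 I1) as E1.
pose proof (ex_RInt_cont _ 0 1 I2) as E2.
rewrite <- (RInt_minusR _ _ 0 1 E1 E2).
replace e with ((1 - 0) * e) by ring.
apply abs_RInt_le_const; [lra | now apply (ex_RInt_minus (V := R_NormedModule))|].
intros s Hs.
replace (s ^ m * G1 (s * y1) - s ^ m * G2 (s * y2))
  with (s ^ m * (G1 (s * y1) - G2 (s * y2))) by ring.
rewrite Rabs_mult, Rabs_pos_eq by (apply pow_le; lra).
pose proof (H s Hs); pose proof (Rabs_pos (G1 (s * y1) - G2 (s * y2))).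
assert (s ^ m <= 1) by (rewrite <- (pow1 m); apply pow_incr; lra).
assert (0 <= s ^ m) by (apply pow_le; lra).
nra.
Qed.

Lemma Kop_0 (m : nat) (y : R) : Kop m (fun _ => 0) y = 0.
Proof.
unfold Kop; rewrite (RInt_ext _ (fun _ => 0)) by (intros; apply Rmult_0_r).
rewrite RInt_const; apply Rmult_0_r.
Qed.

Lemma Kop_nonneg (m : nat) (G : R -> R) (y : R) :
  (forall x, continuous G x) -> 0 <= y ->
  (forall x, 0 <= x <= y -> 0 <= G x) -> 0 <= Kop m G y.
Proof.
intros C Hy H; unfold Kop.
apply RInt_ge_0; [lra | apply ex_RInt_cont, Kop_integrand_continuous, C|].
intros s Hs; apply Rmult_le_pos; [apply pow_le; lra | apply H; nra].
Qed.

Lemma Kop_continuous (m : nat) (G : R -> R) :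
  (forall x, continuous G x) -> forall y, continuous (Kop m G) y.
Proof.
intros C y; apply continuity_pt_filterlim.
intros eps Heps.
set (L := Rabs y + 1).
assert (He2 : 0 < eps / 2) by lra.
destruct (Heine_cor2 (f := G) (a := - L) (b := L)
  (fun x _ => proj2 (continuity_pt_filterlim G x) (C x)) (mkposreal _ He2)) as [d Hd].
exists (Rmin d 1); split; [apply Rmin_case; [apply cond_pos | lra]|].
intros y' [_ Hy']; simpl in Hy' |- *; unfold R_dist, Rdist in *.
assert (H1 : Rabs (y' - y) < d) by (eapply Rlt_le_trans; [exact Hy' | apply Rmin_l]).
assert (H2 : Rabs (y' - y) < 1) by (eapply Rlt_le_trans; [exact Hy' | apply Rmin_r]).
apply (Rle_lt_trans _ (eps / 2)); [|lra].
apply Kop_diff; [exact C | exact C|].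
intros s Hs; left; apply Hd.
- apply Rabs_le_between; eapply Rle_trans; [now apply abs_scaled_le|].
  unfold L; replace y' with (y + (y' - y)) by ring.
  eapply Rle_trans; [apply Rabs_triang | lra].
- apply Rabs_le_between; eapply Rle_trans; [now apply abs_scaled_le | unfold L; lra].
- replace (s * y' - s * y) with (s * (y' - y)) by ring.
  eapply Rle_lt_trans; [now apply abs_scaled_le | exact H1].
Qed.

(** Differentiation under the integral sign brings out a factor [s], which raises the weight from
    [m] to [S m]. *)
Lemma Kop_is_derive (m : nat) (G Gd : R -> R) (y : R) :
  (forall x, is_derive G x (Gd x)) -> (forall x, continuous Gd x) ->
  is_derive (Kop m G) y (Kop (S m) Gd y).
Proof.
intros D C.
assert (E : forall s u, is_derive (fun z => s ^ m * G (s * z)) u (s ^ S m * Gd (s * u))).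
{ intros s u; simpl.
  replace (s * s ^ m * Gd (s * u)) with (s ^ m * (s * Gd (s * u))) by ring.
  apply (is_derive_scal (fun z => G (s * z)) u (s ^ m)).
  apply (is_derive_comp G (fun z => s * z)); [apply D|].
  auto_derive; [easy | ring]. }
unfold Kop at 2.
rewrite (RInt_ext _ (fun s => Derive (fun u => s ^ m * G (s * u)) y)).
2: { intros s _; symmetry; apply is_derive_unique, E. }
apply (is_derive_RInt_param (fun u s => s ^ m * G (s * u)) 0 1 y).
- apply filter_forall; intros u s _; eexists; apply E.
- intros s _.
  apply (continuity_2d_pt_ext (fun u v => v ^ S m * Gd (v * u))).
  { intros u v; symmetry; apply is_derive_unique, E. }
  apply continuity_2d_pt_mult.
  + apply (continuity_1d_2d_pt_comp (fun v => v ^ S m) (fun _ v => v)).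
    * apply continuity_pt_filterlim, continuous_pow.
    * apply continuity_2d_pt_id2.
  + apply (continuity_1d_2d_pt_comp Gd (fun u v => v * u)).
    * apply continuity_pt_filterlim, C.
    * apply continuity_2d_pt_mult; [apply continuity_2d_pt_id2 | apply continuity_2d_pt_id1].
- apply filter_forall; intros u; apply ex_RInt_cont, Kop_integrand_continuous.
  intros x; apply (is_derive_continuous G x (Gd x)), D.
Qed.

Lemma Kop_Ck (n : nat) : forall m G, Ck reals n G -> Ck reals n (Kop m G).
Proof.
induction n as [|n IH]; intros m G H.
- intros x _; apply Kop_continuous; intros y; now apply H.
- destruct H as [G' [D C]]; exists (Kop (S m) G'); split; [|now apply IH].
  intros x _; apply Kop_is_derive; [intros y; now apply D|].
  intros y; now apply (Ck_continuous reals n).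
Qed.

Lemma Kop_Sm (m : nat) (G : R -> R) : Sm G -> Sm (Kop m G).
Proof. intros H n; apply Kop_Ck, H. Qed.

Lemma Kop_RInt (m : nat) (G : R -> R) (y : R) :
  (forall x, continuous G x) ->
  y ^ S m * Kop m G y = RInt (fun z : R => z ^ m * G z) 0 y.
Proof.
intros C.
assert (Cf : forall z, continuous (fun z : R => z ^ m * G z) z).
{ intros z; apply continuous_multR; [apply continuous_pow | apply C]. }
transitivity (RInt (fun z : R => z ^ m * G z) (y * 0 + 0) (y * 1 + 0)); [|f_equal; ring].
rewrite <- (RInt_comp_lin (V := R_CompleteNormedModule) (fun z : R => z ^ m * G z) y 0 0 1);
  [|now apply ex_RInt_cont].
unfold Kop.
rewrite <- RInt_scalR;
  [|now apply ex_RInt_cont, Kop_integrand_continuous].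
apply RInt_ext; intros s _; unfold scal; simpl; unfold mult; simpl.
rewrite Rplus_0_r, (Rmult_comm y s), Rpow_mult_distr; ring.
Qed.

Lemma Kop_pow_is_derive (m : nat) (G : R -> R) (y : R) :
  (forall x, continuous G x) ->
  is_derive (fun y => y ^ S m * Kop m G y) y (y ^ m * G y).
Proof.
intros C.
apply (is_derive_ext (fun y => RInt (fun z : R => z ^ m * G z) 0 y)).
- intros t; symmetry; now apply Kop_RInt.
- apply (is_derive_RInt0 (fun z : R => z ^ m * G z)); intros z.
  apply continuous_multR; [apply continuous_pow | apply C].
Qed.

(** By the fundamental theorem of calculus, the quotient is the mean of [G'] over the segment from
    [a] to [x], that is [Kop 0] of the translated derivative. *)
Lemma hadamard_division (a : R) (G : R -> R) :
  Sm G -> G a = 0 -> exists H, Sm H /\ forall x, G x = (x - a) * H x.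
Proof.
intros HG Ha.
set (G0 := fun y => G (y + a)).
assert (S0 : Sm G0) by (apply (Sm_comp G); [exact HG | smooth_tac]).
set (H0 := Kop 0 (Derive G0)).
assert (SH : Sm H0) by (apply Kop_Sm; smooth_tac).
exists (fun x => H0 (x - a)); split.
- apply (Sm_comp H0); [exact SH | smooth_tac].
- intros x; unfold H0.
  rewrite <- (pow_1 (x - a)) at 1.
  assert (CD : forall y, continuous (Derive G0) y).
  { intros y; apply Sm_continuous; smooth_tac. }
  rewrite Kop_RInt by exact CD.
  rewrite (RInt_ext _ (Derive G0)) by (intros z _; simpl; apply Rmult_1_l).
  rewrite RInt_Derive.
  + unfold G0; rewrite Rplus_0_l, Ha.
    replace (x - a + a) with x by ring; ring.
  + intros; now apply Sm_ex_derive.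
  + intros; apply CD.
Qed.

Lemma hadamard_division2 (G : R -> R) :
  Sm G -> G (-1) = 0 -> G 1 = 0 ->
  exists H, Sm H /\ forall x, G x = (1 - x ^ 2) * H x.
Proof.
intros HG H1 H2.
destruct (hadamard_division 1 G HG H2) as [F [SF EF]].
assert (F1 : F (-1) = 0) by (pose proof (EF (-1)); lra).
destruct (hadamard_division (-1) F SF F1) as [H [SH EH]].
exists (fun x => - H x); split; [smooth_tac|].
intros x; rewrite EF, EH; ring.
Qed.

(** * A singular Volterra equation *)

Lemma derive_le_derive (g g' phi phi' : R -> R) (y : R) :
  0 <= y -> g 0 = 0 -> phi 0 = 0 ->
  (forall z, 0 <= z <= y -> is_derive g z (g' z)) ->
  (forall z, 0 <= z <= y -> is_derive phi z (phi' z)) ->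
  (forall z, 0 <= z <= y -> Rabs (g' z) <= phi' z) ->
  Rabs (g y) <= phi y.
Proof.
intros Hy G0 P0 Dg Dp B.
assert (mono : forall s, (s = 1 \/ s = -1) -> 0 <= phi y + s * g y).
{ intros s Hs.
  set (F := fun z => phi z + s * g z).
  assert (DF : forall z, 0 <= z <= y -> is_derive F z (phi' z + s * g' z)).
  { intros z Hz; apply (is_derive_plus phi (fun z => s * g z)); [now apply Dp|].
    now apply (is_derive_scal g), Dg. }
  destruct (MVT_gen F 0 y (fun z => phi' z + s * g' z)) as [c [Hc E]].
  - intros z Hz; rewrite Rmin_left, Rmax_right in Hz by lra; apply DF; lra.
  - intros z Hz; rewrite Rmin_left, Rmax_right in Hz by lra.
    apply continuity_pt_filterlim, (is_derive_continuous F z (phi' z + s * g' z)).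
    apply DF; lra.
  - rewrite Rmin_left, Rmax_right in Hc by lra.
    unfold F in E; rewrite G0, P0 in E.
    pose proof (B c Hc) as Bc; apply Rabs_le_between in Bc.
    destruct Hs as [->| ->]; nra. }
apply Rabs_le_between; pose proof (mono 1 (or_introl eq_refl));
  pose proof (mono (-1) (or_intror eq_refl)); lra.
Qed.

(** An exponential weight in place of a short interval: integrating [exp (2 * M * Rabs z)] gains the
    factor [/ (2 * M)], so an operator of norm [M] becomes a contraction by [/ 2] on any bounded
    interval. *)
Lemma weighted_bound (g g' : R -> R) (a M B L : R) :
  0 <= a -> 0 < M -> 0 <= B -> g 0 = 0 ->
  (forall z, is_derive g z (g' z)) ->
  (forall z, Rabs z <= L -> Rabs (g' z) <= a + M * B * exp (2 * M * Rabs z)) ->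
  forall y, Rabs y <= L -> Rabs (g y) <= a * L + B / 2 * exp (2 * M * Rabs y).
Proof.
intros Ha HM HB G0 D Bd y Hy.
set (phi := fun z => a * z + B / 2 * exp (2 * M * z) - B / 2).
set (phi' := fun z => a + M * B * exp (2 * M * z)).
assert (Dp : forall z, is_derive phi z (phi' z)).
{ intros z; unfold phi, phi'; auto_derive; [easy | field]. }
assert (P0 : phi 0 = 0) by (unfold phi; rewrite !Rmult_0_r, exp_0; ring).
assert (Fin : Rabs (g y) <= phi (Rabs y)).
{ destruct (Rle_dec 0 y) as [P|P].
  - rewrite (Rabs_pos_eq y) in * by lra.
    apply (derive_le_derive g g' phi phi'); auto.
    intros z Hz; unfold phi'; rewrite <- (Rabs_pos_eq z) at 2 by lra.
    apply Bd; rewrite Rabs_pos_eq; lra.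
  - rewrite (Rabs_left y) in * by lra.
    replace (g y) with (g (- - y)) by (f_equal; ring).
    apply (derive_le_derive (fun z => g (- z)) (fun z => - g' (- z)) phi phi'); auto; try lra.
    + now rewrite Ropp_0.
    + intros z Hz.
      replace (- g' (- z)) with ((-1) * g' (- z)) by ring.
      apply (is_derive_comp g Ropp); [apply D|].
      auto_derive; [easy | ring].
    + intros z Hz; rewrite Rabs_Ropp; unfold phi'.
      replace z with (Rabs (- z)) at 2 by (rewrite Rabs_left1; lra).
      apply Bd; rewrite Rabs_Ropp, Rabs_pos_eq; lra. }
unfold phi in Fin.
pose proof (Rmult_le_compat_l a _ _ Ha Hy); lra.
Qed.

Lemma weight_mono (M x y : R) : 0 < M -> Rabs x <= Rabs y ->
  exp (2 * M * Rabs x) <= exp (2 * M * Rabs y).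
Proof.
intros HM H; destruct H as [H|H]; [left; apply exp_increasing; nra | rewrite H; lra].
Qed.

Section Volterra.
Variables (m : nat) (beta gamma : R -> R).
Hypothesis (Sbeta : Sm beta) (Sgamma : Sm gamma).

(** [f' = volt_rhs f] is the integrated form of [(y^(m+1) f' / beta)' = y^m gamma f], the constant
    of integration being [0] for the solution regular at the singular point [y = 0]. *)
Definition volt_rhs (f : R -> R) (y : R) : R := beta y * Kop m (fun w => gamma w * f w) y.

(** The increments of Picard iteration started from the constant [1]. *)
Fixpoint volt_term (n : nat) (y : R) : R :=
  match n with
  | O => 1
  | S n => RInt (volt_rhs (volt_term n)) 0 y
  end.

Lemma volt_mult_continuous (f : R -> R) :
  (forall y, continuous f y) -> forall y, continuous (fun w => gamma w * f w) y.
Proof. intros C y; apply continuous_multR; [now apply Sm_continuous | apply C]. Qed.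

Lemma volt_rhs_continuous (f : R -> R) :
  (forall y, continuous f y) -> forall y, continuous (volt_rhs f) y.
Proof.
intros C y; apply continuous_multR; [now apply Sm_continuous|].
now apply Kop_continuous, volt_mult_continuous.
Qed.

Lemma volt_term_continuous (n : nat) : forall y, continuous (volt_term n) y.
Proof.
induction n as [|n IH]; intros y; [apply continuous_const|].
apply (is_derive_continuous (volt_term (S n)) y (volt_rhs (volt_term n) y)).
apply (is_derive_RInt0 (volt_rhs (volt_term n))); now apply volt_rhs_continuous.
Qed.

Lemma volt_term_is_derive (n : nat) (y : R) :
  is_derive (volt_term (S n)) y (volt_rhs (volt_term n) y).
Proof.
apply (is_derive_RInt0 (volt_rhs (volt_term n))), volt_rhs_continuous, volt_term_continuous.
Qed.

Lemma volt_term_S_0 (n : nat) : volt_term (S n) 0 = 0.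
Proof. simpl; apply (RInt_point (V := R_CompleteNormedModule)). Qed.

Lemma volt_rhs_diff (f1 f2 : R -> R) (Mb Mg e y : R) :
  (forall x, continuous f1 x) -> (forall x, continuous f2 x) ->
  Rabs (beta y) <= Mb ->
  (forall x, Rabs x <= Rabs y -> Rabs (gamma x) <= Mg) ->
  (forall x, Rabs x <= Rabs y -> Rabs (f1 x - f2 x) <= e) ->
  Rabs (volt_rhs f1 y - volt_rhs f2 y) <= Mb * Mg * e.
Proof.
intros C1 C2 Hb Hg He; unfold volt_rhs.
rewrite <- Rmult_minus_distr_l, Rabs_mult, Rmult_assoc.
apply Rmult_le_compat; try apply Rabs_pos; [exact Hb|].
apply Kop_diff; try now apply volt_mult_continuous.
intros s Hs; rewrite <- Rmult_minus_distr_l, Rabs_mult.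
pose proof (abs_scaled_le s y Hs).
apply Rmult_le_compat; try apply Rabs_pos; auto.
Qed.

Lemma volt_rhs_bound (f : R -> R) (Mb Mg e y : R) :
  (forall x, continuous f x) ->
  Rabs (beta y) <= Mb ->
  (forall x, Rabs x <= Rabs y -> Rabs (gamma x) <= Mg) ->
  (forall x, Rabs x <= Rabs y -> Rabs (f x) <= e) ->
  Rabs (volt_rhs f y) <= Mb * Mg * e.
Proof.
intros C Hb Hg He.
replace (volt_rhs f y) with (volt_rhs f y - volt_rhs (fun _ => 0) y).
- apply volt_rhs_diff; auto; [intros; apply continuous_const|].
  intros x Hx; rewrite Rminus_0_r; auto.
- unfold volt_rhs at 2.
  replace (fun w => gamma w * 0) with (fun _ : R => 0)
    by (apply functional_extensionality; intros; ring).
  rewrite Kop_0; ring.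
Qed.

(** Each iteration halves the norm weighted by [exp (2 * (Mb * Mg) * Rabs y)], so the series
    converges uniformly on every bounded interval. *)
Lemma volt_term_bound (Mb Mg L : R) :
  0 < Mb -> 0 < Mg ->
  (forall y, Rabs y <= L -> Rabs (beta y) <= Mb) ->
  (forall y, Rabs y <= L -> Rabs (gamma y) <= Mg) ->
  forall n y, Rabs y <= L ->
  Rabs (volt_term n y) <= (/ 2) ^ n * exp (2 * (Mb * Mg) * Rabs y).
Proof.
intros Pb Pg Hb Hg; set (M := Mb * Mg).
assert (HM : 0 < M) by now apply Rmult_lt_0_compat.
induction n as [|n IH]; intros y Hy.
- simpl; rewrite Rabs_R1, Rmult_1_l.
  pose proof (exp_ineq1_le (2 * M * Rabs y)); pose proof (Rabs_pos y); nra.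
- pose proof (weighted_bound (volt_term (S n)) (volt_rhs (volt_term n)) 0 M ((/ 2) ^ n) L) as W.
  replace ((/ 2) ^ S n * exp (2 * M * Rabs y)) with
    (0 * L + (/ 2) ^ n / 2 * exp (2 * M * Rabs y)) by (simpl; field).
  apply W; auto; try lra.
  + apply pow_le; lra.
  + apply volt_term_S_0.
  + apply volt_term_is_derive.
  + intros z Hz.
    rewrite Rplus_0_l, Rmult_assoc; unfold M at 1.
    apply volt_rhs_bound; [apply volt_term_continuous | now apply Hb | |].
    * intros x Hx; apply Hg; lra.
    * intros x Hx; eapply Rle_trans; [apply IH; lra|].
      apply Rmult_le_compat_l; [apply pow_le; lra | now apply weight_mono].
Qed.

Lemma Series_geom_tail (a : nat -> R) (C : R) (N : nat) :
  0 <= C -> (forall n, Rabs (a n) <= (/ 2) ^ n * C) ->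
  ex_series a /\ Rabs (Series a - sum_n a N) <= (/ 2) ^ N * C.
Proof.
intros HC H.
assert (half : Rabs (/ 2) < 1) by (rewrite Rabs_pos_eq; lra).
assert (G : ex_series (fun n => (/ 2) ^ n * C)).
{ apply ex_series_scal_r; eexists; now apply is_series_geom. }
assert (E : ex_series a) by (now apply (ex_series_le (V := R_CompleteNormedModule) a _ H)).
split; [exact E|].
rewrite (Series_incr_n a (S N)) by (lia || exact E).
rewrite sum_n_Reals; simpl Init.Nat.pred.
match goal with |- Rabs (?x + ?y - ?x) <= _ => replace (x + y - x) with y by ring end.
assert (Ht : forall n, 0 <= Rabs (a (S N + n)%nat) <= ((/ 2) ^ S N * C) * (/ 2) ^ n).
{ intros n; split; [apply Rabs_pos|]; eapply Rle_trans; [apply H|].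
  rewrite pow_add; right; ring. }
assert (G2 : ex_series (fun n => ((/ 2) ^ S N * C) * (/ 2) ^ n)).
{ apply (ex_series_scal_l (V := R_NormedModule) ((/ 2) ^ S N * C)); eexists; now apply is_series_geom. }
eapply Rle_trans; [apply Series_Rabs|].
- apply (ex_series_le (V := R_CompleteNormedModule) _ (fun n => ((/ 2) ^ S N * C) * (/ 2) ^ n)); [|exact G2].
  intros n; unfold norm; simpl; rewrite Rabs_Rabsolu; apply Ht.
- eapply Rle_trans; [apply (Series_le _ _ Ht G2)|].
  rewrite (Series_scal_l ((/ 2) ^ S N * C) (fun n => (/ 2) ^ n)), (Series_geom (/ 2)) by exact half.
  right; simpl; field.
Qed.

Definition volt_sol (y : R) : R := Series (fun n => volt_term n y).

Lemma volt_sol_spec :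
  Sm volt_sol /\ volt_sol 0 = 1 /\ (forall y, is_derive volt_sol y (volt_rhs volt_sol y)) /\
    ((forall y, 0 <= y <= 1 -> 0 <= beta y /\ 0 <= gamma y) ->
     forall y, 0 <= y <= 1 -> 1 <= volt_sol y).
Proof.
set (f := volt_sol).
set (S_ := (fun N y => sum_n (fun n => volt_term n y) N) : nat -> R -> R).
assert (tail : forall L, exists C, 0 < C /\ forall N y, Rabs y <= L ->
  ex_series (fun n => volt_term n y) /\ Rabs (f y - S_ N y) <= (/ 2) ^ N * C).
{ intros L.
  destruct (continuous_bounded beta (- L) L) as [Mb [Pb Hb]];
    [intros; now apply Sm_continuous|].
  destruct (continuous_bounded gamma (- L) L) as [Mg [Pg Hg]];
    [intros; now apply Sm_continuous|].
  exists (exp (2 * (Mb * Mg) * L)); split; [apply exp_pos|].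
  intros N y Hy; apply Series_geom_tail; [left; apply exp_pos|].
  intros n; eapply Rle_trans.
  - apply (volt_term_bound Mb Mg L); auto; intros; [apply Hb | apply Hg];
      now apply Rabs_le_between.
  - apply Rmult_le_compat_l; [apply pow_le; lra|].
    assert (0 < Mb * Mg) by now apply Rmult_lt_0_compat.
    destruct Hy as [Hy|Hy]; [left; apply exp_increasing; nra | rewrite Hy; lra]. }
assert (half0 : forall C eps, 0 < C -> 0 < eps -> exists N, forall n, (N <= n)%nat ->
  (/ 2) ^ n * C < eps).
{ intros C eps HC He.
  destruct (pow_lt_1_zero (/ 2) ltac:(rewrite Rabs_pos_eq; lra) (eps / C)
    (Rdiv_lt_0_compat _ _ He HC)) as [N HN].
  exists N; intros n Hn; specialize (HN n Hn).
  rewrite Rabs_pos_eq in HN by (apply pow_le; lra).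
  apply (Rmult_lt_compat_r C) in HN; [|exact HC].
  replace (eps / C * C) with eps in HN by (field; lra); exact HN. }
assert (SC : forall N y, continuous (S_ N) y).
{ intros N y; induction N as [|N IH].
  - apply (continuous_ext (volt_term 0)); [intros; unfold S_; now rewrite sum_O|].
    apply volt_term_continuous.
  - apply (continuous_ext (fun y => S_ N y + volt_term (S N) y)).
    + intros z; unfold S_; now rewrite sum_Sn.
    + apply (continuous_plus (S_ N) (volt_term (S N))); [exact IH | apply volt_term_continuous]. }
(* By linearity [volt_rhs] of a partial sum is the derivative of the next one; the equation for [f]
   then follows from the uniform convergence of both sides on bounded intervals. *)
assert (SD : forall N y, is_derive (S_ (S N)) y (volt_rhs (S_ N) y)).
{ intros N y; induction N as [|N IH].
  - apply (is_derive_ext (fun y => 1 + volt_term 1 y)).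
    { intros z; unfold S_; now rewrite sum_Sn, sum_O. }
    replace (volt_rhs (S_ O) y) with (0 + volt_rhs (volt_term 0) y).
    { apply (is_derive_plus (fun _ => 1) (volt_term 1)); [|apply volt_term_is_derive].
      apply (is_derive_const (V := R_NormedModule)). }
    rewrite Rplus_0_l; f_equal; apply functional_extensionality; intros z.
    unfold S_; now rewrite sum_O.
  - apply (is_derive_ext (fun y => S_ (S N) y + volt_term (S (S N)) y)).
    { intros z; unfold S_; now rewrite (sum_Sn _ (S N)). }
    replace (volt_rhs (S_ (S N)) y) with (volt_rhs (S_ N) y + volt_rhs (volt_term (S N)) y).
    { apply (is_derive_plus (S_ (S N)) (volt_term (S (S N)))); [exact IH | apply volt_term_is_derive]. }
    unfold volt_rhs; rewrite <- Rmult_plus_distr_l; f_equal; unfold Kop.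
    rewrite <- RInt_plusR.
    + apply RInt_ext; intros s _; unfold S_; rewrite sum_Sn; unfold plus; simpl; ring.
    + apply ex_RInt_cont, (Kop_integrand_continuous m (fun w => gamma w * S_ N w)),
        volt_mult_continuous, SC.
    + apply ex_RInt_cont,
        (Kop_integrand_continuous m (fun w => gamma w * volt_term (S N) w)),
        volt_mult_continuous, volt_term_continuous. }
assert (fC : forall y, continuous f y).
{ intros y; apply continuity_pt_filterlim.
  assert (HL : 0 < Rabs y + 1) by (pose proof (Rabs_pos y); lra).
  apply (CVU_continuity S_ f 0 (mkposreal _ HL)).
  - intros eps He; destruct (tail (Rabs y + 1)) as [C [HC T]].
    destruct (half0 C eps HC He) as [N HN].
    exists N; intros n z Hn Hz; unfold Boule in Hz; simpl in Hz; rewrite Rminus_0_r in Hz.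
    eapply Rle_lt_trans; [apply T; lra | now apply HN].
  - intros n z _; apply continuity_pt_filterlim, SC.
  - unfold Boule; simpl; rewrite Rminus_0_r; lra. }
assert (fD : forall y, is_derive f y (volt_rhs f y)).
{ intros y; apply is_derive_Reals.
  set (L := Rabs y + 1).
  assert (HL : 0 < L) by (unfold L; pose proof (Rabs_pos y); lra).
  destruct (tail L) as [C [HC T]].
  destruct (continuous_bounded beta (- L) L) as [Mb [Pb Hb]];
    [intros; now apply Sm_continuous|].
  destruct (continuous_bounded gamma (- L) L) as [Mg [Pg Hg]];
    [intros; now apply Sm_continuous|].
  apply (CVU_derivable (fun N => S_ (S N)) (fun N => volt_rhs (S_ N)) f (volt_rhs f) 0
    (mkposreal _ HL)).
  - intros eps He.
    assert (HC' : 0 < Mb * Mg * C) by (repeat apply Rmult_lt_0_compat; auto).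
    destruct (half0 _ eps HC' He) as [N HN].
    exists N; intros n z Hn Hz; unfold Boule in Hz; simpl in Hz; rewrite Rminus_0_r in Hz.
    eapply Rle_lt_trans; [|apply (HN n Hn)].
    replace ((/ 2) ^ n * (Mb * Mg * C)) with (Mb * Mg * ((/ 2) ^ n * C)) by ring.
    apply volt_rhs_diff; auto.
    + apply Hb; apply Rabs_le_between; lra.
    + intros x Hx; apply Hg; apply Rabs_le_between; lra.
    + intros x Hx; apply T; lra.
  - intros z Hz; unfold Boule in Hz; simpl in Hz; rewrite Rminus_0_r in Hz.
    intros eps He; destruct (half0 C eps HC He) as [N HN].
    exists N; intros n Hn; unfold R_dist, Rdist; rewrite Rabs_minus_sym.
    eapply Rle_lt_trans; [apply T; lra | apply HN; lia].
  - intros n z _; apply is_derive_Reals, SD.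
  - unfold Boule; simpl; rewrite Rminus_0_r; unfold L; lra. }
split; [|split; [|split]].
(* Bootstrap: [volt_rhs] preserves regularity, so the equation gains one derivative at a time. *)
- intros n; induction n as [|n IH]; [intros y _; apply fC|].
  exists (volt_rhs f); split; [intros; apply fD|].
  apply Ck_mult; [apply Sbeta|].
  apply Kop_Ck, Ck_mult; [apply Sgamma | exact IH].
- assert (S0 : forall N, S_ N 0 = 1).
  { induction N as [|N IH]; unfold S_ in *; [now rewrite sum_O|].
    rewrite sum_Sn, IH, volt_term_S_0; apply Rplus_0_r. }
  destruct (tail 0) as [C [HC T]].
  destruct (Req_dec (f 0) 1) as [E|E]; [exact E|].
  assert (P : 0 < Rabs (f 0 - 1)) by (apply Rabs_pos_lt; lra).
  destruct (half0 C _ HC P) as [N HN]; specialize (HN N (Nat.le_refl N)).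
  destruct (T N 0 ltac:(rewrite Rabs_R0; lra)) as [_ T']; rewrite S0 in T'; lra.
- apply fD.
(* With nonnegative coefficients all terms are nonnegative, and the one of index [0] is [1]. *)
- intros Hpos y Hy.
  assert (tn : forall n z, 0 <= z <= 1 -> 0 <= volt_term n z).
  { induction n as [|n IH]; intros z Hz; [simpl; lra|].
    simpl; apply RInt_ge_0; [lra | apply ex_RInt_cont, volt_rhs_continuous, volt_term_continuous|].
    intros x Hx; apply Rmult_le_pos; [apply Hpos; lra|].
    apply Kop_nonneg; [apply volt_mult_continuous, volt_term_continuous | lra|].
    intros w Hw; apply Rmult_le_pos; [apply Hpos; lra | apply IH; lra]. }
  assert (SN : forall N, 1 <= S_ N y).
  { induction N as [|N IH]; unfold S_ in *; [rewrite sum_O; simpl; lra|].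
    rewrite sum_Sn; unfold plus; cbn -[volt_term sum_n]; pose proof (tn (S N) y Hy); lra. }
  destruct (tail 1) as [C [HC T]].
  apply Rnot_lt_le; intros Hlt.
  destruct (half0 C (1 - f y) HC ltac:(lra)) as [N HN].
  specialize (HN N (Nat.le_refl N)).
  destruct (T N y ltac:(rewrite Rabs_pos_eq; lra)) as [_ T'].
  apply Rabs_le_between in T'; pose proof (SN N); lra.
Qed.
End Volterra.

Lemma is_derive_shift (f : R -> R) (c x d : R) :
  is_derive f (x + c) d -> is_derive (fun x => f (x + c)) x d.
Proof.
intros H; replace d with (1 * d) by ring.
apply (is_derive_comp f (fun x => x + c)); [exact H|].
auto_derive; [easy | reflexivity].
Qed.

Lemma is_derive_reflect (f : R -> R) (x d : R) :
  is_derive f (- x) d -> is_derive (fun x => f (- x)) x (- d).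
Proof.
intros H; replace (- d) with (-1 * d) by ring.
apply (is_derive_comp f Ropp); [exact H|].
auto_derive; [easy | reflexivity].
Qed.

Lemma le_of_le_half_pow (x a B : R) : (forall n, x <= a + B * (/ 2) ^ n) -> x <= a.
Proof.
intros H; apply Rnot_lt_le; intros Hx.
assert (HB : 0 < Rabs B + 1) by (pose proof (Rabs_pos B); lra).
destruct (pow_lt_1_zero (/ 2) ltac:(rewrite Rabs_pos_eq; lra) ((x - a) / (Rabs B + 1))
  ltac:(apply Rdiv_lt_0_compat; lra)) as [N HN].
specialize (HN N (Nat.le_refl N)); specialize (H N).
assert (P : 0 <= (/ 2) ^ N) by (apply pow_le; lra).
rewrite Rabs_pos_eq in HN by exact P.
apply (Rmult_lt_compat_r (Rabs B + 1)) in HN; [|exact HB].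
replace ((x - a) / (Rabs B + 1) * (Rabs B + 1)) with (x - a) in HN by (field; lra).
pose proof (Rle_abs B); nra.
Qed.

(** In place of Gronwall's inequality: starting from a crude bound [B], each pass through
    [weighted_bound] turns [2 a + B / 2^n] into [2 a + B / 2^(n+1)], where [a = Mb * d * F] measures
    the difference of the coefficients; the limit leaves [2 a]. *)
Lemma volt_stable (m : nat) (beta g1 g2 f1 f2 : R -> R) (Mb Mg F d : R) :
  Sm beta -> Sm g1 -> Sm g2 -> 0 < Mb -> 0 < Mg -> 0 <= F -> 0 <= d ->
  f1 0 = f2 0 ->
  (forall y, is_derive f1 y (volt_rhs m beta g1 f1 y)) ->
  (forall y, is_derive f2 y (volt_rhs m beta g2 f2 y)) ->
  (forall y, Rabs y <= 1 -> Rabs (beta y) <= Mb) ->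
  (forall y, Rabs y <= 1 -> Rabs (g2 y) <= Mg) ->
  (forall y, Rabs y <= 1 -> Rabs (f1 y) <= F) ->
  (forall y, Rabs y <= 1 -> Rabs (g1 y - g2 y) <= d) ->
  forall y, Rabs y <= 1 -> Rabs (f1 y - f2 y) <= 2 * (Mb * d * F) * exp (2 * (Mb * Mg)).
Proof.
intros Sb S1 S2 Pb Pg PF Pd E0 D1 D2 Hb Hg HF Hd.
assert (C1 : forall y, continuous f1 y) by (intros y; eapply is_derive_continuous; apply D1).
assert (C2 : forall y, continuous f2 y) by (intros y; eapply is_derive_continuous; apply D2).
set (M := Mb * Mg); assert (HM : 0 < M) by now apply Rmult_lt_0_compat.
set (a := Mb * d * F).
assert (Ha : 0 <= a) by (unfold a; repeat apply Rmult_le_pos; lra).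
set (g := fun y => f1 y - f2 y).
assert (Cg : forall y, continuous g y).
{ intros y; apply (continuous_minus f1 f2); auto. }
destruct (continuous_bounded g (-1) 1 Cg) as [B [HB Bg]].
assert (IH : forall n y, Rabs y <= 1 ->
  Rabs (g y) <= (2 * a + B * (/ 2) ^ n) * exp (2 * M * Rabs y)).
{ induction n as [|n IH]; intros y Hy.
  - simpl.
    assert (1 <= exp (2 * M * Rabs y)).
    { pose proof (exp_ineq1_le (2 * M * Rabs y)); pose proof (Rabs_pos y); nra. }
    pose proof (Bg y ltac:(now apply Rabs_le_between)); nra.
  - set (K := 2 * a + B * (/ 2) ^ n) in *.
    assert (HK : 0 <= K).
    { unfold K; assert (0 <= (/ 2) ^ n) by (apply pow_le; lra); nra. }
    pose proof (weighted_bound g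
      (fun y => volt_rhs m beta g1 f1 y - volt_rhs m beta g2 f2 y) a M K 1 Ha HM HK) as W.
    assert (W' : Rabs (g y) <= a * 1 + K / 2 * exp (2 * M * Rabs y)).
    { apply W; auto.
      - unfold g; rewrite E0; ring.
      - intros z; apply (is_derive_minus f1 f2); auto.
      - intros z Hz; unfold volt_rhs.
        rewrite <- Rmult_minus_distr_l, Rabs_mult.
        replace (a + M * K * exp (2 * M * Rabs z)) with
          (Mb * (d * F + Mg * (K * exp (2 * M * Rabs z)))) by (unfold a, M; ring).
        apply Rmult_le_compat; try apply Rabs_pos; [now apply Hb|].
        apply Kop_diff; try (intros; now apply volt_mult_continuous).
        intros s Hs; pose proof (abs_scaled_le s z Hs) as Hsz; set (w := s * z) in *.
        replace (g1 w * f1 w - g2 w * f2 w) with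
          ((g1 w - g2 w) * f1 w + g2 w * g w) by (unfold g; ring).
        eapply Rle_trans; [apply Rabs_triang|]; rewrite !Rabs_mult.
        apply Rplus_le_compat; apply Rmult_le_compat; try apply Rabs_pos.
        + apply Hd; lra.
        + apply HF; lra.
        + apply Hg; lra.
        + eapply Rle_trans; [apply IH; lra|].
          apply Rmult_le_compat_l; [exact HK | now apply weight_mono]. }
    assert (1 <= exp (2 * M * Rabs y)).
    { pose proof (exp_ineq1_le (2 * M * Rabs y)); pose proof (Rabs_pos y); nra. }
    replace (2 * a + B * (/ 2) ^ S n) with (a + K / 2) by (unfold K; simpl; field).
    nra. }
intros y Hy.
apply (le_of_le_half_pow _ _ (B * exp (2 * M))); intros n.
eapply Rle_trans; [apply (IH n y Hy)|].
fold M; fold a.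
replace (2 * a * exp (2 * M) + B * exp (2 * M) * (/ 2) ^ n) with
  ((2 * a + B * (/ 2) ^ n) * exp (2 * M)) by ring.
apply Rmult_le_compat_l.
- assert (0 <= (/ 2) ^ n) by (apply pow_le; lra); nra.
- destruct Hy as [Hy|Hy]; [left; apply exp_increasing; nra | rewrite Hy; right; f_equal; ring].
Qed.

(** * Shooting from one endpoint *)

(** [l lam] is the solution regular at [-1] of the degenerate Sturm-Liouville equation
    [((1-x^2)^(n+1) / A * l')' = (1-x^2)^n * (q - lam * b) * l], and [Phi lam] is the flux
    [(1-x^2)^(n+1) / A * l']. *)
Record half_family (n : nat) (A b q : R -> R) (l Phi : R -> R -> R) : Prop := {
  hf_smooth : forall lam, Sm (l lam);
  hf_m1 : forall lam, l lam (-1) = 1;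
  hf_Phi_m1 : forall lam, Phi lam (-1) = 0;
  hf_Phi : forall (lam x : R),
    is_derive (Phi lam) x ((1 - x ^ 2) ^ n * (q x - lam * b x) * l lam x);
  hf_l : forall lam x, -1 <= x <= / 2 ->
    (1 - x ^ 2) ^ S n * Derive (l lam) x = A x * Phi lam x;
  hf_lip : forall lam, exists C, 0 < C /\ forall mu, Rabs (mu - lam) <= 1 ->
    (forall x, -1 <= x <= 0 -> Rabs (l mu x - l lam x) <= C * Rabs (mu - lam)) /\
    Rabs (Phi mu 0 - Phi lam 0) <= C * Rabs (mu - lam);
  hf_0 : forall x, -1 <= x <= 0 -> 1 <= l 0 x }.

Lemma half_family_exists (n : nat) (A b q : R -> R) :
  Sm A -> Sm b -> Sm q -> (forall x, -1 <= x <= 1 -> 0 < A x) ->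
  (forall x, -1 <= x <= 1 -> 0 <= q x) -> exists l Phi, half_family n A b q l Phi.
Proof.
intros SA Sb Sq PA Pq.
(* With [y = x + 1], [1 - x^2 = y (2 - y)]; only the factor [y] stays singular. The other one is
   inverted on [[0, 3/2]], beyond the middle [y = 1], so that the equation still holds on both sides
   of the gluing point [x = 0]. *)
destruct (recip_extension 0 (3 / 2) (fun y => (2 - y) ^ S n)) as [rec [Srec Hrec]].
{ smooth_tac. }
{ intros y Hy; apply pow_lt; lra. }
set (beta := fun y => A (y - 1) * rec y).
set (gamma := fun lam y => (2 - y) ^ n * (q (y - 1) - lam * b (y - 1))).
assert (Sh : forall f, Sm f -> Sm (fun y => f (y - 1))).
{ intros f Sf; apply (Sm_comp f); [exact Sf | smooth_tac]. }
assert (Sbeta : Sm beta) by (unfold beta; smooth_tac; now apply Sh).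
assert (Sgamma : forall lam, Sm (gamma lam)).
{ intros lam; unfold gamma; smooth_tac; now apply Sh. }
set (f := fun lam => volt_sol n beta (gamma lam)).
set (G := fun lam y => gamma lam y * f lam y).
assert (spec := fun lam => volt_sol_spec n beta (gamma lam) Sbeta (Sgamma lam)).
assert (Sf : forall lam, Sm (f lam)) by (intros; apply spec).
assert (Df : forall lam y, is_derive (f lam) y (volt_rhs n beta (gamma lam) (f lam) y))
  by (intros; apply spec).
assert (SG : forall lam, Sm (G lam)).
{ intros lam; unfold G; apply smooth_on_mult; auto. }
exists (fun lam x => f lam (x + 1)),
  (fun lam x => (x + 1) ^ S n * Kop n (G lam) (x + 1)).
assert (Bq : forall x, (1 - x ^ 2) ^ n = (x + 1) ^ n * (2 - (x + 1)) ^ n).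
{ intros x; rewrite <- Rpow_mult_distr; f_equal; ring. }
split.
- intros lam; apply (Sm_comp (f lam)); [apply Sf | smooth_tac].
- intros lam; replace (-1 + 1) with 0 by ring; apply spec.
- intros lam; replace (-1 + 1) with 0 by ring; rewrite pow_i by lia; ring.
- intros lam x.
  rewrite Bq.
  replace ((x + 1) ^ n * (2 - (x + 1)) ^ n * (q x - lam * b x) * f lam (x + 1)) with
    ((x + 1) ^ n * G lam (x + 1)).
  2: { unfold G, gamma; replace (x + 1 - 1) with x by ring; ring. }
  apply (is_derive_shift (fun y => y ^ S n * Kop n (G lam) y)).
  apply Kop_pow_is_derive; intros y; now apply Sm_continuous.
- intros lam x Hx.
  replace (Derive (fun x => f lam (x + 1)) x) with
    (volt_rhs n beta (gamma lam) (f lam) (x + 1)).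
  2: { symmetry; apply is_derive_unique.
    apply (is_derive_shift (f lam)), Df. }
  unfold volt_rhs, beta; rewrite Hrec by lra.
  fold (G lam).
  replace (x + 1 - 1) with x by ring.
  replace ((1 - x ^ 2) ^ S n) with ((x + 1) ^ S n * (2 - (x + 1)) ^ S n)
    by (rewrite <- Rpow_mult_distr; f_equal; ring).
  assert ((2 - (x + 1)) ^ S n <> 0) by (apply pow_nonzero; lra).
  change (fun w => gamma lam w * f lam w) with (G lam).
  field; exact H.
- intros lam.
  destruct (continuous_bounded beta (-1) 1) as [Mb [Pb Hb]];
    [intros; now apply Sm_continuous|].
  destruct (continuous_bounded (gamma lam) (-1) 1) as [Mg [Pg Hg]];
    [intros; now apply Sm_continuous|].
  destruct (continuous_bounded (f lam) (-1) 1) as [F [PF HF]];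
    [intros; now apply Sm_continuous|].
  destruct (continuous_bounded (fun y => (2 - y) ^ n * b (y - 1)) (-1) 1) as [N [PN HN]].
  { intros y; apply Sm_continuous; smooth_tac; now apply Sh. }
  (* The constant of [volt_stable] when the coefficients differ by [N * Rabs (mu - lam)]; [Mg + N]
     bounds [gamma mu] for [mu] within [1] of [lam]. *)
  set (C1 := 2 * (Mb * N * F) * exp (2 * (Mb * (Mg + N)))).
  assert (PC1 : 0 < C1).
  { unfold C1; apply Rmult_lt_0_compat; [|apply exp_pos].
    apply Rmult_lt_0_compat; [lra|]; repeat apply Rmult_lt_0_compat; auto. }
  assert (Dg : forall mu y, Rabs y <= 1 ->
    Rabs (gamma lam y - gamma mu y) <= N * Rabs (mu - lam)).
  { intros mu y Hy; unfold gamma.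
    replace ((2 - y) ^ n * (q (y - 1) - lam * b (y - 1)) -
      (2 - y) ^ n * (q (y - 1) - mu * b (y - 1))) with
      (((2 - y) ^ n * b (y - 1)) * (mu - lam)) by ring.
    rewrite Rabs_mult; apply Rmult_le_compat_r; [apply Rabs_pos|].
    apply HN; now apply Rabs_le_between. }
  assert (Bg : forall mu y, Rabs (mu - lam) <= 1 -> Rabs y <= 1 ->
    Rabs (gamma mu y) <= Mg + N).
  { intros mu y Hmu Hy.
    replace (gamma mu y) with (gamma lam y - (gamma lam y - gamma mu y)) by ring.
    eapply Rle_trans; [apply Rabs_triang|]; rewrite Rabs_Ropp.
    apply Rplus_le_compat; [apply Hg; now apply Rabs_le_between|].
    eapply Rle_trans; [now apply Dg|].
    pose proof (Rabs_pos (mu - lam)); nra. }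
  assert (L1 : forall mu, Rabs (mu - lam) <= 1 -> forall y, Rabs y <= 1 ->
    Rabs (f lam y - f mu y) <= C1 * Rabs (mu - lam)).
  { intros mu Hmu y Hy.
    replace (C1 * Rabs (mu - lam)) with
      (2 * (Mb * (N * Rabs (mu - lam)) * F) * exp (2 * (Mb * (Mg + N))))
      by (unfold C1; ring).
    apply (volt_stable n beta (gamma lam) (gamma mu)); auto; try lra.
    - apply Rmult_le_pos; [lra | apply Rabs_pos].
    - transitivity 1; [apply spec | symmetry; apply spec].
    - intros z Hz; apply Hb; now apply Rabs_le_between.
    - intros z Hz; apply HF; now apply Rabs_le_between. }
  exists (C1 + (N * F + (Mg + N) * C1)).
  assert (P2 : 0 < N * F + (Mg + N) * C1).
  { apply Rplus_lt_0_compat; apply Rmult_lt_0_compat; lra. }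
  split; [lra|]; intros mu Hmu; split.
  + intros x Hx; rewrite Rabs_minus_sym.
    eapply Rle_trans; [apply L1; [exact Hmu | rewrite Rabs_pos_eq; lra]|].
    apply Rmult_le_compat_r; [apply Rabs_pos | lra].
  + rewrite Rplus_0_l, pow1, !Rmult_1_l, Rabs_minus_sym.
    apply (Rle_trans _ ((N * F + (Mg + N) * C1) * Rabs (mu - lam)));
      [|apply Rmult_le_compat_r; [apply Rabs_pos | lra]].
    apply Kop_diff; try (intros; now apply Sm_continuous).
    intros s Hs; rewrite Rmult_1_r.
    assert (Hs1 : Rabs s <= 1) by (rewrite Rabs_pos_eq; lra).
    unfold G.
    replace (gamma lam s * f lam s - gamma mu s * f mu s) with
      ((gamma lam s - gamma mu s) * f lam s + gamma mu s * (f lam s - f mu s)) by ring.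
    eapply Rle_trans; [apply Rabs_triang|]; rewrite !Rabs_mult.
    replace ((N * F + (Mg + N) * C1) * Rabs (mu - lam)) with
      ((N * Rabs (mu - lam)) * F + (Mg + N) * (C1 * Rabs (mu - lam))) by ring.
    apply Rplus_le_compat; apply Rmult_le_compat; try apply Rabs_pos; auto.
    apply HF; lra.
- intros x Hx; apply spec; [|lra].
  intros y Hy; unfold beta, gamma; rewrite Hrec by lra.
  pose proof (PA (y - 1) ltac:(lra)); pose proof (Pq (y - 1) ltac:(lra)).
  split.
  + apply Rmult_le_pos; [lra|]; left; apply Rinv_0_lt_compat, pow_lt; lra.
  + apply Rmult_le_pos; [apply pow_le; lra | lra].
Qed.

(** * Sign and continuity arguments for the half solutions *)

Lemma MVT_open (f f' : R -> R) (a b : R) :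
  a < b -> (forall x, a <= x <= b -> continuous f x) ->
  (forall x, a < x < b -> is_derive f x (f' x)) ->
  exists c, a < c < b /\ f b - f a = f' c * (b - a).
Proof.
intros Hab C D.
assert (pr : forall c, a < c < b -> derivable_pt f c).
{ intros c Hc; exists (f' c); now apply is_derive_Reals, D. }
destruct (MVT f id a b pr (fun c _ => derivable_pt_id c) Hab) as [c [Hc E]].
- intros c Hc; now apply continuity_pt_filterlim, C.
- intros c _; apply derivable_continuous_pt, derivable_pt_id.
- exists c; split; [exact Hc|].
  rewrite derive_pt_id in E.
  assert (Ec : derive_pt f c (pr c Hc) = f' c).
  { rewrite Derive_Reals; now apply is_derive_unique, D. }
  rewrite Ec in E; unfold id in E; lra.
Qed.

Lemma increasing_open (f f' : R -> R) (a b : R) :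
  a < b -> (forall x, a <= x <= b -> continuous f x) ->
  (forall x, a < x < b -> is_derive f x (f' x)) ->
  (forall x, a < x < b -> 0 < f' x) -> f a < f b.
Proof.
intros Hab C D P; destruct (MVT_open f f' a b Hab C D) as [c [Hc E]].
pose proof (P c Hc); nra.
Qed.

Lemma nondecreasing_open (f f' : R -> R) (a b : R) :
  a <= b -> (forall x, a <= x <= b -> continuous f x) ->
  (forall x, a < x < b -> is_derive f x (f' x)) ->
  (forall x, a < x < b -> 0 <= f' x) -> f a <= f b.
Proof.
intros [Hab| ->] C D P; [|lra].
destruct (MVT_open f f' a b Hab C D) as [c [Hc E]].
pose proof (P c Hc); nra.
Qed.

Lemma continuity_pt_pos (D : R -> R) (lam : R) :
  continuity_pt D lam -> 0 < D lam ->
  exists d, 0 < d /\ forall mu, Rabs (mu - lam) < d -> 0 < D mu.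
Proof.
intros C P; destruct (C (D lam) P) as [d [Pd Hd]].
exists d; split; [exact Pd|]; intros mu Hmu.
destruct (Req_dec mu lam) as [->|N]; [exact P|].
assert (H : Rabs (D mu - D lam) < D lam).
{ apply (Hd mu); split; [split; [exact I | auto] | exact Hmu]. }
apply Rabs_lt_between in H; lra.
Qed.

Lemma continuity_pt_limit_nonneg (D : R -> R) (lam : R) :
  continuity_pt D lam -> 0 < lam -> (forall mu, 0 <= mu < lam -> 0 < D mu) -> 0 <= D lam.
Proof.
intros C Hl H; apply Rnot_lt_le; intros N.
destruct (continuity_pt_pos (fun x => - D x) lam (continuity_pt_opp D lam C) ltac:(lra))
  as [d [Pd Hd]].
set (mu := Rmax 0 (lam - d / 2)).
assert (Hmu : 0 <= mu < lam /\ lam - d < mu).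
{ unfold mu; split; [split; [apply Rmax_l | apply Rmax_lub_lt; lra]|].
  eapply Rlt_le_trans; [|apply Rmax_r]; lra. }
assert (Hm : Rabs (mu - lam) < d) by (rewrite Rabs_left; lra).
pose proof (H mu ltac:(lra)); pose proof (Hd mu Hm); lra.
Qed.

Lemma lipschitz_continuity_pt (D : R -> R) (lam C : R) :
  0 < C -> (forall mu, Rabs (mu - lam) <= 1 -> Rabs (D mu - D lam) <= C * Rabs (mu - lam)) ->
  continuity_pt D lam.
Proof.
intros HC H eps He; exists (Rmin 1 (eps / C)); split.
{ apply Rmin_case; [lra | now apply Rdiv_lt_0_compat]. }
intros mu [_ Hmu]; simpl in *; unfold R_dist, Rdist in *.
assert (H1 : Rabs (mu - lam) < 1) by (eapply Rlt_le_trans; [exact Hmu | apply Rmin_l]).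
assert (H2 : Rabs (mu - lam) < eps / C) by (eapply Rlt_le_trans; [exact Hmu | apply Rmin_r]).
eapply Rle_lt_trans; [apply H; lra|].
apply (Rmult_lt_compat_l C) in H2; [|exact HC].
replace (C * (eps / C)) with eps in H2 by (field; lra); exact H2.
Qed.

Section HalfFamily.
Variables (n : nat) (A b q : R -> R) (l Phi : R -> R -> R).
Hypothesis HF : half_family n A b q l Phi.
Hypothesis PA : forall x, -1 <= x <= 1 -> 0 < A x.
Hypothesis Pb : forall x, -1 <= x <= 1 -> 0 < b x.
Hypothesis Pq : forall x, -1 < x < 1 -> 0 < q x.

Lemma half_continuity (x lam : R) : -1 <= x <= 0 -> continuity_pt (fun mu => l mu x) lam.
Proof.
intros Hx; destruct (hf_lip _ _ _ _ _ _ HF lam) as [C [HC L]].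
apply (lipschitz_continuity_pt _ lam C HC); intros mu Hmu; now apply L.
Qed.

Lemma half_Phi_continuity (lam : R) : continuity_pt (fun mu => Phi mu 0) lam.
Proof.
destruct (hf_lip _ _ _ _ _ _ HF lam) as [C [HC L]].
apply (lipschitz_continuity_pt _ lam C HC); intros mu Hmu; now apply L.
Qed.

Lemma half_continuous (lam x : R) : continuous (l lam) x.
Proof. apply Sm_continuous, (hf_smooth _ _ _ _ _ _ HF). Qed.

Lemma half_Phi_continuous (lam x : R) : continuous (Phi lam) x.
Proof. eapply is_derive_continuous, (hf_Phi _ _ _ _ _ _ HF). Qed.

Lemma half_pos_open (lam : R) : (forall x, -1 <= x <= 0 -> 0 < l lam x) ->
  exists d, 0 < d /\ forall mu, Rabs (mu - lam) < d -> forall x, -1 <= x <= 0 -> 0 < l mu x.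
Proof.
intros P.
destruct (continuity_ab_min (l lam) (-1) 0 ltac:(lra)) as [c [Hc Pc]].
{ intros y _; apply continuity_pt_filterlim, half_continuous. }
specialize (P c Pc).
destruct (hf_lip _ _ _ _ _ _ HF lam) as [C [HC L]].
exists (Rmin 1 (l lam c / (2 * C))); split.
{ apply Rmin_case; [lra | apply Rdiv_lt_0_compat; lra]. }
intros mu Hmu x Hx.
assert (H1 : Rabs (mu - lam) < 1) by (eapply Rlt_le_trans; [exact Hmu | apply Rmin_l]).
assert (H2 : Rabs (mu - lam) < l lam c / (2 * C))
  by (eapply Rlt_le_trans; [exact Hmu | apply Rmin_r]).
destruct (L mu ltac:(lra)) as [L1 _]; specialize (L1 x Hx).
apply Rabs_le_between in L1.
apply (Rmult_lt_compat_l C) in H2; [|exact HC].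
replace (C * (l lam c / (2 * C))) with (l lam c / 2) in H2 by (field; lra).
pose proof (Hc x Hx); lra.
Qed.

Lemma rho_pos (x : R) : -1 < x < 1 -> 0 < 1 - x ^ 2.
Proof. intros; nra. Qed.

Lemma half_Phi_neg (lam : R) :
  (forall x, -1 < x < 0 -> 0 < l lam x) -> (forall x, -1 < x < 0 -> q x - lam * b x < 0) ->
  Phi lam 0 < 0.
Proof.
intros P N.
enough (- Phi lam (-1) < - Phi lam 0) by (rewrite (hf_Phi_m1 _ _ _ _ _ _ HF) in H; lra).
apply (increasing_open (fun x => - Phi lam x)
  (fun x => - ((1 - x ^ 2) ^ n * (q x - lam * b x) * l lam x))); [lra | | |].
- intros x _; apply (continuous_opp (Phi lam)), half_Phi_continuous.
- intros x _; apply (is_derive_opp (Phi lam)), (hf_Phi _ _ _ _ _ _ HF).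
- intros x Hx.
  assert (0 < (1 - x ^ 2) ^ n) by (apply pow_lt, rho_pos; lra).
  replace (- ((1 - x ^ 2) ^ n * (q x - lam * b x) * l lam x)) with
    ((1 - x ^ 2) ^ n * (lam * b x - q x) * l lam x) by ring.
  pose proof (N x Hx); repeat apply Rmult_lt_0_compat; auto; lra.
Qed.

Lemma half_0_pos (x : R) : -1 <= x <= 0 -> 0 < l 0 x.
Proof. intros Hx; pose proof (hf_0 _ _ _ _ _ _ HF x Hx); lra. Qed.

Lemma half_Phi_0_pos : 0 < Phi 0 0.
Proof.
enough (Phi 0 (-1) < Phi 0 0) by (rewrite (hf_Phi_m1 _ _ _ _ _ _ HF) in H; exact H).
apply (increasing_open (Phi 0) (fun x => (1 - x ^ 2) ^ n * (q x - 0 * b x) * l 0 x)); [lra | | |].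
- intros x _; apply half_Phi_continuous.
- intros x _; apply (hf_Phi _ _ _ _ _ _ HF).
- intros x Hx.
  assert (0 < (1 - x ^ 2) ^ n) by (apply pow_lt, rho_pos; lra).
  rewrite Rmult_0_l, Rminus_0_r.
  repeat apply Rmult_lt_0_compat; auto; [apply Pq; lra | apply half_0_pos; lra].
Qed.

Lemma half_derive (lam x : R) : -1 < x <= / 2 ->
  Derive (l lam) x = A x * Phi lam x / (1 - x ^ 2) ^ S n.
Proof.
intros Hx; rewrite <- (hf_l _ _ _ _ _ _ HF) by lra.
field; apply pow_nonzero; pose proof (rho_pos x ltac:(lra)); lra.
Qed.

(** The Wronskian with the solution for [lam = 0] decreases strictly from [0], so that
    the solution for [lam] has no double zero. *)
Lemma half_wronskian (lam x : R) : 0 < lam ->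
  (forall x, -1 <= x <= 0 -> 0 <= l lam x) -> -1 < x <= 0 ->
  Phi lam x * l 0 x - Phi 0 x * l lam x < 0.
Proof.
intros Hl P Hx.
set (W := fun x => Phi lam x * l 0 x - Phi 0 x * l lam x).
set (W' := fun x => - (lam * (1 - x ^ 2) ^ n * b x * l lam x * l 0 x)).
assert (DW : forall y, -1 < y <= / 2 -> is_derive W y (W' y)).
{ intros y Hy; unfold W.
  pose proof (hf_Phi _ _ _ _ _ _ HF lam y) as D1.
  pose proof (hf_Phi _ _ _ _ _ _ HF 0 y) as D2.
  pose proof (Sm_is_derive (l lam) y (hf_smooth _ _ _ _ _ _ HF lam)) as D3.
  pose proof (Sm_is_derive (l 0) y (hf_smooth _ _ _ _ _ _ HF 0)) as D4.
  rewrite half_derive in D3, D4 by exact Hy.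
  apply is_derive_Reals; apply is_derive_Reals in D1, D2, D3, D4.
  pose proof (derivable_pt_lim_minus _ _ _ _ _ (derivable_pt_lim_mult _ _ _ _ _ D1 D4)
    (derivable_pt_lim_mult _ _ _ _ _ D2 D3)) as D.
  unfold minus_fct, mult_fct in D.
  match type of D with derivable_pt_lim _ _ ?v => replace (W' y) with v; [exact D|] end.
  unfold W'; field; apply pow_nonzero; pose proof (rho_pos y ltac:(lra)); lra. }
assert (CW : forall y, continuous W y).
{ intros y; apply (continuous_minus (fun x => Phi lam x * l 0 x) (fun x => Phi 0 x * l lam x));
    apply continuous_multR; auto using half_continuous, half_Phi_continuous. }
assert (W0 : W (-1) = 0) by (unfold W; rewrite !(hf_Phi_m1 _ _ _ _ _ _ HF); ring).
(* Strictness is won near the pole, where [l lam] is close to its value [1]; further on only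
   [0 <= l lam] is available. *)
assert (N1 : exists y, -1 < y <= x /\ forall z, -1 <= z <= y -> 0 < l lam z).
{ destruct (continuity_pt_pos (l lam) (-1)) as [d [Pd Hd]].
  - apply continuity_pt_filterlim, half_continuous.
  - rewrite (hf_m1 _ _ _ _ _ _ HF); lra.
  - exists (Rmin x (-1 + d / 2)); split.
    + split; [apply Rmin_glb_lt; lra | apply Rmin_l].
    + intros z Hz; apply Hd; pose proof (Rmin_r x (-1 + d / 2)).
      rewrite Rabs_pos_eq; lra. }
destruct N1 as [y [Hy Py]].
assert (I1 : W y < 0).
{ enough (- W (-1) < - W y) by lra.
  apply (increasing_open (fun x => - W x) (fun x => - W' x)); [lra | | |].
  - intros z _; apply (continuous_opp W), CW.
  - intros z Hz; apply (is_derive_opp W), DW; lra.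
  - intros z Hz; unfold W'; rewrite Ropp_involutive.
    repeat apply Rmult_lt_0_compat; auto.
    + apply pow_lt, rho_pos; lra.
    + apply Pb; lra.
    + apply Py; lra.
    + apply half_0_pos; lra. }
assert (I2 : - W y <= - W x).
{ apply (nondecreasing_open (fun x => - W x) (fun x => - W' x)); [lra | | |].
  - intros z _; apply (continuous_opp W), CW.
  - intros z Hz; apply (is_derive_opp W), DW; lra.
  - intros z Hz; unfold W'; rewrite Ropp_involutive.
    repeat apply Rmult_le_pos; auto; try lra.
    + apply pow_le; pose proof (rho_pos z ltac:(lra)); lra.
    + left; apply Pb; lra.
    + apply P; lra.
    + left; apply half_0_pos; lra. }
fold (W x); lra.
Qed.

(** At an interior zero a nonnegative solution has a minimum, so its flux vanishes as well, and the
    Wronskian would be [0] instead of negative. At the end [0] only one side is controlled, and the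
    sign of the Wronskian gives the sign of the flux. *)
Lemma half_nonneg_pos (lam : R) : 0 < lam ->
  (forall x, -1 <= x <= 0 -> 0 <= l lam x) ->
  (forall x, -1 <= x < 0 -> 0 < l lam x) /\ (l lam 0 = 0 -> Phi lam 0 < 0).
Proof.
intros Hl P; split.
- intros x Hx.
  destruct (Req_dec x (-1)) as [->|Nx]; [rewrite (hf_m1 _ _ _ _ _ _ HF); lra|].
  destruct (P x ltac:(lra)) as [H|H]; [exact H | exfalso].
  pose proof (half_wronskian lam x Hl P ltac:(lra)) as Wn; rewrite <- H in Wn.
  assert (pr : derivable_pt (l lam) x).
  { apply ex_derive_Reals_0, Sm_ex_derive, (hf_smooth _ _ _ _ _ _ HF). }
  pose proof (deriv_minimum (l lam) (-1) 0 x pr ltac:(lra) ltac:(lra)) as Dm.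
  rewrite Derive_Reals, half_derive in Dm by lra.
  assert (Hp : Phi lam x = 0).
  { assert (0 < (1 - x ^ 2) ^ S n) by (apply pow_lt, rho_pos; lra).
    pose proof (PA x ltac:(lra)).
    assert (E : A x * Phi lam x / (1 - x ^ 2) ^ S n = 0).
    { apply Dm; intros z Hz1 Hz2; rewrite <- H; apply P; lra. }
    apply (Rmult_eq_compat_r ((1 - x ^ 2) ^ S n)) in E.
    replace (A x * Phi lam x / (1 - x ^ 2) ^ S n * (1 - x ^ 2) ^ S n) with (A x * Phi lam x)
      in E by (field; lra).
    nra. }
  rewrite Hp in Wn; lra.
- intros E; pose proof (half_wronskian lam 0 Hl P ltac:(lra)) as Wn.
  rewrite E in Wn; pose proof (half_0_pos 0 ltac:(lra)); nra.
Qed.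
End HalfFamily.

(** * The ground state *)

Definition glue (f1 f2 : R -> R) (x : R) : R := if Rle_dec x 0 then f1 x else f2 x.

Lemma glue_left (f1 f2 : R -> R) (x : R) : x <= 0 -> glue f1 f2 x = f1 x.
Proof. intros H; unfold glue; destruct (Rle_dec x 0); [easy | lra]. Qed.

Lemma glue_right (f1 f2 : R -> R) (x : R) : f1 0 = f2 0 -> 0 <= x -> glue f1 f2 x = f2 x.
Proof.
intros E H; unfold glue; destruct (Rle_dec x 0); [|easy].
now replace x with 0 by lra.
Qed.

Lemma glue_is_derive (f1 f2 : R -> R) (x d : R) :
  f1 0 = f2 0 -> (x <= 0 -> is_derive f1 x d) -> (0 <= x -> is_derive f2 x d) ->
  is_derive (glue f1 f2) x d.
Proof.
intros E D1 D2; destruct (Rtotal_order x 0) as [H|[->|H]].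
- apply (is_derive_ext_loc f1); [|apply D1; lra].
  apply (filter_imp (fun y => y < 0)); [|now apply open_lt].
  intros y Hy; symmetry; apply glue_left; lra.
- specialize (D1 (Rle_refl 0)); specialize (D2 (Rle_refl 0)).
  apply is_derive_Reals in D1, D2; apply is_derive_Reals; intros eps He.
  destruct (D1 eps He) as [d1 H1], (D2 eps He) as [d2 H2].
  assert (Pd : 0 < Rmin d1 d2) by (apply Rmin_case; apply cond_pos).
  exists (mkposreal _ Pd); simpl; intros h Nh Hh.
  rewrite (glue_left _ _ 0) by lra.
  destruct (Rle_dec h 0) as [P|P].
  + rewrite Rplus_0_l, glue_left by exact P.
    specialize (H1 h Nh); rewrite Rplus_0_l in H1; apply H1.
    eapply Rlt_le_trans; [exact Hh | apply Rmin_l].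
  + rewrite Rplus_0_l, glue_right, E by (exact E || lra).
    specialize (H2 h Nh); rewrite Rplus_0_l in H2; apply H2.
    eapply Rlt_le_trans; [exact Hh | apply Rmin_r].
- apply (is_derive_ext_loc f2); [|apply D2; lra].
  apply (filter_imp (fun y => 0 < y)); [|now apply open_gt].
  intros y Hy; symmetry; apply glue_right; [exact E | lra].
Qed.

(** The derivative of each unknown is a smooth multiple of the other, so regularity bootstraps. This
    makes two half solutions smooth across [0] as soon as their values and fluxes agree there. *)
Lemma linear_system_Ck (U : R -> Prop) (a1 a2 h k : R -> R) (n : nat) :
  smooth_on U a1 -> smooth_on U a2 ->
  (forall x, U x -> is_derive h x (a1 x * k x)) ->
  (forall x, U x -> is_derive k x (a2 x * h x)) -> Ck U n h /\ Ck U n k.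
Proof.
intros S1 S2 Dh Dk; induction n as [|n [IHh IHk]].
- split; intros x Hx; eapply is_derive_continuous; auto.
- split; eexists; split; [exact Dh | | exact Dk |]; apply Ck_mult; auto.
Qed.

(** Shooting: the half solutions from both endpoints are positive and meet at [0] in a concave
    kink ([D > 0]) for [lam = 0]; at the first [lam] where this fails, they fit together. *)
Theorem ground_state (n : nat) (A b q : R -> R) :
  Sm A -> Sm b -> Sm q ->
  (forall x, -1 <= x <= 1 -> 0 < A x) -> (forall x, -1 <= x <= 1 -> 0 < b x) ->
  (forall x, -1 <= x <= 1 -> 0 <= q x) -> (forall x, -1 < x < 1 -> 0 < q x) ->
  exists (lam : R) (h Phi : R -> R), 0 < lam /\ Sm h /\
    (forall x, -1 <= x <= 1 -> 0 < h x) /\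
    forall x, -1 < x < 1 ->
      is_derive h x (A x * Phi x / (1 - x ^ 2) ^ S n) /\
      is_derive Phi x ((1 - x ^ 2) ^ n * (q x - lam * b x) * h x).
Proof.
intros SA Sb Sq PA Pb Nq Pq.
set (rf := fun (f : R -> R) x => f (- x)).
assert (Srf : forall f, Sm f -> Sm (rf f)).
{ intros f Sf; apply (Sm_comp f); [exact Sf | smooth_tac]. }
destruct (half_family_exists n A b q SA Sb Sq PA Nq) as [l [Pl HL]].
destruct (half_family_exists n (rf A) (rf b) (rf q)) as [r [Pr HR]]; auto.
{ intros x Hx; apply PA; lra. }
{ intros x Hx; apply Nq; lra. }
assert (PA' : forall x, -1 <= x <= 1 -> 0 < rf A x) by (intros x Hx; apply PA; lra).
assert (Pb' : forall x, -1 <= x <= 1 -> 0 < rf b x) by (intros x Hx; apply Pb; lra).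
assert (Pq' : forall x, -1 < x < 1 -> 0 < rf q x) by (intros x Hx; apply Pq; lra).
(* Reflection changes the sign of the flux of [r], so [D mu] is the Wronskian at [0] of [l mu] and
   [x |-> r mu (- x)]. *)
set (D := fun mu => Pl mu 0 * r mu 0 + l mu 0 * Pr mu 0).
assert (CD : forall lam, continuity_pt D lam).
{ intros lam.
  apply (continuity_pt_plus (fun mu => Pl mu 0 * r mu 0) (fun mu => l mu 0 * Pr mu 0)).
  - apply (continuity_pt_mult (fun mu => Pl mu 0) (fun mu => r mu 0)).
    + eapply half_Phi_continuity; eassumption.
    + eapply half_continuity; [eassumption | lra].
  - apply (continuity_pt_mult (fun mu => l mu 0) (fun mu => Pr mu 0)).
    + eapply half_continuity; [eassumption | lra].
    + eapply half_Phi_continuity; eassumption. }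
set (good := fun mu => (forall x, -1 <= x <= 0 -> 0 < l mu x) /\
  (forall x, -1 <= x <= 0 -> 0 < r mu x) /\ 0 < D mu).
assert (Gopen : forall lam, good lam ->
  exists d, 0 < d /\ forall mu, Rabs (mu - lam) < d -> good mu).
{ intros lam [G1 [G2 G3]].
  destruct (half_pos_open _ _ _ _ _ _ HL lam G1) as [d1 [P1 H1]].
  destruct (half_pos_open _ _ _ _ _ _ HR lam G2) as [d2 [P2 H2]].
  destruct (continuity_pt_pos D lam (CD lam) G3) as [d3 [P3 H3]].
  exists (Rmin d1 (Rmin d2 d3)); split; [repeat apply Rmin_case; auto|].
  intros mu Hmu.
  pose proof (Rmin_l d1 (Rmin d2 d3)); pose proof (Rmin_r d1 (Rmin d2 d3)).
  pose proof (Rmin_l d2 d3); pose proof (Rmin_r d2 d3).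
  repeat split; [apply H1 | apply H2 | apply H3]; lra. }
assert (G0 : good 0).
{ split; [|split].
  - eapply half_0_pos; eassumption.
  - eapply half_0_pos; eassumption.
  - pose proof (half_Phi_0_pos _ _ _ _ _ _ HL Pq).
    pose proof (half_Phi_0_pos _ _ _ _ _ _ HR Pq').
    pose proof (half_0_pos _ _ _ _ _ _ HL 0 ltac:(lra)).
    pose proof (half_0_pos _ _ _ _ _ _ HR 0 ltac:(lra)).
    unfold D; nra. }
destruct (continuity_ab_min b (-1) 1 ltac:(lra)) as [xb [Hxb Ixb]].
{ intros y _; now apply Sm_continuity_pt. }
destruct (continuous_bounded q (-1) 1) as [Mq [PMq HMq]];
  [intros; now apply Sm_continuous|].
(* Large enough to make [q - Lam * b] negative everywhere; for positive half solutions both fluxes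
   at [0], and hence [D], would then be negative. *)
set (Lam := (Mq + 1) / b xb).
assert (NG : ~ good Lam).
{ intros [G1 [G2 G3]].
  assert (Neg : forall x, -1 < x < 1 -> q x - Lam * b x < 0).
  { intros x Hx; pose proof (HMq x ltac:(lra)) as B; apply Rabs_le_between in B.
    pose proof (Hxb x ltac:(lra)) as Bx; pose proof (Pb xb Ixb).
    assert (Lam * b xb = Mq + 1) by (unfold Lam; field; lra).
    assert (0 < Lam) by (apply Rdiv_lt_0_compat; lra).
    nra. }
  pose proof (half_Phi_neg _ _ _ _ _ _ HL Lam) as N1.
  pose proof (half_Phi_neg _ _ _ _ _ _ HR Lam) as N2.
  assert (Pl Lam 0 < 0).
  { apply N1; intros x Hx; [apply G1; lra | apply Neg; lra]. }
  assert (Pr Lam 0 < 0).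
  { apply N2; intros x Hx; [apply G2; lra | apply Neg; lra]. }
  pose proof (G1 0 ltac:(lra)); pose proof (G2 0 ltac:(lra)).
  unfold D in G3; nra. }
set (E := fun lam => 0 <= lam /\ forall mu, 0 <= mu <= lam -> good mu).
destruct (completeness E) as [ls [Ub Lub]].
{ exists Lam; intros x [Hx Gx]; apply Rnot_lt_le; intros H.
  apply NG, Gx; split; [|lra].
  unfold Lam; apply Rlt_le, Rdiv_lt_0_compat; [lra | now apply Pb]. }
{ exists 0; split; [lra|]; intros mu Hmu; now replace mu with 0 by lra. }
assert (Gbelow : forall mu, 0 <= mu < ls -> good mu).
{ intros mu Hmu; apply NNPP; intros N.
  assert (ls <= mu); [|lra].
  apply Lub; intros x [Hx Gx]; apply Rnot_lt_le; intros H; apply N, Gx; lra. }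
assert (Pls : 0 < ls).
{ destruct (Gopen 0 G0) as [d [Pd Hd]].
  assert (d / 2 <= ls); [|lra].
  apply Ub; split; [lra|]; intros mu Hmu; apply Hd; rewrite Rminus_0_r, Rabs_pos_eq; lra. }
assert (Ngood : ~ good ls).
{ intros G; destruct (Gopen ls G) as [d [Pd Hd]].
  assert (ls + d / 2 <= ls); [|lra].
  apply Ub; split; [lra|]; intros mu Hmu.
  destruct (Rlt_dec mu ls) as [H|H]; [apply Gbelow; lra|].
  apply Hd; rewrite Rabs_pos_eq; lra. }
assert (Nl : forall x, -1 <= x <= 0 -> 0 <= l ls x).
{ intros x Hx; apply (continuity_pt_limit_nonneg (fun mu => l mu x)); auto.
  - eapply half_continuity; eassumption.
  - intros mu Hmu; now apply (Gbelow mu Hmu). }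
assert (Nr : forall x, -1 <= x <= 0 -> 0 <= r ls x).
{ intros x Hx; apply (continuity_pt_limit_nonneg (fun mu => r mu x)); auto.
  - eapply half_continuity; eassumption.
  - intros mu Hmu; now apply (Gbelow mu Hmu). }
assert (ND : 0 <= D ls).
{ apply continuity_pt_limit_nonneg; auto; intros mu Hmu; now apply (Gbelow mu Hmu). }
destruct (half_nonneg_pos _ _ _ _ _ _ HL PA Pb ls Pls Nl) as [Pl1 Pl0].
destruct (half_nonneg_pos _ _ _ _ _ _ HR PA' Pb' ls Pls Nr) as [Pr1 Pr0].
(* If both solutions vanished at 0, [D] would already be negative just below [ls]. *)
assert (both : ~ (Pl ls 0 < 0 /\ Pr ls 0 < 0)).
{ intros [H1 H2].
  destruct (continuity_pt_pos (fun mu => - Pl mu 0) ls) as [d1 [P1 K1]].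
  { apply (continuity_pt_opp (fun mu => Pl mu 0)); eapply half_Phi_continuity; eassumption. }
  { lra. }
  destruct (continuity_pt_pos (fun mu => - Pr mu 0) ls) as [d2 [P2 K2]].
  { apply (continuity_pt_opp (fun mu => Pr mu 0)); eapply half_Phi_continuity; eassumption. }
  { lra. }
  set (e := Rmin ls (Rmin d1 d2) / 2).
  assert (He : 0 < e /\ e < ls /\ e < d1 /\ e < d2).
  { unfold e; pose proof (Rmin_l ls (Rmin d1 d2)); pose proof (Rmin_r ls (Rmin d1 d2)).
    pose proof (Rmin_l d1 d2); pose proof (Rmin_r d1 d2).
    assert (0 < Rmin ls (Rmin d1 d2)) by (repeat apply Rmin_case; auto).
    lra. }
  destruct (Gbelow (ls - e) ltac:(lra)) as [G1 [G2 G3]].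
  assert (Ae : Rabs (ls - e - ls) = e).
  { replace (ls - e - ls) with (- e) by ring; rewrite Rabs_Ropp, Rabs_pos_eq; lra. }
  pose proof (K1 (ls - e) ltac:(lra)); pose proof (K2 (ls - e) ltac:(lra)).
  pose proof (G1 0 ltac:(lra)); pose proof (G2 0 ltac:(lra)).
  unfold D in G3; nra. }
(* If [l ls 0 = 0] then [D ls] is the negative flux of [l] times [r ls 0]; as [D ls >= 0], also
   [r ls 0 = 0], which [both] excludes. *)
assert (L0 : 0 < l ls 0).
{ destruct (Nl 0 ltac:(lra)) as [H|H]; [exact H | exfalso].
  pose proof (Pl0 (eq_sym H)) as HPl.
  unfold D in ND; rewrite <- H in ND.
  assert (R0 : r ls 0 = 0) by (pose proof (Nr 0 ltac:(lra)); nra).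
  apply both; auto. }
assert (R0 : 0 < r ls 0).
{ destruct (Nr 0 ltac:(lra)) as [H|H]; [exact H | exfalso].
  pose proof (Pr0 (eq_sym H)) as HPr.
  unfold D in ND; rewrite <- H in ND; nra. }
assert (Pl2 : forall x, -1 <= x <= 0 -> 0 < l ls x).
{ intros x Hx; destruct (Req_dec x 0) as [->|N]; [exact L0 | apply Pl1; lra]. }
assert (Pr2 : forall x, -1 <= x <= 0 -> 0 < r ls x).
{ intros x Hx; destruct (Req_dec x 0) as [->|N]; [exact R0 | apply Pr1; lra]. }
assert (D0 : D ls = 0).
{ destruct ND as [H|H]; [|auto].
  exfalso; apply Ngood; repeat split; auto. }
(* Scaling by [c] matches the values at [0]; [D ls = 0] then matches the fluxes. *)
set (c := l ls 0 / r ls 0).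
assert (Pc : 0 < c) by now apply Rdiv_lt_0_compat.
set (h1 := l ls); set (h2 := fun x => c * r ls (- x)).
set (k1 := Pl ls); set (k2 := fun x => - c * Pr ls (- x)).
assert (Eh : h1 0 = h2 0) by (unfold h1, h2, c; rewrite Ropp_0; field; lra).
assert (Ek : k1 0 = k2 0).
{ unfold k1, k2, c; rewrite Ropp_0; unfold D in D0.
  apply (Rmult_eq_reg_r (r ls 0)); [|lra].
  replace (- (l ls 0 / r ls 0) * Pr ls 0 * r ls 0) with (- (l ls 0 * Pr ls 0)) by (field; lra).
  lra. }
set (h := glue h1 h2); set (k := glue k1 k2).
assert (S1 : Sm h1) by apply (hf_smooth _ _ _ _ _ _ HL).
assert (S2 : Sm h2).
{ apply smooth_on_mult; [apply smooth_on_const|].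
  apply (Sm_comp (r ls)); [apply (hf_smooth _ _ _ _ _ _ HR) | smooth_tac]. }
assert (Dh : forall x, -1 < x < 1 -> is_derive h x (A x * k x / (1 - x ^ 2) ^ S n)).
{ intros x Hx; apply glue_is_derive; [exact Eh| |]; intros Hx0.
  - unfold k; rewrite glue_left by exact Hx0.
    unfold h1, k1; rewrite <- (half_derive _ _ _ _ _ _ HL) by lra.
    now apply Sm_is_derive.
  - unfold k; rewrite glue_right by (exact Ek || lra).
    unfold h2, k2.
    replace (A x * (- c * Pr ls (- x)) / (1 - x ^ 2) ^ S n) with
      (c * (- (rf A (- x) * Pr ls (- x) / (1 - (- x) ^ 2) ^ S n))).
    2: { unfold rf; rewrite Ropp_involutive; replace ((- x) ^ 2) with (x ^ 2) by ring.
      field; apply pow_nonzero; pose proof (rho_pos x Hx); lra. }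
    rewrite <- (half_derive _ _ _ _ _ _ HR) by lra.
    apply (is_derive_scal (fun x => r ls (- x))), (is_derive_reflect (r ls)).
    apply Sm_is_derive, (hf_smooth _ _ _ _ _ _ HR). }
assert (Dk : forall x, -1 < x < 1 ->
  is_derive k x ((1 - x ^ 2) ^ n * (q x - ls * b x) * h x)).
{ intros x Hx; apply glue_is_derive; [exact Ek| |]; intros Hx0.
  - unfold h; rewrite glue_left by exact Hx0; apply (hf_Phi _ _ _ _ _ _ HL).
  - unfold h; rewrite glue_right by (exact Eh || lra).
    unfold h2, k2.
    replace ((1 - x ^ 2) ^ n * (q x - ls * b x) * (c * r ls (- x))) with
      (- c * (- ((1 - (- x) ^ 2) ^ n * (rf q (- x) - ls * rf b (- x)) * r ls (- x)))).
    2: { unfold rf; rewrite Ropp_involutive; replace ((- x) ^ 2) with (x ^ 2) by ring; ring. }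
    apply (is_derive_scal (fun x => Pr ls (- x))), (is_derive_reflect (Pr ls)).
    apply (hf_Phi _ _ _ _ _ _ HR). }
exists ls, h, k; split; [exact Pls|]; split; [|split].
- assert (Sin : smooth_on inside h).
  { intros j; apply (linear_system_Ck inside (fun x => A x / (1 - x ^ 2) ^ S n)
      (fun x => (1 - x ^ 2) ^ n * (q x - ls * b x)) h k).
    - assert (SR : forall f, Sm f -> smooth_on inside f).
      { intros f Sf; apply (smooth_on_subset reals); [easy | exact Sf]. }
      apply smooth_on_div; [apply open_inside | | now apply SR | smooth_tac].
      intros x Hx; apply pow_nonzero; pose proof (rho_pos x Hx); lra.
    - apply (smooth_on_subset reals); [easy | smooth_tac].
    - intros x Hx; replace (A x / (1 - x ^ 2) ^ S n * k x) with
        (A x * k x / (1 - x ^ 2) ^ S n) by (unfold Rdiv; ring).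
      now apply Dh.
    - exact Dk. }
  (* The bootstrap covers only the open interval. Off [0], poles included, [h] coincides locally
     with [h1] or [h2], which are smooth on the line. *)
  apply smooth_iff; intros j x; destruct (Rtotal_order x 0) as [H|[->|H]].
  + apply (smooth_on_iff _ (open_lt 0)); [|exact H].
    apply (smooth_on_ext _ (open_lt 0) h1); [|now apply (smooth_on_subset reals)].
    intros y Hy; symmetry; apply glue_left; lra.
  + apply (smooth_on_iff inside open_inside); [exact Sin | unfold inside; lra].
  + apply (smooth_on_iff _ (open_gt 0)); [|exact H].
    apply (smooth_on_ext _ (open_gt 0) h2); [|now apply (smooth_on_subset reals)].
    intros y Hy; symmetry; apply glue_right; [exact Eh | lra].
- intros x Hx; unfold h; destruct (Rle_dec x 0).
  + rewrite glue_left by lra; apply Pl2; lra.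
  + rewrite glue_right by (exact Eh || lra); unfold h2.
    apply Rmult_lt_0_compat; [exact Pc | apply Pr2; lra].
- intros x Hx; split; [now apply Dh | now apply Dk].
Qed.

Ltac ringR := unfold plus; simpl; match goal with |- @eq _ ?a ?b => change (@eq R a b) end; ring.

Lemma Derive_n_S_Derive (f : R -> R) (j : nat) (x : R) :
  Derive_n f (S j) x = Derive_n (Derive f) j x.
Proof.
transitivity (Derive_n f (j + 1) x); [now rewrite Nat.add_1_r|].
symmetry; exact (Derive_n_comp f j 1 x).
Qed.

Lemma Sm_ex_derive_n (f : R -> R) (n : nat) (x : R) : Sm f -> ex_derive_n f n x.
Proof. intros H; apply smooth_iff in H; apply H. Qed.

Lemma Derive_n_plus_Sm (f g : R -> R) (j : nat) (x : R) : Sm f -> Sm g ->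
  Derive_n (fun y => f y + g y) j x = Derive_n f j x + Derive_n g j x.
Proof.
intros Hf Hg; apply Derive_n_plus; apply filter_forall; intros y k _; now apply Sm_ex_derive_n.
Qed.

Lemma Derive_eq (f f' : R -> R) : (forall x, is_derive f x (f' x)) -> Derive f = f'.
Proof. intros H; apply functional_extensionality; intros x; now apply is_derive_unique. Qed.

(** * Convergence to zero in [C^infty([-1,1])] *)

Definition vanishing (f : nat -> R -> R) : Prop :=
  forall (j : nat) (eps : R), 0 < eps -> exists N : nat, forall (m : nat) (x : R),
    (N <= m)%nat -> -1 < x < 1 -> Rabs (Derive_n (f m) j x) < eps.

Lemma vanishing_ext (f g : nat -> R -> R) :
  (forall m x, f m x = g m x) -> vanishing f -> vanishing g.
Proof.
intros E H; replace g with f; [exact H|].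
apply functional_extensionality; intros m; now apply functional_extensionality.
Qed.

Lemma vanishing_plus (f g : nat -> R -> R) :
  (forall m, Sm (f m)) -> (forall m, Sm (g m)) ->
  vanishing f -> vanishing g -> vanishing (fun m x => f m x + g m x).
Proof.
intros Sf Sg Hf Hg j eps He.
destruct (Hf j (eps / 2) ltac:(lra)) as [N1 H1], (Hg j (eps / 2) ltac:(lra)) as [N2 H2].
exists (N1 + N2)%nat; intros m x Hm Hx.
rewrite Derive_n_plus_Sm by auto.
eapply Rle_lt_trans; [apply Rabs_triang|].
specialize (H1 m x ltac:(lia) Hx); specialize (H2 m x ltac:(lia) Hx); lra.
Qed.

Lemma vanishing_RInt (f : nat -> R -> R) :
  (forall m, Sm (f m)) -> vanishing f -> vanishing (fun m x => RInt (f m) 0 x).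
Proof.
intros Sf H [|j] eps He.
- destruct (H O eps He) as [N HN]; exists N; intros m x Hm Hx; simpl.
  assert (C : forall y, continuous (f m) y) by (intros; now apply Sm_continuous).
  destruct (MVT_gen (fun x => RInt (f m) 0 x) 0 x (f m)) as [c [Hc E]].
  + intros y _; now apply is_derive_RInt0.
  + intros y _; apply continuity_pt_filterlim.
    now apply (is_derive_continuous _ y (f m y)), is_derive_RInt0.
  + rewrite RInt_point in E; unfold zero in E; simpl in E; rewrite !Rminus_0_r in E.
    assert (Hc' : -1 < c < 1).
    { destruct Hc as [Ha Hb]; unfold Rmin, Rmax in *.
      destruct (Rle_dec 0 x); lra. }
    pose proof (HN m c Hm Hc') as B; simpl in B.
    rewrite E, Rabs_mult.
    assert (Rabs x < 1) by (apply Rabs_lt_between; lra).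
    pose proof (Rabs_pos x); pose proof (Rabs_pos (f m c)); nra.
- destruct (H j eps He) as [N HN]; exists N; intros m x Hm Hx.
  rewrite Derive_n_S_Derive, (Derive_eq _ (f m)); [now apply HN|].
  intros y; apply is_derive_RInt0; intros z; now apply Sm_continuous.
Qed.

Definition entire (c : nat -> R) : Prop := forall x : R, Rbar_lt (Rabs x) (CV_radius c).

Definition ps_tail (c : nat -> R) (m : nat) (y : R) : R :=
  PSeries c y - sum_n (fun k => c k * y ^ k) m.

Lemma entire_derive (c : nat -> R) : entire c -> entire (PS_derive c).
Proof. intros H x; rewrite CV_radius_derive; apply H. Qed.

Lemma PSeries_Sm (c : nat -> R) : entire c -> Sm (PSeries c).
Proof. intros H; apply smooth_iff; intros n x; now apply ex_derive_n_PSeries. Qed.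

Lemma sum_n_Sm (f : nat -> R -> R) (m : nat) :
  (forall k, Sm (f k)) -> Sm (fun y => sum_n (fun k => f k y) m).
Proof.
intros H; induction m as [|m IH].
- apply (smooth_on_ext _ open_reals (f O)); [intros; now rewrite sum_O | apply H].
- apply (smooth_on_ext _ open_reals (fun y => sum_n (fun k => f k y) m + f (S m) y)).
  + intros; now rewrite sum_Sn.
  + now apply smooth_on_plus.
Qed.

Lemma ps_tail_Sm (c : nat -> R) (m : nat) : entire c -> Sm (ps_tail c m).
Proof.
intros H; apply smooth_on_minus; [apply open_reals | now apply PSeries_Sm|].
apply (sum_n_Sm (fun k y => c k * y ^ k)); intros k; smooth_tac.
Qed.

Lemma ps_tail_is_derive (c : nat -> R) (m : nat) (y : R) : entire c ->
  is_derive (ps_tail c (S m)) y (ps_tail (PS_derive c) m y).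
Proof.
intros H; apply (is_derive_minus (PSeries c)); [now apply is_derive_PSeries|].
induction m as [|m IH].
- apply (is_derive_ext (fun y => c O * 1 + c 1%nat * (y * 1))).
  { intros t; rewrite sum_Sn, sum_O; reflexivity. }
  rewrite sum_O; unfold PS_derive; simpl.
  auto_derive; [easy | ring].
- apply (is_derive_ext (fun y => sum_n (fun k => c k * y ^ k) (S m) + c (S (S m)) * y ^ (S (S m)))).
  { intros t; now rewrite (sum_Sn _ (S m)). }
  rewrite sum_Sn.
  apply (is_derive_plus (fun y => sum_n (fun k => c k * y ^ k) (S m))); [exact IH|].
  unfold PS_derive; auto_derive; [easy|].
  rewrite (S_INR (S m)); simpl; ring.
Qed.

(** Weierstrass majorant: for [Rabs y <= Y] the tail is dominated by that of the absolutely
    convergent series at [Y]. *)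
Lemma ps_tail_uniform (c : nat -> R) (Y eps : R) : entire c -> 0 <= Y -> 0 < eps ->
  exists N, forall m y, (N <= m)%nat -> Rabs y <= Y -> Rabs (ps_tail c m y) < eps.
Proof.
intros H HY He.
set (a := fun n => Rabs (c n * Y ^ n)).
assert (Ea : ex_series a) by (apply CV_disk_inside, H).
pose proof (Series_correct a Ea) as L.
assert (L' : is_lim_seq (sum_n a) (Series a)) by exact L.
apply is_lim_seq_spec in L'; destruct (L' (mkposreal eps He)) as [N HN]; simpl in HN.
exists N; intros m y Hm Hy; specialize (HN m Hm).
set (b := fun n => c n * y ^ n).
assert (le : forall n, Rabs (b n) <= a n).
{ intros n; unfold a, b; rewrite !Rabs_mult.
  apply Rmult_le_compat_l; [apply Rabs_pos|].
  rewrite <- !RPow_abs; apply pow_incr; split; [apply Rabs_pos|].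
  now rewrite (Rabs_pos_eq Y). }
assert (Eb : ex_series b) by (now apply (ex_series_le (V := R_CompleteNormedModule) b a)).
unfold ps_tail; change (PSeries c y) with (Series b).
change (fun k => c k * y ^ k) with b.
rewrite (Series_incr_n b (S m)) by (lia || exact Eb).
rewrite (Series_incr_n a (S m)) in HN by (lia || exact Ea).
rewrite !sum_n_Reals in *; simpl Init.Nat.pred in *.
match goal with |- Rabs (?x + ?y - ?x) < _ => replace (x + y - x) with y by ring end.
assert (Ta : ex_series (fun k => a (S m + k)%nat)) by (now apply ex_series_incr_n).
assert (Tb : ex_series (fun k => Rabs (b (S m + k)%nat))).
{ apply (ex_series_le (V := R_CompleteNormedModule) _ (fun k => a (S m + k)%nat)); [|exact Ta].
  intros n; unfold norm; simpl; rewrite Rabs_Rabsolu; apply le. }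
eapply Rle_lt_trans; [apply Series_Rabs, Tb|].
eapply Rle_lt_trans; [apply (Series_le _ (fun k => a (S m + k)%nat)); [|exact Ta]|].
- intros n; split; [apply Rabs_pos | apply le].
- rewrite Rabs_minus_sym in HN.
  match type of HN with Rabs (?x + ?y - ?x) < _ => replace (x + y - x) with y in HN by ring end.
  eapply Rle_lt_trans; [apply Rle_abs | exact HN].
Qed.

(** The amplitude [A] makes the induction on the order of the derivative close: differentiating
    yields [A'] times the tail of [c], plus [A p'] times a tail of the derived series, and both have
    the same form. *)
Lemma vanishing_ps_tail (A p : R -> R) (c : nat -> R) :
  Sm A -> Sm p -> entire c -> vanishing (fun m x => A x * ps_tail c m (p x)).
Proof.
intros SA Sp Hc j; revert A c SA Hc; induction j as [|j IH]; intros A c SA Hc eps He.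
- destruct (continuous_bounded A (-1) 1) as [MA [PA HA]]; [intros; now apply Sm_continuous|].
  destruct (continuous_bounded p (-1) 1) as [Mp [Pp Hp]]; [intros; now apply Sm_continuous|].
  destruct (ps_tail_uniform c Mp (eps / MA) Hc ltac:(lra) ltac:(now apply Rdiv_lt_0_compat))
    as [N HN].
  exists N; intros m x Hm Hx; simpl; rewrite Rabs_mult.
  specialize (HN m (p x) Hm (Hp x ltac:(lra))); specialize (HA x ltac:(lra)).
  pose proof (Rabs_pos (ps_tail c m (p x))).
  apply (Rle_lt_trans _ (MA * Rabs (ps_tail c m (p x)))); [nra|].
  apply (Rmult_lt_compat_l MA) in HN; [|exact PA].
  replace (MA * (eps / MA)) with eps in HN by (field; lra); exact HN.
- destruct (IH (Derive A) c ltac:(smooth_tac) Hc (eps / 2) ltac:(lra)) as [N1 H1].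
  destruct (IH (fun x => A x * Derive p x) (PS_derive c) ltac:(smooth_tac)
    (entire_derive c Hc) (eps / 2) ltac:(lra)) as [N2 H2].
  exists (S (N1 + N2)); intros [|m] x Hm Hx; [lia|].
  rewrite Derive_n_S_Derive.
  assert (S1 : forall c m, entire c -> Sm (fun x => ps_tail c m (p x))).
  { intros c' m' Hc'; apply (Sm_comp (ps_tail c' m')); [now apply ps_tail_Sm | exact Sp]. }
  rewrite (Derive_eq _ (fun x => Derive A x * ps_tail c (S m) (p x) +
    A x * Derive p x * ps_tail (PS_derive c) m (p x))).
  + rewrite Derive_n_plus_Sm.
    * eapply Rle_lt_trans; [apply Rabs_triang|].
      specialize (H1 (S m) x ltac:(lia) Hx); specialize (H2 m x ltac:(lia) Hx); lra.
    * apply smooth_on_mult; [smooth_tac | now apply S1].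
    * apply smooth_on_mult; [smooth_tac | now apply S1, entire_derive].
  + intros y.
    pose proof (Sm_is_derive A y SA) as D1; pose proof (Sm_is_derive p y Sp) as D2.
    pose proof (is_derive_comp (ps_tail c (S m)) p y _ _
      (ps_tail_is_derive c m (p y) Hc) D2) as D3.
    apply is_derive_Reals in D1, D3; apply is_derive_Reals.
    pose proof (derivable_pt_lim_mult _ _ _ _ _ D1 D3) as D; unfold mult_fct in D.
    match type of D with derivable_pt_lim _ _ ?v =>
      match goal with |- derivable_pt_lim _ _ ?w => replace w with v; [exact D|] end end.
    unfold scal; simpl; unfold mult; simpl; ring.
Qed.

(** * Analytic families of smooth functions *)

(** Perturbations of [s''] that are entire in [t]. The bound linear in [t], uniform up to the poles,
    is what keeps [s''] positive for small [t]. *)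
Record analytic_at_zero (g : R -> R -> R) : Prop := {
  an_smooth : forall t, Sm (g t);
  an_zero : forall x, g 0 x = 0;
  an_bound : exists M, 0 < M /\ forall t x, Rabs t <= 1 -> -1 <= x <= 1 ->
    Rabs (g t x) <= M * Rabs t;
  an_series : exists a : nat -> R -> R, (forall n, Sm (a n)) /\
    forall t, vanishing (fun m x => g t x - sum_n (fun n => a n x * t ^ n) m) }.

Lemma analytic_partial_Sm (a : nat -> R -> R) (t : R) (m : nat) :
  (forall n, Sm (a n)) -> Sm (fun x => sum_n (fun n => a n x * t ^ n) m).
Proof.
intros H; apply (sum_n_Sm (fun n x => a n x * t ^ n)); intros k.
apply smooth_on_mult; [apply H | apply smooth_on_const].
Qed.

Lemma analytic_plus (g1 g2 : R -> R -> R) :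
  analytic_at_zero g1 -> analytic_at_zero g2 ->
  analytic_at_zero (fun t x => g1 t x + g2 t x).
Proof.
intros [S1 Z1 [M1 [P1 B1]] [a1 [Sa1 V1]]] [S2 Z2 [M2 [P2 B2]] [a2 [Sa2 V2]]].
split.
- intros t; apply smooth_on_plus; auto.
- intros x; rewrite Z1, Z2; ring.
- exists (M1 + M2); split; [lra|]; intros t x Ht Hx.
  eapply Rle_trans; [apply Rabs_triang|].
  specialize (B1 t x Ht Hx); specialize (B2 t x Ht Hx); lra.
- exists (fun n x => a1 n x + a2 n x); split; [intros n; apply smooth_on_plus; auto|].
  intros t.
  apply (vanishing_ext (fun m x => (g1 t x - sum_n (fun n => a1 n x * t ^ n) m) +
    (g2 t x - sum_n (fun n => a2 n x * t ^ n) m))).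
  + intros m x.
    replace (sum_n (fun n => (a1 n x + a2 n x) * t ^ n) m) with
      (sum_n (fun n => a1 n x * t ^ n) m + sum_n (fun n => a2 n x * t ^ n) m); [ring|].
    transitivity (sum_n (fun n => plus (a1 n x * t ^ n) (a2 n x * t ^ n)) m).
    * symmetry; apply (sum_n_plus (fun n => a1 n x * t ^ n) (fun n => a2 n x * t ^ n)).
    * apply sum_n_ext; intros n; unfold plus; simpl; ring.
  + apply vanishing_plus; auto; intros m; apply smooth_on_minus;
      auto using open_reals, analytic_partial_Sm.
Qed.

Lemma analytic_linear (B : R -> R) : Sm B -> analytic_at_zero (fun t x => t * B x).
Proof.
intros SB; split.
- intros t; apply smooth_on_mult; [apply smooth_on_const | exact SB].
- intros x; ring.
- destruct (continuous_bounded B (-1) 1) as [M [PM HM]]; [intros; now apply Sm_continuous|].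
  exists M; split; [exact PM|]; intros t x _ Hx; rewrite Rabs_mult, Rmult_comm.
  apply Rmult_le_compat_r; [apply Rabs_pos | now apply HM].
- exists (fun n x => match n with 1%nat => B x | _ => 0 end); split.
  + intros [|[|n]]; smooth_tac.
  + intros t j eps He; exists 1%nat; intros [|m] x Hm Hx; [lia|].
    replace (fun x => t * B x - sum_n (fun n => match n with 1%nat => B x | _ => 0 end * t ^ n) (S m))
      with (fun _ : R => 0 * 0).
    + rewrite (Derive_n_scal_l (fun _ => 0)), Rmult_0_l, Rabs_R0; exact He.
    + apply functional_extensionality; intros y.
      assert (E : forall m, sum_n (fun n => match n with 1%nat => B y | _ => 0 end * t ^ n) (S m) =
        t * B y).
      { clear; induction m as [|m IH].
        - rewrite sum_Sn, sum_O; unfold plus; simpl; ring.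
        - rewrite sum_Sn, IH; unfold plus; simpl; ring. }
      rewrite E; ring.
Qed.

(** The explicit factor [t] provides both the vanishing at [t = 0] and the linear bound; it also
    shifts the coefficients by one. *)
Lemma analytic_power_series (B p : R -> R) (c : nat -> R) :
  Sm B -> Sm p -> entire c ->
  analytic_at_zero (fun t x => B x * (t * PSeries c (t * p x))).
Proof.
intros SB Sp Hc; split.
- intros t; apply smooth_on_mult; [exact SB|].
  apply smooth_on_mult; [apply smooth_on_const|].
  apply (Sm_comp (PSeries c)); [now apply PSeries_Sm | smooth_tac].
- intros x; ring.
- destruct (continuous_bounded B (-1) 1) as [MB [PB HB]]; [intros; now apply Sm_continuous|].
  destruct (continuous_bounded p (-1) 1) as [Mp [Pp Hp]]; [intros; now apply Sm_continuous|].
  destruct (continuous_bounded (PSeries c) (- Mp) Mp) as [Mc [Pc Hmc]].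
  { intros; now apply Sm_continuous, PSeries_Sm. }
  exists (MB * Mc); split; [now apply Rmult_lt_0_compat|].
  intros t x Ht Hx; rewrite !Rabs_mult.
  replace (MB * Mc * Rabs t) with (MB * (Rabs t * Mc)) by ring.
  specialize (HB x Hx); specialize (Hp x Hx).
  assert (Rabs (PSeries c (t * p x)) <= Mc).
  { apply Hmc, Rabs_le_between; rewrite Rabs_mult.
    pose proof (Rabs_pos t); pose proof (Rabs_pos (p x)); nra. }
  apply Rmult_le_compat; try apply Rabs_pos; auto.
  + apply Rmult_le_pos; apply Rabs_pos.
  + apply Rmult_le_compat_l; [apply Rabs_pos | assumption].
- exists (fun n x => match n with O => 0 | S k => B x * (c k * p x ^ k) end); split.
  + intros [|k]; smooth_tac.
  + intros t j eps He.
    destruct (vanishing_ps_tail (fun x => t * B x) (fun x => t * p x) c ltac:(smooth_tac)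
      ltac:(smooth_tac) Hc j eps He) as [N HN].
    exists (S N); intros [|m] x Hm Hx; [lia|].
    specialize (HN m x ltac:(lia) Hx).
    match goal with |- Rabs (Derive_n ?f _ _) < _ =>
      replace f with (fun x => t * B x * ps_tail c m (t * p x)); [exact HN|] end.
    apply functional_extensionality; intros y; unfold ps_tail.
    assert (E : forall m, sum_n (fun n => match n with O => 0 | S k => B y * (c k * p y ^ k) end * t ^ n) (S m)
      = t * B y * sum_n (fun k => c k * (t * p y) ^ k) m).
    { clear; intros m; induction m as [|m IH].
      - rewrite sum_Sn, !sum_O; unfold plus; simpl; ring.
      - rewrite sum_Sn, IH, (sum_Sn _ m); unfold plus; simpl.
        rewrite (Rpow_mult_distr t (p y) m); ring. }
    rewrite E; ring.
Qed.

Lemma analytic_RInt (g : R -> R -> R) :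
  analytic_at_zero g -> analytic_at_zero (fun t x => RInt (g t) 0 x).
Proof.
intros [S1 Z1 [M1 [P1 B1]] [a1 [Sa1 V1]]].
assert (C1 : forall t y, continuous (g t) y) by (intros; now apply Sm_continuous).
split.
- intros t; now apply Sm_RInt.
- intros x; rewrite (RInt_ext _ (fun _ => 0)) by (intros; apply Z1).
  rewrite RInt_const; apply Rmult_0_r.
- exists M1; split; [exact P1|]; intros t x Ht Hx.
  destruct (MVT_gen (fun x => RInt (g t) 0 x) 0 x (g t)) as [c [Hc E]].
  + intros y _; now apply is_derive_RInt0.
  + intros y _; apply continuity_pt_filterlim.
    now apply (is_derive_continuous _ y (g t y)), is_derive_RInt0.
  + rewrite RInt_point in E; unfold zero in E; simpl in E; rewrite !Rminus_0_r in E.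
    assert (Hc' : -1 <= c <= 1).
    { destruct Hc as [Ha Hb]; unfold Rmin, Rmax in *.
      destruct (Rle_dec 0 x); lra. }
    rewrite E, Rabs_mult; pose proof (B1 t c Ht Hc').
    assert (Rabs x <= 1) by (now apply Rabs_le_between).
    pose proof (Rabs_pos x); pose proof (Rabs_pos (g t c)); nra.
- exists (fun n x => RInt (a1 n) 0 x); split; [intros n; now apply Sm_RInt|].
  intros t.
  apply (vanishing_ext (fun m x => RInt (fun y => g t y - sum_n (fun n => a1 n y * t ^ n) m) 0 x)).
  + intros m x.
    rewrite (RInt_minusR (g t) (fun y => sum_n (fun n => a1 n y * t ^ n) m)).
    * f_equal; induction m as [|m IH].
      -- rewrite sum_O; rewrite (RInt_ext _ (fun y => t ^ 0 * a1 O y)).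
         ++ rewrite RInt_scalR; [ringR|]; apply ex_RInt_cont; intros; now apply Sm_continuous.
         ++ intros y _; rewrite sum_O; ringR.
      -- rewrite sum_Sn, <- IH.
         rewrite (RInt_ext _ (fun y => sum_n (fun n => a1 n y * t ^ n) m + t ^ S m * a1 (S m) y)).
         ++ rewrite RInt_plusR, RInt_scalR; [ringR | | |].
            ** apply ex_RInt_cont; intros; now apply Sm_continuous.
            ** apply ex_RInt_cont; intros; now apply Sm_continuous, analytic_partial_Sm.
            ** apply (ex_RInt_cont (fun y => t ^ S m * a1 (S m) y)); intros.
               apply Sm_continuous; apply smooth_on_mult; [apply smooth_on_const | apply Sa1].
         ++ intros y _; rewrite sum_Sn; ringR.
    * now apply ex_RInt_cont.
    * apply ex_RInt_cont; intros; now apply Sm_continuous, analytic_partial_Sm.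
  + apply (vanishing_RInt (fun m y => g t y - sum_n (fun n => a1 n y * t ^ n) m)); [|apply V1].
    intros m; apply smooth_on_minus; auto using open_reals, analytic_partial_Sm.
Qed.

Lemma exp_minus_1_series :
  exists c, entire c /\ forall y, exp y - 1 = y * PSeries c y.
Proof.
set (e := fun n => / INR (Factorial.fact n)).
assert (Ee : forall x, is_pseries e x (exp x)) by (intros; apply is_exp_Reals).
assert (He : entire e).
{ intros x; apply Rbar_not_le_lt; intros H.
  apply (CV_disk_outside e (Rabs x + 1)).
  - apply (Rbar_le_lt_trans _ (Rabs x)); [exact H|]; simpl.
    rewrite (Rabs_pos_eq (Rabs x + 1)); pose proof (Rabs_pos x); lra.
  - apply ex_series_lim_0; exists (exp (Rabs x + 1)).
    apply (is_series_ext (fun k => scal (pow_n (Rabs x + 1) k) (e k))); [|apply Ee].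
    intros n; rewrite pow_n_pow; apply Rmult_comm. }
exists (PS_decr_1 e); split.
- intros x; rewrite CV_radius_decr_1; apply He.
- intros y.
  rewrite <- (is_pseries_unique e y (exp y) (Ee y)), PSeries_decr_1.
  + unfold e at 1; simpl; field.
  + exists (exp y); apply Ee.
Qed.

(** Since [(exp y - 1) / y] is entire, the quotient of [exp (t * p x) - 1] by [p x] is smooth even
    where [p] vanishes. This is how the singularities at the poles cancel: [p] is chosen with a zero
    at the pole concerned. *)
Lemma analytic_exp (B p : R -> R) : Sm B -> Sm p ->
  exists g, analytic_at_zero g /\ forall t x, p x * g t x = B x * (exp (t * p x) - 1).
Proof.
intros SB Sp; destruct exp_minus_1_series as [c [Hc E]].
exists (fun t x => B x * (t * PSeries c (t * p x))); split.
- now apply analytic_power_series.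
- intros t x; rewrite E; ring.
Qed.

(** * Symplectic potentials and their perturbations *)

Definition fubini_study (x : R) : R := / 2 * ((1 + x) * ln (1 + x) + (1 - x) * ln (1 - x)).

Lemma fubini_study_derive1 (x : R) : -1 < x < 1 ->
  is_derive fubini_study x (/ 2 * (ln (1 + x) - ln (1 - x))).
Proof.
intros Hx; unfold fubini_study; auto_derive; [repeat split; lra|].
change (1 + - x) with (1 - x); field; lra.
Qed.

Lemma fubini_study_derive2 (x : R) : -1 < x < 1 ->
  is_derive (fun x => / 2 * (ln (1 + x) - ln (1 - x))) x (/ (1 - x ^ 2)).
Proof.
intros Hx; auto_derive; [repeat split; lra|].
field; split; [|split]; nra.
Qed.

Lemma fubini_study_smooth : smooth_on inside fubini_study.
Proof.
apply (smooth_on_intro _ _ _ fubini_study_derive1).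
apply (smooth_on_intro _ _ _ fubini_study_derive2).
apply smooth_on_inv; [apply open_inside | intros x Hx; unfold inside in Hx; nra | smooth_tac].
Qed.

Lemma Sm_inside (f : R -> R) : Sm f -> smooth_on inside f.
Proof. now apply smooth_on_subset. Qed.

Lemma locally_inside (x : R) : -1 < x < 1 -> locally x (fun y => -1 < y < 1).
Proof. apply open_inside. Qed.

Lemma Derive_n_2_plus (f h : R -> R) (x : R) :
  smooth_on inside f -> smooth_on inside h -> -1 < x < 1 ->
  Derive_n (fun y => f y + h y) 2 x = Derive_n f 2 x + Derive_n h 2 x.
Proof.
intros Hf Hh Hx.
apply Derive_n_plus; apply (filter_imp (fun y => -1 < y < 1)); try now apply locally_inside.
- intros y Hy k _; now apply (smooth_on_iff inside open_inside f).
- intros y Hy k _; now apply (smooth_on_iff inside open_inside h).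
Qed.

Lemma fubini_study_Derive_2 (x : R) : -1 < x < 1 -> Derive_n fubini_study 2 x = / (1 - x ^ 2).
Proof.
intros Hx; simpl.
rewrite (Derive_ext_loc _ (fun x => / 2 * (ln (1 + x) - ln (1 - x)))).
- now apply is_derive_unique, fubini_study_derive2.
- apply (filter_imp (fun y => -1 < y < 1)); [|now apply locally_inside].
  intros y Hy; now apply is_derive_unique, fubini_study_derive1.
Qed.

Lemma nonneg_at_endpoints (f : R -> R) : (forall x, continuous f x) ->
  (forall x, -1 < x < 1 -> 0 <= f x) -> forall x, -1 <= x <= 1 -> 0 <= f x.
Proof.
intros C P x Hx; apply Rnot_lt_le; intros N.
destruct (continuity_pt_pos (fun x => - f x) x) as [d [Pd Hd]].
- apply continuity_pt_filterlim, (continuous_opp f), C.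
- lra.
- set (e := Rmin d 1 / 2).
  assert (He : 0 < e < d /\ e < 1).
  { unfold e; pose proof (Rmin_l d 1); pose proof (Rmin_r d 1).
    assert (0 < Rmin d 1) by (apply Rmin_case; lra); lra. }
  destruct (Rle_dec x 0) as [H|H].
  + pose proof (Hd (x + e) ltac:(rewrite Rabs_pos_eq; lra)).
    pose proof (P (x + e) ltac:(lra)); lra.
  + pose proof (Hd (x - e) ltac:(rewrite Rabs_left; lra)).
    pose proof (P (x - e) ltac:(lra)); lra.
Qed.

Lemma eq_at_endpoints (f g : R -> R) : (forall x, continuous f x) -> (forall x, continuous g x) ->
  (forall x, -1 < x < 1 -> f x = g x) -> forall x, -1 <= x <= 1 -> f x = g x.
Proof.
intros Cf Cg E x Hx; apply Rle_antisym.
- enough (0 <= g x - f x) by lra.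
  apply (nonneg_at_endpoints (fun x => g x - f x)); [|intros y Hy; rewrite E; auto; lra | exact Hx].
  intros y; apply (continuous_minus g f); auto.
- enough (0 <= f x - g x) by lra.
  apply (nonneg_at_endpoints (fun x => f x - g x)); [|intros y Hy; rewrite E; auto; lra | exact Hx].
  intros y; apply (continuous_minus f g); auto.
Qed.

Lemma Spot_smooth (s : R -> R) : Spot s -> smooth_on inside s.
Proof. intros [H _]; now apply smooth_inside_iff. Qed.

(** The logarithmic part contributes exactly [/ (1 - x^2)] to [s'']. Hence [(1 - x^2) s''] is smooth
    up to the poles and equals [1] there, which gives its positivity on the closed interval. *)
Lemma Spot_density (s : R -> R) : Spot s ->
  exists h, Sm h /\ (forall x, -1 < x < 1 -> s x = fubini_study x + h x) /\
    (forall x, -1 < x < 1 -> Derive_n s 2 x = (1 + (1 - x ^ 2) * Derive_n h 2 x) / (1 - x ^ 2)) /\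
    (forall x, -1 <= x <= 1 -> 0 < 1 + (1 - x ^ 2) * Derive_n h 2 x).
Proof.
intros [S1 [P [h [Sh Eh]]]]; apply smooth_iff in Sh.
assert (E : forall x, -1 < x < 1 -> s x = fubini_study x + h x).
{ intros x Hx; rewrite <- Eh by exact Hx; unfold fubini_study; ring. }
assert (D : forall x, -1 < x < 1 ->
  Derive_n s 2 x = (1 + (1 - x ^ 2) * Derive_n h 2 x) / (1 - x ^ 2)).
{ intros x Hx.
  rewrite (Derive_n_ext_loc _ (fun y => fubini_study y + h y)).
  - rewrite Derive_n_2_plus, fubini_study_Derive_2; auto using fubini_study_smooth, Sm_inside.
    field; nra.
  - apply (filter_imp (fun y => -1 < y < 1)); [exact E | now apply locally_inside]. }
exists h; repeat split; auto.
intros x Hx; destruct (Req_dec (x ^ 2) 1) as [E1|N1]; [rewrite E1; lra|].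
assert (Hx' : -1 < x < 1) by nra.
specialize (P x Hx'); rewrite D in P by exact Hx'.
assert (Hr : 0 < 1 - x ^ 2) by nra.
apply (Rmult_lt_compat_r (1 - x ^ 2)) in P; [|exact Hr].
replace ((1 + (1 - x ^ 2) * Derive_n h 2 x) / (1 - x ^ 2) * (1 - x ^ 2)) with
  (1 + (1 - x ^ 2) * Derive_n h 2 x) in P by (field; lra).
lra.
Qed.

(** Integrating [g t] twice from [0] gives a correction of [s] that is smooth on the line, so the
    logarithmic singularity of the potential is untouched. *)
Lemma Spot_perturbation (s : R -> R) (g : R -> R -> R) :
  Spot s -> analytic_at_zero g ->
  exists sf, analytic_family s sf /\
    locally 0 (fun t => Spot (sf t) /\
      forall x, -1 < x < 1 -> Derive_n (sf t) 2 x = Derive_n s 2 x + g t x).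
Proof.
intros Hs Hg.
set (G := (fun t x => RInt (fun y => RInt (g t) 0 y) 0 x) : R -> R -> R).
assert (HG : analytic_at_zero G) by (now apply (analytic_RInt (fun t y => RInt (g t) 0 y)), analytic_RInt).
pose proof (an_smooth _ Hg) as Sg; pose proof (an_smooth _ HG) as SG.
assert (D2 : forall t, Derive_n (G t) 2 = g t).
{ intros t; apply functional_extensionality; intros x.
  rewrite Derive_n_S_Derive, (Derive_eq (G t) (fun y => RInt (g t) 0 y)).
  - rewrite Derive_n_S_Derive, (Derive_eq _ (g t)); [reflexivity|].
    intros y; apply is_derive_RInt0; intros z; now apply Sm_continuous.
  - intros y; apply (is_derive_RInt0 (fun y => RInt (g t) 0 y)); intros z.
    now apply Sm_continuous, Sm_RInt. }
destruct (Spot_density s Hs) as [h [Sh [Es [Ds Pv]]]].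
set (v := fun x => 1 + (1 - x ^ 2) * Derive_n h 2 x) in *.
assert (Sv : Sm v) by (unfold v; smooth_tac).
destruct (continuity_ab_min v (-1) 1 ltac:(lra)) as [xm [Hxm Ixm]].
{ intros y _; now apply Sm_continuity_pt. }
destruct (an_bound _ Hg) as [M [PM BM]].
set (sf := fun t x => s x + G t x).
assert (Dsf : forall t x, -1 < x < 1 -> Derive_n (sf t) 2 x = Derive_n s 2 x + g t x).
{ intros t x Hx; unfold sf; rewrite (Derive_n_2_plus s (G t)), D2; auto using Spot_smooth, Sm_inside. }
assert (L : locally 0 (fun t => Spot (sf t) /\
  forall x, -1 < x < 1 -> Derive_n (sf t) 2 x = Derive_n s 2 x + g t x)).
(* [v xm] is the minimum of [v], and [s'' = v / (1 - x^2) >= v]; so a perturbation smaller than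
   [v xm] preserves positivity. The bound [1] is the range of [t] in [an_bound]. *)
{ assert (Pr : 0 < Rmin 1 (v xm / M)).
  { apply Rmin_case; [lra | apply Rdiv_lt_0_compat; [apply (Pv xm Ixm) | exact PM]]. }
  exists (mkposreal _ Pr); intros t Ht; change (Rabs (t - 0) < Rmin 1 (v xm / M)) in Ht.
  rewrite Rminus_0_r in Ht; split; [|apply Dsf].
  split; [|split].
  - apply smooth_inside_iff, smooth_on_plus; [apply Spot_smooth, Hs | apply Sm_inside, SG].
  - intros x Hx; rewrite Dsf, Ds by exact Hx.
    assert (T1 : Rabs t < 1) by (eapply Rlt_le_trans; [exact Ht | apply Rmin_l]).
    assert (T2 : Rabs t < v xm / M) by (eapply Rlt_le_trans; [exact Ht | apply Rmin_r]).
    pose proof (BM t x ltac:(lra) ltac:(lra)) as B; apply Rabs_le_between in B.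
    apply (Rmult_lt_compat_l M) in T2; [|exact PM].
    replace (M * (v xm / M)) with (v xm) in T2 by (field; lra).
    pose proof (Hxm x ltac:(lra)) as V1; pose proof (Pv xm Ixm) as V2.
    assert (v x <= v x / (1 - x ^ 2)); [|unfold v in *; lra].
    apply (Rmult_le_reg_r (1 - x ^ 2)); [nra|].
    replace (v x / (1 - x ^ 2) * (1 - x ^ 2)) with (v x) by (field; nra); nra.
  - exists (fun x => h x + G t x); split.
    + apply smooth_iff, smooth_on_plus; auto using open_reals.
    + intros x Hx; unfold sf; rewrite Es by exact Hx; unfold fubini_study; ring. }
exists sf; split; [|exact L]; split; [|split].
- apply (filter_imp _ _ (fun t H => proj1 H) L).
- intros x _; unfold sf; rewrite (an_zero _ HG); ring.
- destruct (an_series _ HG) as [a [Sa Va]].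
  exists 1, a; split; [lra|]; split.
  + intros n; exists (a n); split; [apply smooth_iff, Sa | reflexivity].
  + intros t j _ eps He; destruct (Va t j eps He) as [N HN].
    exists N; intros m x Hm Hx; specialize (HN m x Hm Hx).
    replace (fun y => sf t y - sf 0 y) with (G t).
    2: { apply functional_extensionality; intros y; unfold sf; rewrite (an_zero _ HG); ring. }
    rewrite Rabs_minus_sym.
    match type of HN with Rabs ?u < _ => match goal with |- Rabs ?w < _ =>
      replace w with u; [exact HN|] end end.
    replace (fun y => G t y - sum_n (fun n => a n y * t ^ n) m) with
      (fun y => G t y + -1 * sum_n (fun n => a n y * t ^ n) m)
      by (apply functional_extensionality; intros; ring).
    rewrite Derive_n_plus_Sm, Derive_n_scal_l.
    * replace (sum_n (fun n => Derive_n (a n) j x * t ^ n) m) with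
        (Derive_n (fun y => sum_n (fun n => a n y * t ^ n) m) j x); [ring|].
      rewrite Derive_n_sum_n.
      -- apply sum_n_ext; intros n.
         rewrite <- (Rmult_comm (t ^ n)), <- Derive_n_scal_l.
         apply Derive_n_ext; intros y; ring.
      -- apply filter_forall; intros y l i _ _; apply Sm_ex_derive_n, smooth_on_mult;
           [apply Sa | apply smooth_on_const].
    * apply SG.
    * apply smooth_on_mult; [apply smooth_on_const | now apply analytic_partial_Sm].
Qed.

(** * Non-criticality from a prescribed first eigenvalue *)

Lemma is_lambda1_lambda1 (k : Z) (s : R -> R) (l : R) : is_lambda1 k s l -> lambda1 k s = l.
Proof.
intros H; unfold lambda1.
apply (iota_unique (V := R_CompleteNormedModule)); [|exact H].
intros y [Py [Ey My]]; destruct H as [Pl [El Ml]].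
apply Rle_antisym; auto.
Qed.

(** Along the family the first eigenvalue is [lam * exp (- t)] near [0], so both one-sided
    derivatives are [- lam] and their product [lam^2] is positive. *)
Lemma not_critical (k : Z) (s : R -> R) (g : R -> R -> R) (lam : R) :
  Spot s -> analytic_at_zero g -> 0 < lam ->
  (forall t s', Spot s' ->
    (forall x, -1 < x < 1 -> Derive_n s' 2 x = Derive_n s 2 x + g t x) ->
    is_lambda1 k s' (lam * exp (- t))) ->
  ~ lambda1_critical k s.
Proof.
intros Hs Hg Pl H Crit.
destruct (Spot_perturbation s g Hs Hg) as [sf [Fam L]].
set (Lf := fun t => lambda1 k (sf t)).
assert (EL : locally 0 (fun t => Lf t = lam * exp (- t))).
{ apply (filter_imp _ _ (fun t Ht => is_lambda1_lambda1 k (sf t) _ (H t _ (proj1 Ht) (proj2 Ht))) L). }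
assert (D : is_derive Lf 0 (- lam)).
{ apply (is_derive_ext_loc (fun t => lam * exp (- t))).
  - apply (filter_imp (fun t => Lf t = lam * exp (- t))); [easy | exact EL].
  - auto_derive; [easy|]; rewrite Ropp_0, exp_0; ring. }
apply is_derive_Reals in D.
assert (side : forall (P : R -> Prop), (forall t, P t -> t <> 0) ->
  filterlim (fun t => (Lf t - Lf 0) / t) (within P (locally 0)) (locally (- lam))).
{ intros P N; apply filterlim_locally; intros eps.
  destruct (D eps (cond_pos eps)) as [d Hd].
  exists d; intros t Ht Pt.
  change (Rabs ((Lf t - Lf 0) / t - - lam) < eps).
  specialize (Hd t (N t Pt)); rewrite Rplus_0_l in Hd; apply Hd.
  change (Rabs (t - 0) < d) in Ht; now rewrite Rminus_0_r in Ht. }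
assert (C := Crit sf Fam (- lam) (- lam)
  (side (fun t => t < 0) ltac:(intros; lra)) (side (fun t => 0 < t) ltac:(intros; lra))).
nra.
Qed.

(** * Restriction of smooth functions to a meridian *)

Lemma continuous_pair {U V W : UniformSpace} (f : U -> V) (g : U -> W) (x : U) :
  continuous f x -> continuous g x -> continuous (fun t => (f t, g t)) x.
Proof.
intros Hf Hg; apply (continuous_comp_2 f g pair); auto.
apply (continuous_ext (fun z => z)); [intros [a b]; reflexivity | apply continuous_id].
Qed.

(** The restriction of [G] to the meridian [theta = 0] of the sphere. *)
Definition slice (G : R3 -> R) (x : R) : R := G (sqrt (1 - x ^ 2), 0, x).

Lemma slice_continuous (G : R3 -> R) (x : R) :
  (forall p, continuous G p) -> continuous (slice G) x.
Proof.
intros H; apply (continuous_comp (fun x => (sqrt (1 - x ^ 2), 0, x)) G); [|apply H].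
apply (continuous_pair (fun x => (sqrt (1 - x ^ 2), 0)) (fun x => x)); [|apply continuous_id].
apply continuous_pair; [|apply continuous_const].
apply continuous_sqrt_comp, ex_derive_continuousR; auto_derive; easy.
Qed.

Lemma sqrt_rho_derive (x : R) : -1 < x < 1 ->
  is_derive (fun x => sqrt (1 - x ^ 2)) x (- x / sqrt (1 - x ^ 2)).
Proof.
intros Hx; pose proof (rho_pos x Hx) as P; pose proof (sqrt_lt_R0 _ P).
auto_derive; [lra|].
change (1 + - x ^ 2) with (1 - x ^ 2); replace (x * (x * 1)) with (x ^ 2) by ring.
change (1 + - x ^ 2) with (1 - x ^ 2); field; lra.
Qed.

Lemma slice_derive (G : R3 -> R) (x : R) : class_C 1 G -> -1 < x < 1 ->
  is_derive (slice G) x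
    (slice (partial3 axis1 G) x * (- x / sqrt (1 - x ^ 2)) + slice (partial3 axis3 G) x).
Proof.
intros [CG HG] Hx.
destruct (HG axis1) as [E1 [C1 _]], (HG axis3) as [E3 [C3 _]].
set (r := fun x => sqrt (1 - x ^ 2)).
set (f := fun a c => G (a, 0, c)).
(* Joint differentiability, needed for the chain rule along the meridian, from two partial
   derivatives of which the one in the first variable is continuous. *)
assert (F : differentiable_pt_lim f (r x) x (slice (partial3 axis1 G) x)
  (slice (partial3 axis3 G) x)).
{ apply filterdiff_differentiable_pt_lim.
  apply (is_derive_filterdiff f (r x) x (fun a c => partial3 axis1 G (a, 0, c))
    (slice (partial3 axis3 G) x)).
  - apply filter_forall; intros [a c]; apply Derive_correct, (E1 (a, 0, c)).
  - apply Derive_correct, (E3 (r x, 0, x)).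
  - apply (continuous_comp (fun u => (fst u, 0, snd u)) (partial3 axis1 G)); [|apply C1].
    apply (continuous_pair (fun u => (fst u, 0)) snd); [|apply continuous_snd].
    apply continuous_pair; [apply continuous_fst | apply continuous_const]. }
apply is_derive_Reals.
replace (slice (partial3 axis3 G) x) with (slice (partial3 axis3 G) x * 1) at 1 by ring.
apply (derivable_pt_lim_comp_2d f r (fun x => x)); [exact F | |].
- apply is_derive_Reals, sqrt_rho_derive, Hx.
- apply derivable_pt_lim_id.
Qed.

(** * The Laplacian in the coordinates [(x, theta)] *)

(** The area density is [1], the two diagonal coefficients of the metric being inverse to each
    other. *)
Lemma laplace_pot_eq (s : R -> R) (f : R -> R -> R) (x t : R) : Spot s -> -1 < x < 1 ->
  laplace_pot s f x t =
  - (Derive (fun a => / Derive_n s 2 a * Derive (fun u => f u t) a) x +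
     Derive_n s 2 x * Derive (fun b => Derive (fun v => f x v) b) t).
Proof.
intros [_ [P _]] Hx; unfold laplace_pot, laplace_beltrami.
assert (W : forall a, -1 < a < 1 ->
  sqrt (Derive_n s 2 a * / Derive_n s 2 a - 0 ^ 2) = 1).
{ intros a Ha; specialize (P a Ha).
  replace (Derive_n s 2 a * / Derive_n s 2 a - 0 ^ 2) with 1 by (field; lra).
  apply sqrt_1. }
rewrite (W x Hx).
rewrite (Derive_ext_loc _ (fun a => / Derive_n s 2 a * Derive (fun u => f u t) a)).
2: { apply (filter_imp (fun a => -1 < a < 1)); [|now apply locally_inside].
  intros a Ha; rewrite (W a Ha); field; specialize (P a Ha); lra. }
rewrite (Derive_ext (fun b => (Derive_n s 2 x * Derive (fun v => f x v) b -
   0 * Derive (fun u => f u b) x) / 1)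
  (fun b => Derive_n s 2 x * Derive (fun v => f x v) b)) by (intros; field).
rewrite Derive_scal; unfold Rdiv; rewrite Rinv_1, Rmult_1_r; reflexivity.
Qed.

Lemma clip_inside (x : R) : -1 <= x <= 1 -> clip x = x.
Proof.
intros Hx; unfold clip, Rmax, Rmin; destruct (Rle_dec 1 x), (Rle_dec (-1) _); lra.
Qed.

Lemma chart_proj (x t : R) : -1 <= x <= 1 ->
  proj1_sig (chart x t) = (sqrt (1 - x ^ 2) * cos t, sqrt (1 - x ^ 2) * sin t, x).
Proof. intros Hx; simpl; unfold radius; now rewrite clip_inside. Qed.

Lemma act_chart_proj (x t : R) : -1 <= x <= 1 ->
  proj1_sig (act t (chart x 0)) = proj1_sig (chart x t).
Proof.
intros Hx; change (rot t (proj1_sig (chart x 0)) = proj1_sig (chart x t)).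
rewrite !chart_proj by exact Hx; unfold rot; rewrite cos_0, sin_0.
apply f_equal2; [apply f_equal2; ring | reflexivity].
Qed.

Lemma polar_angle (a b : R) : a ^ 2 + b ^ 2 = 1 -> exists t, cos t = a /\ sin t = b.
Proof.
intros H.
assert (Ha : -1 <= a <= 1) by nra.
assert (Hs : sin (acos a) = Rabs b).
{ rewrite sin_acos by exact Ha.
  replace (1 - Rsqr a) with (Rsqr b) by (unfold Rsqr; nra); apply sqrt_Rsqr_abs. }
destruct (Rle_dec 0 b) as [Hb|Hb].
- exists (acos a); rewrite Hs, Rabs_pos_eq by exact Hb; split; [now apply cos_acos | easy].
- exists (- acos a); rewrite cos_neg, sin_neg, Hs, Rabs_left by lra.
  split; [now apply cos_acos | ring].
Qed.

Lemma sphere_chart (p : S2) : exists x t, -1 <= x <= 1 /\ proj1_sig p = proj1_sig (chart x t).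
Proof.
destruct p as [[[a b] c] H]; simpl proj1_sig at 1; unfold on_sphere in H.
assert (Hc : -1 <= c <= 1) by nra.
assert (Hr : 0 <= 1 - c ^ 2) by nra.
set (r := sqrt (1 - c ^ 2)).
assert (Er : r * r = 1 - c ^ 2) by now apply sqrt_sqrt.
destruct (Req_dec r 0) as [Z|N].
- exists c, 0; split; [exact Hc|]; rewrite chart_proj by exact Hc; fold r; rewrite Z.
  rewrite !Rmult_0_l; rewrite Z in Er.
  destruct (Rplus_sqr_eq_0 a b) as [-> ->]; [unfold Rsqr; lra | reflexivity].
- destruct (polar_angle (a / r) (b / r)) as [t [C S]].
  { field_simplify; [|exact N]; replace (r ^ 2) with (1 - c ^ 2) by (rewrite <- Er; ring).
    replace (a ^ 2 + b ^ 2) with (1 - c ^ 2) by lra; field.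
    rewrite <- Er; nra. }
  exists c, t; split; [exact Hc|]; rewrite chart_proj by exact Hc; fold r; rewrite C, S.
  apply f_equal2; [apply f_equal2; field; exact N | reflexivity].
Qed.

(** Elements of [S2] carry a membership proof; a smooth function does not see it, being induced by
    functions on [R3]. *)
Lemma smooth_S2_proj (F : S2 -> C) (p q : S2) :
  smooth_S2 F -> proj1_sig p = proj1_sig q -> F p = F q.
Proof. intros [G1 [G2 [_ [_ E]]]] H; now rewrite !E, H. Qed.

(** * The radial part of an eigenfunction *)

(** [om] is [psi' / s'']. *)
Record profile (k : Z) (s : R -> R) (m : R) (psi om : R -> R) : Prop := {
  pf_psi_continuous : forall x, continuous psi x;
  pf_om_continuous : forall x, continuous om x;
  pf_om_left : om (-1) = 0;
  pf_om_right : om 1 = 0;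
  pf_psi : forall x, -1 < x < 1 -> is_derive psi x (Derive_n s 2 x * om x);
  pf_om : forall x, -1 < x < 1 ->
    is_derive om x ((IZR k ^ 2 * Derive_n s 2 x - m) * psi x);
  pf_poles : k <> 0%Z -> psi (-1) = 0 /\ psi 1 = 0 }.

(** Along the meridian the derivative may grow like [/ sqrt (1 - x^2)] at the poles, but [1 / s'']
    vanishes there like [1 - x^2]. The product therefore extends continuously by [0]. *)
Lemma slice_om (s : R -> R) (G : R3 -> R) : Spot s -> smooth3 G ->
  exists om, (forall x, continuous om x) /\ om (-1) = 0 /\ om 1 = 0 /\
    (forall x, -1 < x < 1 -> is_derive (slice G) x (Derive_n s 2 x * om x)) /\
    (forall x, -1 < x < 1 -> ex_derive om x).
Proof.
intros Hs SG.
destruct (Spot_density s Hs) as [h [Sh [_ [Ds Pv]]]].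
set (v := fun x => 1 + (1 - x ^ 2) * Derive_n h 2 x) in *.
assert (Sv : Sm v) by (unfold v; smooth_tac).
destruct (recip_extension (-1) 1 v Sv Pv) as [rec [Srec Erec]].
pose proof (SG 2%nat) as [_ H2].
destruct (H2 axis1) as [_ C1], (H2 axis3) as [_ C3].
set (r := fun x => sqrt (1 - x ^ 2)).
set (Ga := slice (partial3 axis1 G)); set (Gc := slice (partial3 axis3 G)).
assert (Er : forall x, -1 <= x <= 1 -> r x * r x = 1 - x ^ 2).
{ intros x Hx; apply sqrt_sqrt; nra. }
assert (Pr : forall x, -1 < x < 1 -> 0 < r x).
{ intros x Hx; apply sqrt_lt_R0, rho_pos, Hx. }
exists (fun x => rec x * (Ga x * (- x * r x) + Gc x * (1 - x ^ 2))).
assert (R1 : forall e, e ^ 2 = 1 -> r e = 0).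
{ intros e He; unfold r; rewrite He, Rminus_diag; apply sqrt_0. }
split; [|split; [|split; [|split]]].
- intros x; apply continuous_multR; [now apply Sm_continuous|].
  apply (continuous_plus (fun x => Ga x * (- x * r x)) (fun x => Gc x * (1 - x ^ 2)));
    apply continuous_multR.
  + apply slice_continuous, (proj1 C1).
  + apply continuous_multR; [apply ex_derive_continuousR; auto_derive; easy|].
    apply continuous_sqrt_comp, ex_derive_continuousR; auto_derive; easy.
  + apply slice_continuous, (proj1 C3).
  + apply ex_derive_continuousR; auto_derive; easy.
- rewrite (R1 (-1)) by ring; ringR.
- rewrite (R1 1) by ring; ringR.
- intros x Hx.
  replace (Derive_n s 2 x * (rec x * (Ga x * (- x * r x) + Gc x * (1 - x ^ 2)))) with
    (Ga x * (- x / r x) + Gc x).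
  + apply slice_derive; [apply SG | exact Hx].
  + rewrite Ds, Erec by lra.
    pose proof (Pv x ltac:(lra)) as Pvx; fold (v x) in Pvx |- *.
    pose proof (Pr x Hx) as Prx; rewrite <- (Er x) by lra; field; lra.
- intros x Hx.
  apply (ex_derive_mult rec (fun x => Ga x * (- x * r x) + Gc x * (1 - x ^ 2))).
  { now apply Sm_ex_derive. }
  apply (ex_derive_plus (fun x => Ga x * (- x * r x)) (fun x => Gc x * (1 - x ^ 2))).
  + apply (ex_derive_mult Ga (fun x => - x * r x)).
    * eexists; apply slice_derive; [exact C1 | exact Hx].
    * apply (ex_derive_mult Ropp r); [auto_derive; easy|].
      eexists; now apply sqrt_rho_derive.
  + apply (ex_derive_mult Gc (fun x => 1 - x ^ 2)); [|auto_derive; easy].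
    eexists; apply slice_derive; [exact C3 | exact Hx].
Qed.

Lemma angular_derive2 (k a b t : R) :
  Derive (fun v => Derive (fun u => cos (k * u) * a + sin (k * u) * b) v) t =
  - k ^ 2 * (cos (k * t) * a + sin (k * t) * b).
Proof.
rewrite (Derive_ext _ (fun v => - k * sin (k * v) * a + k * cos (k * v) * b)).
- apply is_derive_unique; auto_derive; [easy | ring].
- intros v; apply is_derive_unique; auto_derive; [easy | ring].
Qed.

Lemma laplace_pot_ext (s : R -> R) (f g : R -> R -> R) (x t : R) : Spot s -> -1 < x < 1 ->
  (forall y u, -1 < y < 1 -> f y u = g y u) -> laplace_pot s f x t = laplace_pot s g x t.
Proof.
intros Hs Hx E; rewrite !laplace_pot_eq by auto.
f_equal; f_equal.
- apply Derive_ext_loc, (filter_imp (fun a => -1 < a < 1)); [|now apply locally_inside].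
  intros a Ha; f_equal; apply Derive_ext_loc, (filter_imp (fun a => -1 < a < 1));
    [|now apply locally_inside].
  intros y Hy; now apply E.
- f_equal; apply Derive_ext; intros b; apply Derive_ext; intros c; now apply E.
Qed.

(** By equivariance an eigenfunction is determined by its values on one meridian, so its real or its
    imaginary part is a nonzero profile. *)
Lemma is_eigenvalue_profile (k : Z) (s : R -> R) (m : R) :
  Spot s -> is_eigenvalue k s m ->
  exists psi om, profile k s m psi om /\ exists x, -1 <= x <= 1 /\ psi x <> 0.
Proof.
intros Hs [F [SF [EF [[p Np] [_ [_ L]]]]]].
pose proof SF as [G1 [G2 [S1 [S2 EG]]]].
assert (chart0 : forall x, -1 <= x <= 1 -> F (chart x 0) = (slice G1 x, slice G2 x)).
{ intros x Hx; rewrite EG, chart_proj by exact Hx.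
  unfold slice; now rewrite cos_0, sin_0, Rmult_1_r, Rmult_0_r. }
assert (chartt : forall x t, -1 <= x <= 1 -> F (chart x t) =
  (cos (IZR k * t) * slice G1 x - sin (IZR k * t) * slice G2 x,
   cos (IZR k * t) * slice G2 x + sin (IZR k * t) * slice G1 x)).
{ intros x t Hx.
  rewrite <- (smooth_S2_proj F (act t (chart x 0)) (chart x t) SF (act_chart_proj x t Hx)).
  rewrite EF, chart0 by exact Hx; reflexivity. }
(* Rotation by [PI / k] fixes the pole and multiplies [F] by [-1]. *)
assert (poles : k <> 0%Z -> forall e, (e = -1 \/ e = 1) -> slice G1 e = 0 /\ slice G2 e = 0).
{ intros Nk e He.
  assert (Ie : -1 <= e <= 1) by lra.
  assert (Re : sqrt (1 - e ^ 2) = 0).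
  { destruct He as [-> | ->]; rewrite <- sqrt_0; f_equal; ring. }
  assert (E : F (chart e (PI / IZR k)) = F (chart e 0)).
  { apply smooth_S2_proj; [exact SF|]; rewrite !chart_proj, Re by exact Ie.
    now rewrite !Rmult_0_l. }
  rewrite chartt, chart0 in E by exact Ie.
  assert (Nk' : IZR k <> 0) by (now apply not_0_IZR).
  replace (IZR k * (PI / IZR k)) with PI in E by (field; exact Nk').
  rewrite cos_PI, sin_PI in E; injection E; intros; lra. }
(* At angle [0] two derivatives in the angle give [- k^2] times the value; the partner [Gb] comes
   with a sine and drops out. *)
assert (main : forall G Gb, smooth3 G -> smooth3 Gb ->
  (forall x, -1 < x < 1 -> m * slice G x = laplace_pot s (fun x t =>
     cos (IZR k * t) * slice G x + sin (IZR k * t) * slice Gb x) x 0) ->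
  (k <> 0%Z -> slice G (-1) = 0 /\ slice G 1 = 0) ->
  exists om, profile k s m (slice G) om).
{ intros G Gb SG SGb E Z.
  destruct (slice_om s G Hs SG) as [om [Com [O1 [O2 [Dpsi Eom]]]]].
  exists om; split; auto.
  - intros x; apply slice_continuous, (SG O).
  - intros x Hx; specialize (E x Hx).
    rewrite laplace_pot_eq in E by auto.
    rewrite (Derive_ext_loc _ om) in E.
    + replace ((IZR k ^ 2 * Derive_n s 2 x - m) * slice G x) with (Derive om x);
        [now apply Derive_correct, Eom|].
      rewrite (angular_derive2 (IZR k) (slice G x) (slice Gb x) 0) in E.
      rewrite Rmult_0_r, cos_0, sin_0 in E; lra.
    + apply (filter_imp (fun a => -1 < a < 1)); [|now apply locally_inside].
      intros a Ha.
      rewrite (Derive_ext _ (slice G)).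
      * rewrite (is_derive_unique _ _ _ (Dpsi a Ha)).
        destruct Hs as [_ [P _]]; specialize (P a Ha); field; lra.
      * intros u; rewrite Rmult_0_r, cos_0, sin_0; ring. }
assert (chartE : forall x t, -1 < x < 1 -> F (chart x t) =
  (cos (IZR k * t) * slice G1 x - sin (IZR k * t) * slice G2 x,
   cos (IZR k * t) * slice G2 x + sin (IZR k * t) * slice G1 x)).
{ intros; apply chartt; lra. }
(* The real part rotates with [- sin], the imaginary part with [+ sin]; using [- G2] as the partner
   of [G1] lets [main] treat both. *)
assert (SN : smooth3 (fun p => -1 * G2 p) /\ slice (fun p => -1 * G2 p) = fun x => - slice G2 x).
{ split; [|apply functional_extensionality; intros x; unfold slice; ring].
  assert (sc : forall n G, class_C n G -> class_C n (fun p => -1 * G p)).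
  { clear; induction n as [|n IH]; intros G [C H]; split;
      try (intros q; apply (continuous_mult (fun _ => -1) G); [apply continuous_const | apply C]).
    - exact I.
    - intros i; destruct (H i) as [E D]; split.
      + intros [[a b] c]; specialize (E (a, b, c)); destruct i; simpl in *;
          now apply ex_derive_scal.
      + replace (partial3 i (fun p => -1 * G p)) with (fun p => -1 * partial3 i G p);
          [now apply IH|].
        apply functional_extensionality; intros [[a b] c]; destruct i; simpl;
          symmetry; apply Derive_scal. }
  intros n; apply sc, S2. }
destruct SN as [SN EN].
destruct (main G1 (fun p => -1 * G2 p) S1 SN) as [om1 P1].
{ intros x Hx; specialize (L x 0 Hx).
  apply (f_equal fst) in L; rewrite chart0 in L by lra; simpl in L.
  rewrite EN.
  transitivity (m * slice G1 x - 0 * slice G2 x); [ring|].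
  rewrite L; apply laplace_pot_ext; [exact Hs | exact Hx|]; intros y u Hy.
  rewrite chartE by exact Hy; simpl; ring. }
{ intros Nk; split; apply (poles Nk); auto. }
destruct (main G2 G1 S2 S1) as [om2 P2].
{ intros x Hx; specialize (L x 0 Hx).
  apply (f_equal snd) in L; rewrite chart0 in L by lra; simpl in L.
  transitivity (m * slice G2 x + 0 * slice G1 x); [ring|].
  rewrite L; apply laplace_pot_ext; [exact Hs | exact Hx|]; intros y u Hy.
  rewrite chartE by exact Hy; simpl; ring. }
{ intros Nk; split; apply (poles Nk); auto. }
destruct (sphere_chart p) as [x [t [Hx Ep]]].
rewrite (smooth_S2_proj F p (chart x t) SF Ep), chartt in Np by exact Hx.
destruct (Req_dec (slice G1 x) 0) as [Z1|N1].
- destruct (Req_dec (slice G2 x) 0) as [Z2|N2].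
  + exfalso; apply Np; rewrite Z1, Z2; unfold RtoC; f_equal; ring.
  + exists (slice G2), om2; eauto.
- exists (slice G1), om1; eauto.
Qed.

(** * Minimality, by Picone's identity *)

Definition vanishes_at_poles (B : R -> R) : Prop :=
  forall eps, 0 < eps -> exists d, 0 < d /\
    forall x, -1 < x < 1 -> 1 - Rabs x < d -> Rabs (B x) < eps.

Lemma continuous_vanishes_at_poles (f : R -> R) :
  (forall x, continuous f x) -> f (-1) = 0 -> f 1 = 0 -> vanishes_at_poles f.
Proof.
intros C F1 F2 eps He.
assert (E : forall e, f e = 0 -> exists d, 0 < d /\ forall x, Rabs (x - e) < d -> Rabs (f x) < eps).
{ intros e Fe.
  destruct (continuity_pt_pos (fun x => eps - Rabs (f x)) e) as [d [Pd Hd]].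
  - apply (continuity_pt_minus (fun _ => eps) (fun x => Rabs (f x))).
    + apply continuity_pt_const; intros ? ?; reflexivity.
    + apply (continuity_pt_comp f Rabs); [apply continuity_pt_filterlim, C | apply Rcontinuity_abs].
  - rewrite Fe, Rabs_R0; lra.
  - exists d; split; [exact Pd|]; intros x Hx; specialize (Hd x Hx); lra. }
destruct (E (-1) F1) as [d1 [P1 H1]], (E 1 F2) as [d2 [P2 H2]].
exists (Rmin d1 d2); split; [now apply Rmin_case|]; intros x Hx Hd.
pose proof (Rmin_l d1 d2); pose proof (Rmin_r d1 d2).
destruct (Rle_dec 0 x) as [P|P].
- rewrite Rabs_pos_eq in Hd by lra; apply H2; rewrite Rabs_left; lra.
- rewrite Rabs_left in Hd by lra; apply H1; rewrite Rabs_pos_eq; lra.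
Qed.

Lemma vanishes_at_poles_le (B f : R -> R) :
  vanishes_at_poles f -> (forall x, -1 < x < 1 -> Rabs (B x) <= f x) -> vanishes_at_poles B.
Proof.
intros H L eps He; destruct (H eps He) as [d [Pd Hd]]; exists d; split; [exact Pd|].
intros x Hx Hxd; specialize (Hd x Hx Hxd); pose proof (L x Hx); pose proof (Rle_abs (f x)); lra.
Qed.

(** A nondecreasing function that tends to [0] at both ends is identically [0]. *)
Lemma nondecreasing_vanishing (B B' : R -> R) :
  (forall x, -1 < x < 1 -> is_derive B x (B' x)) -> (forall x, -1 < x < 1 -> 0 <= B' x) ->
  vanishes_at_poles B -> forall x, -1 < x < 1 -> B' x = 0.
Proof.
intros D P V.
assert (mono : forall x y, -1 < x -> x <= y -> y < 1 -> B x <= B y).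
{ intros x y Hx Hxy Hy; apply (nondecreasing_open B B'); auto.
  - intros z Hz; apply (is_derive_continuous B z (B' z)), D; lra.
  - intros z Hz; apply D; lra.
  - intros z Hz; apply P; lra. }
assert (Z : forall x, -1 < x < 1 -> B x = 0).
{ intros x Hx; destruct (Req_dec (B x) 0) as [E|N]; [exact E | exfalso].
  destruct (V (Rabs (B x)) (Rabs_pos_lt _ N)) as [d [Pd Hd]].
  assert (Hax : Rabs x < 1) by (apply Rabs_lt_between; lra).
  pose proof (Rabs_pos x).
  set (y := Rmax (Rabs x) (1 - d / 2)).
  assert (Hy : Rabs x <= y /\ 1 - d / 2 <= y /\ y < 1).
  { unfold y; split; [apply Rmax_l | split; [apply Rmax_r | apply Rmax_lub_lt; lra]]. }
  assert (Hxy : - y <= x <= y) by (apply Rabs_le_between; lra).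
  destruct (Rle_dec 0 (B x)) as [S|S].
  - pose proof (Hd y ltac:(lra) ltac:(rewrite Rabs_pos_eq; lra)) as L.
    pose proof (mono x y ltac:(lra) ltac:(lra) ltac:(lra)).
    rewrite (Rabs_pos_eq (B x)) in L by lra; pose proof (Rle_abs (B y)); lra.
  - pose proof (Hd (- y) ltac:(lra) ltac:(rewrite Rabs_Ropp, Rabs_pos_eq; lra)) as L.
    pose proof (mono (- y) x ltac:(lra) ltac:(lra) ltac:(lra)).
    rewrite (Rabs_left (B x)) in L by lra; pose proof (Rle_abs (- B (- y))).
    rewrite Rabs_Ropp in *; lra. }
intros x Hx.
rewrite <- (is_derive_unique B x (B' x) (D x Hx)).
rewrite (Derive_ext_loc _ (fun _ => 0)); [apply Derive_const|].
apply (filter_imp (fun y => -1 < y < 1)); [exact Z | now apply locally_inside].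
Qed.

Lemma vanishing_inside (psi : R -> R) : (forall x, continuous psi x) ->
  (forall x, -1 < x < 1 -> psi x = 0) -> forall x, -1 <= x <= 1 -> psi x = 0.
Proof.
intros C E; apply (eq_at_endpoints psi (fun _ => 0)); auto; intros; apply continuous_const.
Qed.

(** [p] is [u f' / f] for a positive eigenfunction [f cos (k theta)], where [u = 1 / s'']. *)
Lemma eigenvalue_ge_nonzero (k : Z) (s p psi om : R -> R) (lam m K : R) :
  k <> 0%Z -> Spot s -> profile k s m psi om ->
  (forall x, -1 < x < 1 ->
    is_derive p x ((IZR k ^ 2 - p x ^ 2) * Derive_n s 2 x - lam)) ->
  (forall x, -1 < x < 1 -> Rabs (p x) <= K) ->
  (exists x, -1 <= x <= 1 /\ psi x <> 0) -> lam <= m.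
Proof.
intros Nk Hs Hp Dp Bp [x0 [Hx0 N0]]; apply Rnot_lt_le; intros Hlt; apply N0.
pose proof Hs as [_ [Ps _]].
destruct (pf_poles _ _ _ _ _ Hp Nk) as [Z1 Z2].
apply (vanishing_inside psi (pf_psi_continuous _ _ _ _ _ Hp)); [|exact Hx0].
clear x0 Hx0 N0.
(* Picone's identity: this is the derivative of [om psi - p psi^2]. For [m < lam] both summands are
   nonnegative, and the boundary terms vanish since [p] is bounded and [psi] is [0] at the poles. *)
set (B' := fun x => Derive_n s 2 x * (om x - p x * psi x) ^ 2 + (lam - m) * psi x ^ 2).
assert (nn : forall x, -1 < x < 1 -> 0 <= Derive_n s 2 x * (om x - p x * psi x) ^ 2).
{ intros x Hx; apply Rmult_le_pos; [specialize (Ps x Hx); lra | apply pow2_ge_0]. }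
assert (Z : forall x, -1 < x < 1 -> B' x = 0).
{ apply (nondecreasing_vanishing (fun x => om x * psi x - p x * psi x ^ 2)).
  - intros x Hx.
    pose proof (pf_psi _ _ _ _ _ Hp x Hx) as D1.
    pose proof (pf_om _ _ _ _ _ Hp x Hx) as D2.
    pose proof (Dp x Hx) as D3.
    auto_derive.
    + repeat split; eexists; eassumption.
    + change (fun x => om x) with om; change (fun x => p x) with p;
        change (fun x => psi x) with psi.
      rewrite (is_derive_unique _ _ _ D1), (is_derive_unique _ _ _ D2),
        (is_derive_unique _ _ _ D3); unfold B'; ring.
  - intros x Hx; unfold B'; pose proof (nn x Hx); pose proof (pow2_ge_0 (psi x)); nra.
  - apply (vanishes_at_poles_le _ (fun x => Rabs (om x) * Rabs (psi x) + K * psi x ^ 2)).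
    + apply continuous_vanishes_at_poles.
      * intros x; apply (continuous_plus (fun x => Rabs (om x) * Rabs (psi x)) (fun x => K * psi x ^ 2)).
        -- apply continuous_multR; apply (continuous_comp _ Rabs); try apply continuous_Rabs.
           ++ apply (pf_om_continuous _ _ _ _ _ Hp).
           ++ apply (pf_psi_continuous _ _ _ _ _ Hp).
        -- apply continuous_multR; [apply continuous_const|].
           apply (continuous_comp psi (fun y => y ^ 2)); [apply (pf_psi_continuous _ _ _ _ _ Hp)|].
           apply continuous_pow.
      * rewrite Z1, Rabs_R0; ring.
      * rewrite Z2, Rabs_R0; ring.
    + intros x Hx; unfold Rminus; eapply Rle_trans; [apply Rabs_triang|].
      rewrite Rabs_Ropp, !Rabs_mult.
      apply Rplus_le_compat_l.
      rewrite (Rabs_pos_eq (psi x ^ 2)) by apply pow2_ge_0.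
      apply Rmult_le_compat_r; [apply pow2_ge_0 | now apply Bp]. }
intros x Hx; specialize (Z x Hx); unfold B' in Z.
pose proof (nn x Hx); pose proof (pow2_ge_0 (psi x)).
assert (psi x ^ 2 = 0) by nra; nra.
Qed.

(** [P] is [w' / w] for a positive solution [w] of [w'' = - lam s'' w]; the derivative [u f']
    of an invariant eigenfunction [f] solves this equation. *)
Lemma eigenvalue_ge_zero (s P psi om : R -> R) (lam m K : R) :
  Spot s -> profile 0 s m psi om -> 0 < m ->
  (forall x, -1 < x < 1 -> is_derive P x (- lam * Derive_n s 2 x - P x ^ 2)) ->
  (forall x, -1 < x < 1 -> Rabs (P x) * (1 - x ^ 2) <= K) ->
  (exists x, -1 <= x <= 1 /\ psi x <> 0) -> lam <= m.
Proof.
intros Hs Hp Pm DP BP [x0 [Hx0 N0]]; apply Rnot_lt_le; intros Hlt; apply N0.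
pose proof Hs as [_ [Ps _]].
apply (vanishing_inside psi (pf_psi_continuous _ _ _ _ _ Hp)); [|exact Hx0].
clear x0 Hx0 N0.
assert (Dom : forall x, -1 < x < 1 -> is_derive om x (- m * psi x)).
{ intros x Hx; replace (- m * psi x) with ((0 ^ 2 * Derive_n s 2 x - m) * psi x) by ring.
  apply (pf_om _ _ _ _ _ Hp x Hx). }
destruct (continuous_bounded psi (-1) 1 (pf_psi_continuous _ _ _ _ _ Hp)) as [M [PM HM]].
(* [om' = - m psi] is bounded and [om] vanishes at the poles. The resulting factor [1 - x^2]
   compensates the pole of [P] in the boundary term [P om^2]. *)
assert (Lom : forall x, -1 < x < 1 -> Rabs (om x) <= m * M * (1 - x ^ 2)).
{ intros x Hx.
  assert (L : forall y, -1 < y < 1 -> Rabs (m * psi y) <= m * M).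
  { intros y Hy; rewrite Rabs_mult, (Rabs_pos_eq m) by lra.
    apply Rmult_le_compat_l; [lra | apply HM; lra]. }
  assert (PmM : 0 < m * M) by now apply Rmult_lt_0_compat.
  destruct (Rle_dec 0 x) as [Px|Px].
  - destruct (MVT_open om (fun x => - m * psi x) x 1) as [c [Hc E]]; [lra | | |].
    + intros; apply (pf_om_continuous _ _ _ _ _ Hp).
    + intros y Hy; apply Dom; lra.
    + rewrite (pf_om_right _ _ _ _ _ Hp) in E.
      replace (om x) with (m * psi c * (1 - x)) by lra.
      rewrite Rabs_mult, (Rabs_pos_eq (1 - x)) by lra.
      pose proof (L c ltac:(lra)); pose proof (Rabs_pos (m * psi c)).
      apply (Rle_trans _ (m * M * (1 - x))); [apply Rmult_le_compat_r; lra|].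
      apply Rmult_le_compat_l; [lra | nra].
  - destruct (MVT_open om (fun x => - m * psi x) (-1) x) as [c [Hc E]]; [lra | | |].
    + intros; apply (pf_om_continuous _ _ _ _ _ Hp).
    + intros y Hy; apply Dom; lra.
    + rewrite (pf_om_left _ _ _ _ _ Hp) in E.
      replace (om x) with (- (m * psi c) * (x + 1)) by lra.
      rewrite Rabs_mult, Rabs_Ropp, (Rabs_pos_eq (x + 1)) by lra.
      pose proof (L c ltac:(lra)); pose proof (Rabs_pos (m * psi c)).
      apply (Rle_trans _ (m * M * (x + 1))); [apply Rmult_le_compat_r; lra|].
      apply Rmult_le_compat_l; [lra | nra]. }
(* Since [om'' = - m s'' om], Picone's identity is applied to [om] rather than [psi]: this is the
   derivative of [om om' - P om^2]. *)
set (B' := fun x => (m * psi x + P x * om x) ^ 2 + (lam - m) * Derive_n s 2 x * om x ^ 2).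
assert (nn : forall x, -1 < x < 1 -> 0 <= (lam - m) * Derive_n s 2 x * om x ^ 2).
{ intros x Hx; apply Rmult_le_pos; [|apply pow2_ge_0].
  apply Rmult_le_pos; [lra | specialize (Ps x Hx); lra]. }
assert (Z : forall x, -1 < x < 1 -> B' x = 0).
{ apply (nondecreasing_vanishing (fun x => - m * psi x * om x - P x * om x ^ 2)).
  - intros x Hx.
    pose proof (pf_psi _ _ _ _ _ Hp x Hx) as D1.
    pose proof (Dom x Hx) as D2.
    pose proof (DP x Hx) as D3.
    auto_derive.
    + repeat split; eexists; eassumption.
    + change (fun x => om x) with om; change (fun x => P x) with P;
        change (fun x => psi x) with psi.
      rewrite (is_derive_unique _ _ _ D1), (is_derive_unique _ _ _ D2),
        (is_derive_unique _ _ _ D3); unfold B'; ring.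
  - intros x Hx; unfold B'; pose proof (nn x Hx).
    pose proof (pow2_ge_0 (m * psi x + P x * om x)); lra.
  - apply (vanishes_at_poles_le _ (fun x => (m * M + K * (m * M)) * Rabs (om x))).
    + apply continuous_vanishes_at_poles.
      * intros x; apply continuous_multR; [apply continuous_const|].
        apply (continuous_comp _ Rabs); [apply (pf_om_continuous _ _ _ _ _ Hp) | apply continuous_Rabs].
      * rewrite (pf_om_left _ _ _ _ _ Hp), Rabs_R0; ring.
      * rewrite (pf_om_right _ _ _ _ _ Hp), Rabs_R0; ring.
    + intros x Hx; unfold Rminus; eapply Rle_trans; [apply Rabs_triang|].
      rewrite Rabs_Ropp, Rmult_plus_distr_r, !Rabs_mult.
      rewrite Rabs_Ropp, (Rabs_pos_eq m), <- RPow_abs by lra.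
      pose proof (HM x ltac:(lra)); pose proof (Rabs_pos (om x)); pose proof (Rabs_pos (P x)).
      pose proof (Lom x Hx) as Lo; pose proof (BP x Hx) as Bo.
      apply Rplus_le_compat.
      * apply Rmult_le_compat_r; [lra|]; apply Rmult_le_compat_l; lra.
      * replace (Rabs (P x) * Rabs (om x) ^ 2) with ((Rabs (P x) * Rabs (om x)) * Rabs (om x)) by ring.
        apply Rmult_le_compat_r; [lra|].
        apply (Rle_trans _ (Rabs (P x) * (m * M * (1 - x ^ 2)))).
        -- apply Rmult_le_compat_l; lra.
        -- replace (Rabs (P x) * (m * M * (1 - x ^ 2))) with
             (Rabs (P x) * (1 - x ^ 2) * (m * M)) by ring.
           apply Rmult_le_compat_r; [|exact Bo].
           apply Rmult_le_pos; lra. }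
assert (Zom : forall x, -1 < x < 1 -> om x = 0).
{ intros x Hx; specialize (Z x Hx); unfold B' in Z.
  pose proof (nn x Hx); pose proof (pow2_ge_0 (m * psi x + P x * om x)).
  specialize (Ps x Hx).
  assert (E : (lam - m) * Derive_n s 2 x * om x ^ 2 = 0) by lra.
  assert (0 < (lam - m) * Derive_n s 2 x) by (apply Rmult_lt_0_compat; lra).
  assert (om x ^ 2 = 0) by nra; nra. }
intros x Hx.
(* The flux [om] also vanishes for constant functions; [0 < m] is what rules them out. *)
assert (E : - m * psi x = 0); [|nra].
rewrite <- (is_derive_unique _ _ _ (Dom x Hx)).
rewrite (Derive_ext_loc _ (fun _ => 0)); [apply Derive_const|].
apply (filter_imp (fun y => -1 < y < 1)); [exact Zom | now apply locally_inside].
Qed.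

(** * Smooth functions on R^3 *)

Lemma class_C_pred (n : nat) : forall f, class_C (S n) f -> class_C n f.
Proof.
induction n as [|n IH]; intros f [C H]; split; auto.
intros i; destruct (H i) as [E D]; split; [exact E | now apply IH].
Qed.

Lemma partial3_plus (i : axis) (f g : R3 -> R) :
  (forall p, ex_partial3 i f p) -> (forall p, ex_partial3 i g p) ->
  partial3 i (fun p => f p + g p) = (fun p => partial3 i f p + partial3 i g p).
Proof.
intros Ef Eg; apply functional_extensionality; intros [[a b] c].
specialize (Ef (a, b, c)); specialize (Eg (a, b, c)); destruct i; simpl in *.
- now apply (Derive_plus (fun u => f (u, b, c)) (fun u => g (u, b, c))).
- now apply (Derive_plus (fun u => f (a, u, c)) (fun u => g (a, u, c))).
- now apply (Derive_plus (fun u => f (a, b, u)) (fun u => g (a, b, u))).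
Qed.

Lemma partial3_mult (i : axis) (f g : R3 -> R) :
  (forall p, ex_partial3 i f p) -> (forall p, ex_partial3 i g p) ->
  partial3 i (fun p => f p * g p) = (fun p => partial3 i f p * g p + f p * partial3 i g p).
Proof.
intros Ef Eg; apply functional_extensionality; intros [[a b] c].
specialize (Ef (a, b, c)); specialize (Eg (a, b, c)); destruct i; simpl in *.
- now apply (Derive_mult (fun u => f (u, b, c)) (fun u => g (u, b, c))).
- now apply (Derive_mult (fun u => f (a, u, c)) (fun u => g (a, u, c))).
- now apply (Derive_mult (fun u => f (a, b, u)) (fun u => g (a, b, u))).
Qed.

Lemma class_C_plus (n : nat) :
  forall f g, class_C n f -> class_C n g -> class_C n (fun p => f p + g p).
Proof.
induction n as [|n IH]; intros f g [Cf Hf] [Cg Hg];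
  (split; [intros p; apply (continuous_plus f g); auto|]); [exact I|].
intros i; destruct (Hf i) as [Ef Df], (Hg i) as [Eg Dg]; split.
- intros [[a b] c]; specialize (Ef (a, b, c)); specialize (Eg (a, b, c)); destruct i; simpl in *.
  + now apply (ex_derive_plus (fun u => f (u, b, c)) (fun u => g (u, b, c))).
  + now apply (ex_derive_plus (fun u => f (a, u, c)) (fun u => g (a, u, c))).
  + now apply (ex_derive_plus (fun u => f (a, b, u)) (fun u => g (a, b, u))).
- rewrite partial3_plus by assumption; now apply IH.
Qed.

Lemma class_C_mult (n : nat) :
  forall f g, class_C n f -> class_C n g -> class_C n (fun p => f p * g p).
Proof.
induction n as [|n IH]; intros f g Hf' Hg'.
- destruct Hf' as [Cf _], Hg' as [Cg _]; split; [|exact I].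
  intros p; apply (continuous_mult f g); auto.
- pose proof (class_C_pred _ _ Hf') as Pf; pose proof (class_C_pred _ _ Hg') as Pg.
  destruct Hf' as [Cf Hf], Hg' as [Cg Hg].
  split; [intros p; apply (continuous_mult f g); auto|].
  intros i; destruct (Hf i) as [Ef Df], (Hg i) as [Eg Dg]; split.
  + intros [[a b] c]; specialize (Ef (a, b, c)); specialize (Eg (a, b, c)); destruct i; simpl in *.
    * now apply (ex_derive_mult (fun u => f (u, b, c)) (fun u => g (u, b, c))).
    * now apply (ex_derive_mult (fun u => f (a, u, c)) (fun u => g (a, u, c))).
    * now apply (ex_derive_mult (fun u => f (a, b, u)) (fun u => g (a, b, u))).
  + rewrite partial3_mult by assumption; apply class_C_plus; now apply IH.
Qed.

Lemma class_C_const (n : nat) (r : R) : class_C n (fun _ => r).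
Proof.
revert r; induction n as [|n IH]; intros r; (split; [intros; apply continuous_const|]); [exact I|].
intros i; split.
- intros [[a b] c]; destruct i; simpl; apply (ex_derive_const (V := R_NormedModule)).
- replace (partial3 i (fun _ => r)) with (fun _ : R3 => 0); [apply IH|].
  apply functional_extensionality; intros [[a b] c]; destruct i; simpl; now rewrite Derive_const.
Qed.

Definition coord (i : axis) (p : R3) : R :=
  let '(a, b, c) := p in match i with axis1 => a | axis2 => b | axis3 => c end.

Lemma coord_continuous (i : axis) (p : R3) : continuous (coord i) p.
Proof.
destruct i.
- apply (continuous_ext (fun p : R3 => fst (fst p))); [now intros [[a b] c]|].
  apply (continuous_comp fst fst); apply continuous_fst.
- apply (continuous_ext (fun p : R3 => snd (fst p))); [now intros [[a b] c]|].
  apply (continuous_comp fst snd); [apply continuous_fst | apply continuous_snd].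
- apply (continuous_ext (fun p : R3 => snd p)); [now intros [[a b] c]|].
  apply continuous_snd.
Qed.

Lemma smooth3_comp_coord (i : axis) (h : R -> R) : Sm h -> smooth3 (fun p => h (coord i p)).
Proof.
intros Sh n; revert h Sh; induction n as [|n IH]; intros h Sh.
- split; [|exact I]; intros p; apply (continuous_comp (coord i) h); [apply coord_continuous|].
  now apply Sm_continuous.
- split.
  { intros p; apply (continuous_comp (coord i) h); [apply coord_continuous|].
    now apply Sm_continuous. }
  intros j; split.
  + intros [[a b] c]; destruct i, j; simpl;
      first [now apply (Sm_ex_derive h) | apply (ex_derive_const (V := R_NormedModule))].
  + assert (D : partial3 j (fun p => h (coord i p)) = (fun p => Derive h (coord i p)) \/
      partial3 j (fun p => h (coord i p)) = (fun _ => 0)).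
    { destruct i, j; (now left; apply functional_extensionality; intros [[a b] c]) ||
        (right; apply functional_extensionality; intros [[a b] c]; simpl; apply Derive_const). }
    destruct D as [-> | ->]; [apply IH; smooth_tac | apply class_C_const].
Qed.

Lemma smooth3_coord (i : axis) : smooth3 (coord i).
Proof. apply (smooth3_comp_coord i (fun x => x)); smooth_tac. Qed.

Lemma smooth3_const (r : R) : smooth3 (fun _ => r).
Proof. intros n; apply class_C_const. Qed.

Lemma smooth3_plus (f g : R3 -> R) : smooth3 f -> smooth3 g -> smooth3 (fun p => f p + g p).
Proof. intros Hf Hg n; now apply class_C_plus. Qed.

Lemma smooth3_mult (f g : R3 -> R) : smooth3 f -> smooth3 g -> smooth3 (fun p => f p * g p).
Proof. intros Hf Hg n; now apply class_C_mult. Qed.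

(** * Construction of eigenfunctions *)

(** The real and imaginary parts of [(a + i b)^n] at [(a, b, c)]. *)
Fixpoint zpow (n : nat) (p : R3) : R * R :=
  match n with
  | O => (1, 0)
  | S n => let '(x, y) := zpow n p in
      (coord axis1 p * x - coord axis2 p * y, coord axis1 p * y + coord axis2 p * x)
  end.

Lemma zpow_S (n : nat) (p : R3) : zpow (S n) p =
  (coord axis1 p * fst (zpow n p) - coord axis2 p * snd (zpow n p),
   coord axis1 p * snd (zpow n p) + coord axis2 p * fst (zpow n p)).
Proof. simpl; now destruct (zpow n p). Qed.

Lemma zpow_smooth3 (n : nat) :
  smooth3 (fun p => fst (zpow n p)) /\ smooth3 (fun p => snd (zpow n p)).
Proof.
induction n as [|n [IH1 IH2]]; [split; [apply (smooth3_const 1) | apply (smooth3_const 0)]|].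
split.
- replace (fun p => fst (zpow (S n) p)) with (fun p => coord axis1 p * fst (zpow n p) +
    (-1) * (coord axis2 p * snd (zpow n p))).
  + repeat first [apply smooth3_plus | apply smooth3_mult | apply smooth3_coord
      | apply smooth3_const | assumption].
  + apply functional_extensionality; intros p; rewrite zpow_S; simpl; ring.
- replace (fun p => snd (zpow (S n) p)) with (fun p => coord axis1 p * snd (zpow n p) +
    coord axis2 p * fst (zpow n p)).
  + repeat first [apply smooth3_plus | apply smooth3_mult | apply smooth3_coord
      | apply smooth3_const | assumption].
  + apply functional_extensionality; intros p; now rewrite zpow_S.
Qed.

Lemma zpow_rot (n : nat) (t : R) (p : R3) : zpow n (rot t p) =
  (cos (INR n * t) * fst (zpow n p) - sin (INR n * t) * snd (zpow n p),
   sin (INR n * t) * fst (zpow n p) + cos (INR n * t) * snd (zpow n p)).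
Proof.
induction n as [|n IH]; [simpl; rewrite Rmult_0_l, cos_0, sin_0; f_equal; ring|].
rewrite !zpow_S, IH, S_INR, Rmult_plus_distr_r, Rmult_1_l, cos_plus, sin_plus.
destruct p as [[a b] c]; simpl coord; simpl fst; simpl snd; f_equal; ring.
Qed.

Lemma zpow_polar (n : nat) (r t c : R) : zpow n (r * cos t, r * sin t, c) =
  (r ^ n * cos (INR n * t), r ^ n * sin (INR n * t)).
Proof.
induction n as [|n IH]; [simpl; rewrite Rmult_0_l, cos_0, sin_0; f_equal; ring|].
rewrite zpow_S, IH, S_INR, Rmult_plus_distr_r, Rmult_1_l, cos_plus, sin_plus.
simpl coord; simpl fst; simpl snd; simpl pow; f_equal; ring.
Qed.

Lemma smooth_S2_scal (l : R) (F : S2 -> C) :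
  smooth_S2 F -> smooth_S2 (fun p => Cmult (RtoC l) (F p)).
Proof.
intros [G1 [G2 [S1 [S2 E]]]]; exists (fun p => l * G1 p), (fun p => l * G2 p).
split; [|split].
- apply smooth3_mult; [apply smooth3_const | exact S1].
- apply smooth3_mult; [apply smooth3_const | exact S2].
- intros p; rewrite E; unfold Cmult, RtoC; simpl; f_equal; ring.
Qed.

Lemma laplace_pot_separated (s f om : R -> R) (k l a b x t : R) : Spot s -> -1 < x < 1 ->
  (forall x, -1 < x < 1 -> is_derive f x (Derive_n s 2 x * om x)) ->
  (forall x, -1 < x < 1 -> is_derive om x ((k ^ 2 * Derive_n s 2 x - l) * f x)) ->
  laplace_pot s (fun x t => f x * (cos (k * t) * a + sin (k * t) * b)) x t =
  l * (f x * (cos (k * t) * a + sin (k * t) * b)).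
Proof.
intros Hs Hx Df Dom; rewrite laplace_pot_eq by assumption.
set (T := fun t => cos (k * t) * a + sin (k * t) * b).
rewrite (Derive_ext_loc _ (fun a => T t * om a)).
- rewrite Derive_scal, (is_derive_unique _ _ _ (Dom x Hx)).
  rewrite (Derive_ext _ (fun c => f x * Derive (fun v => cos (k * v) * a + sin (k * v) * b) c)).
  + rewrite Derive_scal, angular_derive2; unfold T; ring.
  + intros c; apply Derive_scal.
- apply (filter_imp (fun y => -1 < y < 1)); [|now apply locally_inside].
  intros y Hy.
  rewrite (Derive_ext _ (fun u => T t * f u)) by (intros; apply Rmult_comm).
  rewrite Derive_scal, (is_derive_unique _ _ _ (Df y Hy)).
  destruct Hs as [_ [P _]]; specialize (P y Hy); field; lra.
Qed.

(** [sqrt (1 - x^2)^|k| exp(i k theta)] is the restriction of [(a + i b)^|k|], or of its conjugate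
    when [k < 0]. So the eigenfunction is a polynomial times [h] of the height, smooth across the
    poles. *)
Lemma is_eigenvalue_intro (k : Z) (s h om : R -> R) (l x0 : R) :
  let f := fun x => sqrt (1 - x ^ 2) ^ Z.abs_nat k * h x in
  Spot s -> Sm h ->
  (forall x, -1 < x < 1 -> is_derive f x (Derive_n s 2 x * om x)) ->
  (forall x, -1 < x < 1 -> is_derive om x ((IZR k ^ 2 * Derive_n s 2 x - l) * f x)) ->
  -1 <= x0 <= 1 -> f x0 <> 0 ->
  is_eigenvalue k s l.
Proof.
intros f Hs Sh Df Dom Hx0 N0.
set (n := Z.abs_nat k) in *.
assert (sg : exists sg, (sg = 1 \/ sg = -1) /\ IZR k = sg * INR n).
{ unfold n; destruct (Z_le_dec 0 k) as [Pk|Nk].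
  - exists 1; split; [auto|]; rewrite INR_IZR_INZ, Zabs2Nat.id_abs, Z.abs_eq by exact Pk; ring.
  - exists (-1); split; [auto|]; rewrite INR_IZR_INZ, Zabs2Nat.id_abs, Z.abs_neq by lia.
    rewrite opp_IZR; ring. }
destruct sg as [sg [Hsg Ek]].
set (G1 := fun p => fst (zpow n p) * h (coord axis3 p)).
set (G2 := fun p => sg * snd (zpow n p) * h (coord axis3 p)).
set (F := (fun p => (G1 (proj1_sig p), G2 (proj1_sig p))) : S2 -> C).
destruct (zpow_smooth3 n) as [Sz1 Sz2].
assert (SF : smooth_S2 F).
{ exists G1, G2; split; [|split; [|reflexivity]].
  - apply smooth3_mult; [exact Sz1 | now apply smooth3_comp_coord].
  - apply smooth3_mult; [|now apply smooth3_comp_coord].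
    apply smooth3_mult; [apply smooth3_const | exact Sz2]. }
assert (Ecos : forall t, cos (IZR k * t) = cos (INR n * t)).
{ intros t; rewrite Ek; destruct Hsg as [-> | ->]; [now rewrite Rmult_1_l|].
  replace (-1 * INR n * t) with (- (INR n * t)) by ring; apply cos_neg. }
assert (Esin : forall t, sin (IZR k * t) = sg * sin (INR n * t)).
{ intros t; rewrite Ek; destruct Hsg as [-> | ->]; [now rewrite !Rmult_1_l|].
  replace (-1 * INR n * t) with (- (INR n * t)) by ring; rewrite sin_neg; ring. }
assert (Fchart : forall x t, -1 <= x <= 1 ->
  F (chart x t) = (f x * cos (IZR k * t), f x * sin (IZR k * t))).
{ intros x t Hx; unfold F; rewrite chart_proj by exact Hx; unfold G1, G2.
  rewrite zpow_polar; cbn [coord fst snd].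
  rewrite Ecos, Esin; unfold f; f_equal; ring. }
exists F; split; [exact SF | split; [|split]].
- intros t [[[a b] c] Hp]; unfold F; simpl proj1_sig.
  change (cos t * a - sin t * b, sin t * a + cos t * b, c) with (rot t (a, b, c)).
  unfold G1, G2; rewrite zpow_rot; simpl fst; simpl snd.
  unfold Cmult, cis; simpl fst; simpl snd; simpl coord.
  rewrite Ecos, Esin.
  assert (sg * sg = 1) by (destruct Hsg as [-> | ->]; ring).
  f_equal; [|ring].
  transitivity ((cos (INR n * t) * fst (zpow n (a, b, c)) -
    (sg * sg) * sin (INR n * t) * snd (zpow n (a, b, c))) * h c); [rewrite H|]; ring.
- exists (chart x0 0); rewrite Fchart by exact Hx0; rewrite Rmult_0_r, cos_0, Rmult_1_r.
  intros E; apply N0; now injection E.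
- split; [exact SF | split; [now apply smooth_S2_scal|]].
  intros x t Hx; rewrite Fchart by lra.
  unfold Cmult, RtoC; simpl fst; simpl snd; f_equal.
  + rewrite (laplace_pot_ext s _ (fun x t => f x * (cos (IZR k * t) * 1 + sin (IZR k * t) * 0))).
    * rewrite (laplace_pot_separated s f om (IZR k) l) by assumption; ring.
    * exact Hs.
    * exact Hx.
    * intros y u Hy; rewrite Fchart by lra; simpl; ring.
  + rewrite (laplace_pot_ext s _ (fun x t => f x * (cos (IZR k * t) * 0 + sin (IZR k * t) * 1))).
    * rewrite (laplace_pot_separated s f om (IZR k) l) by assumption; ring.
    * exact Hs.
    * exact Hx.
    * intros y u Hy; rewrite Fchart by lra; simpl; ring.
Qed.

(** * Invariant functions *)

Lemma zero_case (s : R -> R) : Spot s -> ~ lambda1_critical 0 s.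
Proof.
intros Hs.
destruct (Spot_density s Hs) as [h [Sh [_ [Ds Pv]]]].
set (v := fun x => 1 + (1 - x ^ 2) * Derive_n h 2 x) in *.
assert (Sv : Sm v) by (unfold v; smooth_tac).
(* With [w = (1 - x^2) y], the equation [w'' = - lam s'' w] becomes [((1 - x^2)^2 y')' = (1 - x^2)
   (2 - lam v) y]. *)
destruct (ground_state 1 (fun _ => 1) v (fun _ => 2)) as [lam [y [Phi [Plam [Sy [Py Dy]]]]]];
  try (intros; lra); try smooth_tac.
destruct (recip_extension (-1) 1 y Sy Py) as [yr [Syr Eyr]].
set (y1 := Derive y).
assert (Sy1 : Sm y1) by (unfold y1; smooth_tac).
assert (Dy0 : forall x, is_derive y x (y1 x)) by (intros; now apply Sm_is_derive).
assert (Dy1 : forall x, -1 < x < 1 ->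
  is_derive y1 x (((2 - lam * v x) * y x + 4 * x * y1 x) / (1 - x ^ 2))).
{ intros x Hx; pose proof (rho_pos x Hx) as Pr.
  apply (is_derive_ext_loc (fun x => Phi x / (1 - x ^ 2) ^ 2)).
  - apply (filter_imp (fun y => -1 < y < 1)); [|now apply locally_inside].
    intros z Hz; pose proof (rho_pos z Hz); unfold y1.
    rewrite (is_derive_unique _ _ _ (proj1 (Dy z Hz))); eqR; field; lra.
  - assert (E : Phi x = y1 x * (1 - x ^ 2) ^ 2).
    { unfold y1; rewrite (is_derive_unique _ _ _ (proj1 (Dy x Hx))); eqR; field; lra. }
    destruct (Dy x Hx) as [_ DP].
    auto_derive.
    + split; [now exists ((1 - x ^ 2) ^ 1 * (2 - lam * v x) * y x) | split; [|exact I]].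
      apply Rmult_integral_contrapositive_currified;
        [|apply Rmult_integral_contrapositive_currified]; lra.
    + change (fun x => Phi x) with Phi; rewrite (is_derive_unique _ _ _ DP), E; eqR; field; lra. }
(* The logarithmic derivative of [w = (1 - x^2) y]. *)
set (P := fun x => - 2 * x / (1 - x ^ 2) + y1 x / y x).
assert (DP : forall x, -1 < x < 1 -> is_derive P x (- lam * Derive_n s 2 x - P x ^ 2)).
{ intros x Hx; pose proof (rho_pos x Hx) as Pr; pose proof (Py x ltac:(lra)) as Pyx.
  unfold P at 1; auto_derive.
  - repeat split; try lra; eexists; [now apply Dy1 | apply Dy0].
  - change (fun x => y1 x) with y1; change (fun x => y x) with y.
    rewrite (is_derive_unique _ _ _ (Dy1 x Hx)), (is_derive_unique _ _ _ (Dy0 x)).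
    rewrite Ds by exact Hx; fold (v x); unfold P; eqR; field; lra. }
(* Solving the Riccati equation for the new [s''], [B1] is the coefficient of [exp t - 1] and [- B2]
   that of [exp (- t) - 1]. [B1] is [s'' + x P / 2 + / 4 - lam x^2 / 16], where the singular parts
   [1 / (1 - x^2)] and [- x^2 / (1 - x^2)] add up to [1]. *)
set (B1 := fun x => 1 + Derive_n h 2 x + x * (y1 x * yr x) / 2 + / 4 - lam / 16 * x ^ 2).
set (B2 := fun x => lam / 16 * x ^ 2).
assert (SB1 : Sm B1) by (unfold B1, Rdiv; smooth_tac).
assert (SB2 : Sm B2) by (unfold B2; smooth_tac).
destruct (analytic_exp B1 (fun _ => 1) SB1) as [g1 [A1 E1]]; [smooth_tac|].
destruct (analytic_exp B2 (fun _ => -1) SB2) as [g2 [A2 E2]]; [smooth_tac|].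
apply (not_critical 0 s (fun t x => g1 t x + g2 t x) lam); auto; [now apply analytic_plus|].
intros t s' Hs' Ds'.
set (e := exp (- t)).
assert (Pe : 0 < e) by apply exp_pos.
assert (Ee : exp t = / e) by (unfold e; now rewrite exp_Ropp, Rinv_inv).
assert (Es' : forall x, -1 < x < 1 -> Derive_n s' 2 x =
  Derive_n s 2 x + (Derive_n s 2 x + x * P x / 2 + / 4 - lam / 16 * x ^ 2) * (/ e - 1)
    - lam / 16 * x ^ 2 * (e - 1)).
{ intros x Hx; rewrite Ds' by exact Hx.
  specialize (E1 t x); specialize (E2 t x).
  replace (t * -1) with (- t) in E2 by ring; fold e in E2.
  rewrite Rmult_1_r, Ee, Rmult_1_l in E1.
  assert (B1x : B1 x = Derive_n s 2 x + x * P x / 2 + / 4 - lam / 16 * x ^ 2).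
  { unfold B1; rewrite Eyr, Ds by lra; unfold P, v.
    pose proof (rho_pos x Hx); pose proof (Py x ltac:(lra)); eqR; field; lra. }
  rewrite <- B1x, E1; unfold B2 in E2; lra. }
set (Pt := fun x => P x + lam * (e - 1) * x / 4).
assert (DPt : forall x, -1 < x < 1 ->
  is_derive Pt x (- (lam * e) * Derive_n s' 2 x - Pt x ^ 2)).
{ intros x Hx.
  apply (is_derive_eq _ _ ((- lam * Derive_n s 2 x - P x ^ 2) + lam * (e - 1) / 4)).
  - apply (is_derive_plus P); [now apply DP | auto_derive; [easy | field]].
  - rewrite Es' by exact Hx; unfold Pt; eqR; field; lra. }
split; [now apply Rmult_lt_0_compat | split].
(* [c x^2] is a primitive of the correction [lam (e - 1) x / 4], so the new [w] has logarithmic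
   derivative [Pt]. The eigenfunction is recovered from its flux as [- w' / (lam e)]. *)
- set (c := lam * (e - 1) / 8).
  set (w := fun x => (1 - x ^ 2) * (y x * exp (c * x ^ 2))).
  assert (Sw : Sm w) by (unfold w; smooth_tac).
  assert (Dw : forall x, is_derive w x (- 2 * x * (y x * exp (c * x ^ 2)) +
    (1 - x ^ 2) * ((y1 x + 2 * c * x * y x) * exp (c * x ^ 2)))).
  { intros x; unfold w; auto_derive.
    - repeat split; eexists; apply Dy0.
    - change (fun x => y x) with y; rewrite (is_derive_unique _ _ _ (Dy0 x)).
      replace (x * (x * 1)) with (x ^ 2) by ring; ring. }
  assert (Dw' : forall x, -1 < x < 1 -> Derive w x = Pt x * w x).
  { intros x Hx; rewrite (is_derive_unique _ _ _ (Dw x)); unfold Pt, P, w, c.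
    pose proof (rho_pos x Hx); pose proof (Py x ltac:(lra)); eqR; field; lra. }
  set (f := fun x => - / (lam * e) * Derive w x).
  assert (Sf : Sm f) by (unfold f; smooth_tac).
  assert (Dfx : forall x, -1 < x < 1 -> is_derive f x (Derive_n s' 2 x * w x)).
  { intros x Hx; unfold f.
    apply (is_derive_eq _ _ (- / (lam * e) *
      ((- (lam * e) * Derive_n s' 2 x - Pt x ^ 2) * w x + Pt x * (Pt x * w x)))).
    - apply (is_derive_scal (Derive w)).
      apply (is_derive_ext_loc (fun x => Pt x * w x)).
      + apply (filter_imp (fun y => -1 < y < 1)); [|now apply locally_inside].
        intros z Hz; symmetry; now apply Dw'.
      + rewrite <- (Dw' x Hx).
        apply is_derive_Reals, (derivable_pt_lim_mult Pt w); apply is_derive_Reals;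
          [now apply DPt | now apply Sm_is_derive].
    - eqR; field; lra. }
  apply (is_eigenvalue_intro 0 s' f w (lam * e) 1); auto; try lra.
  + intros x Hx; apply (is_derive_ext f); [intros z; simpl; ring | now apply Dfx].
  + intros x Hx; apply (is_derive_eq _ _ (Derive w x)); [now apply Sm_is_derive|].
    simpl; unfold f; eqR; field; lra.
  (* At the pole [1] the flux [w] has a simple zero, so its derivative, and with it [f], is nonzero
     there. *)
  + simpl; rewrite Rmult_1_l; unfold f; rewrite (is_derive_unique _ _ _ (Dw 1)).
    pose proof (exp_pos (c * 1 ^ 2)); pose proof (Py 1 ltac:(lra)).
    assert (0 < / (lam * e)) by (apply Rinv_0_lt_compat; now apply Rmult_lt_0_compat).
    replace (- / (lam * e) * _) with (2 * (/ (lam * e) * (y 1 * exp (c * 1 ^ 2)))) by ring.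
    repeat apply Rmult_integral_contrapositive_currified; lra.
- intros m Pm Hm.
  destruct (is_eigenvalue_profile 0 s' m Hs' Hm) as [psi [om [Hp Np]]].
  (* This is [(1 - x^2) Pt] with [/ y] replaced by its smooth extension. *)
  destruct (continuous_bounded (fun x => - 2 * x + (1 - x ^ 2) * (y1 x * yr x + lam * (e - 1) * x / 4))
    (-1) 1) as [K [_ HK]].
  { intros x; apply Sm_continuous; unfold Rdiv; smooth_tac. }
  apply (eigenvalue_ge_zero s' Pt psi om (lam * e) m K Hs' Hp Pm); [|  |exact Np].
  + intros x Hx; apply (is_derive_eq _ _ _ _ (DPt x Hx)); ring.
  + intros x Hx; pose proof (rho_pos x Hx).
    rewrite <- (Rabs_pos_eq (1 - x ^ 2)) by lra; rewrite <- Rabs_mult.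
    eapply Rle_trans; [|apply (HK x); lra].
    right; f_equal; unfold Pt, P; rewrite Eyr by lra.
    pose proof (Py x ltac:(lra)); eqR; field; lra.
Qed.

(** * Equivariant functions of nonzero weight *)

(** At a maximum with nonnegative value [f] would be decreasing. *)
Lemma stays_negative (f f' : R -> R) :
  (forall x, continuous f x) -> f (-1) = 0 ->
  (forall x, -1 < x < 1 -> is_derive f x (f' x)) ->
  (forall x, -1 < x < 1 -> 0 <= f x -> f' x < 0) -> forall x, -1 < x < 1 -> f x < 0.
Proof.
intros C F0 D N x0 Hx0; apply Rnot_le_lt; intros P.
destruct (continuity_ab_maj f (-1) x0 ltac:(lra)) as [c [Hc Ic]].
{ intros y _; apply continuity_pt_filterlim, C. }
assert (M : exists c, -1 < c <= x0 /\ 0 <= f c /\ forall y, -1 <= y <= x0 -> f y <= f c).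
{ destruct (Req_dec c (-1)) as [->|Nc].
  - exists x0; split; [lra | split; [exact P|]]; intros y Hy; specialize (Hc y Hy); lra.
  - exists c; split; [lra | split; [|exact Hc]]; specialize (Hc x0 ltac:(lra)); lra. }
destruct M as [d [Hd [Pd Md]]].
pose proof (N d ltac:(lra) Pd) as Nd; pose proof (D d ltac:(lra)) as Dd.
apply is_derive_Reals in Dd.
destruct (Dd (- f' d) ltac:(lra)) as [r Hr].
set (a := - Rmin (r / 2) ((d + 1) / 2)).
pose proof (cond_pos r).
assert (Ha : -1 <= d + a /\ a < 0 /\ Rabs a < r).
{ pose proof (Rmin_l (r / 2) ((d + 1) / 2)); pose proof (Rmin_r (r / 2) ((d + 1) / 2)).
  assert (0 < Rmin (r / 2) ((d + 1) / 2)) by (apply Rmin_case; lra).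
  unfold a; rewrite Rabs_Ropp, Rabs_pos_eq; lra. }
destruct Ha as [A1 [A2 A3]].
specialize (Hr a ltac:(lra) A3); apply Rabs_lt_between in Hr.
assert (Q : (f (d + a) - f d) / a < 0) by lra.
pose proof (Md (d + a) ltac:(lra)) as L.
apply (Rmult_lt_gt_compat_neg_l a) in Q; [|exact A2].
replace (a * ((f (d + a) - f d) / a)) with (f (d + a) - f d) in Q by (field; lra).
lra.
Qed.

(** For [e = exp (2 ka s')] and [sg = s''], the first term of [p] is [- ka tanh (ka s')], which is
    [u f0' / f0] for [f0 = 1 / cosh (ka s')]; the second is [u y' / y], as
    [e / (e + 1)^2 = f0^2 / 4]. Thus [p] belongs to [f = f0 y], and the term in [ka^2] of the flux
    equation is the defect of [f0] in the equation for [lam = 0]. *)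
Lemma riccati_from_ground_state (e y Phi : R -> R) (ka sg lam x : R) :
  0 < e x -> 0 < y x ->
  is_derive e x (2 * ka * sg * e x) ->
  is_derive y x (sg * ((e x + 1) ^ 2 / e x) * Phi x) ->
  is_derive Phi x
    ((8 * ka ^ 2 * sg * (e x / (e x + 1) ^ 2) ^ 2 - lam * (e x / (e x + 1) ^ 2)) * y x) ->
  let p := fun x => - ka * ((e x - 1) / (e x + 1)) + (e x + 1) ^ 2 / e x * (Phi x / y x) in
  is_derive p x ((ka ^ 2 - p x ^ 2) * sg - lam).
Proof.
intros Pe Py De Dy DP p; unfold p at 1; auto_derive.
- repeat split; try lra; eexists; eassumption.
- change (fun x => e x) with e; change (fun x => y x) with y; change (fun x => Phi x) with Phi.
  rewrite (is_derive_unique _ _ _ De), (is_derive_unique _ _ _ Dy), (is_derive_unique _ _ _ DP).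
  unfold p; eqR; field; lra.
Qed.

Lemma Derive_n_2_is_derive (s : R -> R) (x : R) : Spot s -> -1 < x < 1 ->
  is_derive (Derive s) x (Derive_n s 2 x).
Proof.
intros Hs Hx; apply (smooth_on_is_derive inside); [|exact Hx].
apply smooth_on_Derive; [apply open_inside | now apply Spot_smooth].
Qed.

Lemma pow_exp_ln (z : R) (n : nat) : 0 < z -> z ^ n = exp (INR n * ln z).
Proof. intros Hz; symmetry; rewrite <- (Rpower_pow n z Hz); reflexivity. Qed.

(** [p] is [u f' / f] for the positive first eigenfunction [f cos (k theta)], where
    [u = 1 / s''] and [ka = |k|]; it is smooth up to the poles, where it equals [ka] and [- ka]. *)
Lemma riccati_solution (s h : R -> R) (j : nat) :
  let ka := INR (S j) in
  let v := fun x => 1 + (1 - x ^ 2) * Derive_n h 2 x in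
  Spot s -> Sm h -> (forall x, -1 < x < 1 -> s x = fubini_study x + h x) ->
  (forall x, -1 < x < 1 -> Derive_n s 2 x = v x / (1 - x ^ 2)) ->
  (forall x, -1 <= x <= 1 -> 0 < v x) ->
  exists (lam : R) (kp km p : R -> R), 0 < lam /\ Sm kp /\ Sm km /\
    (forall x, -1 <= x <= 1 -> 0 < kp x) /\ (forall x, -1 <= x <= 1 -> 0 < km x) /\
    (forall x, -1 <= x <= 1 -> ka + p x = (1 - x) * kp x) /\
    (forall x, -1 <= x <= 1 -> ka - p x = (1 + x) * km x) /\
    (forall x, -1 < x < 1 -> is_derive p x ((ka ^ 2 - p x ^ 2) * Derive_n s 2 x - lam)).
Proof.
intros ka v Hs Sh Es Ds Pv.
assert (Pka : 0 < ka) by (apply lt_0_INR; lia).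
assert (Sv : Sm v) by (unfold v; smooth_tac).
set (X1 := fun x => exp (ka * Derive h x)); set (X2 := fun x => exp (- ka * Derive h x)).
assert (SX1 : Sm X1) by (unfold X1; smooth_tac).
assert (SX2 : Sm X2) by (unfold X2; smooth_tac).
assert (PX1 : forall x, 0 < X1 x) by (intros; apply exp_pos).
assert (PX2 : forall x, 0 < X2 x) by (intros; apply exp_pos).
assert (X12 : forall x, X1 x * X2 x = 1).
{ intros x; unfold X1, X2; rewrite <- exp_plus, <- exp_0; f_equal; ring. }
(* Because [s' = (ln (1 + x) - ln (1 - x)) / 2 + h'], [exp (2 ka s') = E1 / E2], a quotient of
   functions smooth up to the poles with no common zero on [[-1,1]]. *)
set (E1 := fun x => (1 + x) ^ S j * X1 x); set (E2 := fun x => (1 - x) ^ S j * X2 x).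
set (c := fun x => E1 x + E2 x).
assert (SE1 : Sm E1) by (unfold E1; smooth_tac).
assert (SE2 : Sm E2) by (unfold E2; smooth_tac).
assert (Sc : Sm c) by (unfold c; smooth_tac).
assert (Pc : forall x, -1 <= x <= 1 -> 0 < c x).
{ intros x Hx; unfold c, E1, E2.
  destruct (Rle_dec 0 x) as [H|H].
  - assert (0 < (1 + x) ^ S j) by (apply pow_lt; lra).
    assert (0 <= (1 - x) ^ S j) by (apply pow_le; lra).
    specialize (PX1 x); specialize (PX2 x); nra.
  - assert (0 < (1 - x) ^ S j) by (apply pow_lt; lra).
    assert (0 <= (1 + x) ^ S j) by (apply pow_le; lra).
    specialize (PX1 x); specialize (PX2 x); nra. }
destruct (recip_extension (-1) 1 c Sc Pc) as [cr [Scr Ecr]].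
destruct (recip_extension (-1) 1 v Sv Pv) as [vr [Svr Evr]].
assert (Pcr : forall x, -1 <= x <= 1 -> 0 < cr x).
{ intros x Hx; rewrite Ecr by exact Hx; now apply Rinv_0_lt_compat, Pc. }
(* With [e = E1 / E2] and [E1 E2 = (1 - x^2)^(S j)], one has
   [e / (e + 1)^2 = (1 - x^2)^(S j) / c^2]. This rewrites the coefficients of
   [riccati_from_ground_state] in the form required by [ground_state]; [q] may vanish at the
   poles. *)
set (q := fun x => 8 * ka ^ 2 * v x * (1 - x ^ 2) ^ j * (cr x ^ 2) ^ 2).
destruct (ground_state (S j) (fun x => v x * c x ^ 2) (fun x => cr x ^ 2) q)
  as [lam [y [Phi [Plam [Sy [Py Dy]]]]]].
{ smooth_tac. }
{ smooth_tac. }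
{ unfold q; smooth_tac. }
{ intros x Hx; apply Rmult_lt_0_compat; [now apply Pv | now apply pow_lt, Pc]. }
{ intros x Hx; now apply pow_lt, Pcr. }
{ intros x Hx; unfold q.
  assert (0 <= (1 - x ^ 2) ^ j) by (apply pow_le; nra).
  assert (0 < cr x ^ 2) by now apply pow_lt, Pcr.
  assert (0 < ka ^ 2) by now apply pow_lt.
  pose proof (Pv x Hx).
  apply Rmult_le_pos; [apply Rmult_le_pos; [apply Rmult_le_pos; lra | lra] | apply pow_le; lra]. }
{ intros x Hx; unfold q.
  assert (0 < (1 - x ^ 2) ^ j) by (apply pow_lt, rho_pos, Hx).
  assert (0 < cr x ^ 2) by (apply pow_lt, Pcr; lra).
  assert (0 < ka ^ 2) by now apply pow_lt.
  pose proof (Pv x ltac:(lra)).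
  apply Rmult_lt_0_compat; [|apply pow_lt; lra].
  apply Rmult_lt_0_compat; [apply Rmult_lt_0_compat; lra | lra]. }
destruct (recip_extension (-1) 1 y Sy Py) as [yr [Syr Eyr]].
set (dy := Derive y).
assert (Sdy : Sm dy) by (unfold dy; smooth_tac).
(* In [ka + p] and [ka - p] the hyperbolic parts are [2 ka E2 / c] and [2 ka E1 / c], divisible by
   [1 - x] and [1 + x]; the remaining part [(1 - x^2) y' / (v y)] is divisible by both. *)
set (kp := fun x => 2 * ka * ((1 - x) ^ j * X2 x) * cr x + (1 + x) * (vr x * (dy x * yr x))).
set (km := fun x => 2 * ka * ((1 + x) ^ j * X1 x) * cr x - (1 - x) * (vr x * (dy x * yr x))).
assert (Skp : Sm kp) by (unfold kp; smooth_tac).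
assert (Skm : Sm km) by (unfold km; smooth_tac).
set (p := fun x => (1 - x) * kp x - ka).
assert (Sp : Sm p) by (unfold p; smooth_tac).
assert (Kp : forall x, ka + p x = (1 - x) * kp x) by (intros; unfold p; ring).
assert (Km : forall x, -1 <= x <= 1 -> ka - p x = (1 + x) * km x).
{ intros x Hx; unfold p, kp, km.
  assert (Ec : 2 * ka * (E1 x + E2 x) * cr x = 2 * ka).
  { rewrite Ecr by exact Hx; fold (c x); pose proof (Pc x Hx); field; lra. }
  transitivity (2 * ka - 2 * ka * E2 x * cr x -
    (1 - x ^ 2) * (vr x * (dy x * yr x))); [unfold E2; simpl; ring|].
  transitivity (2 * ka * (E1 x + E2 x) * cr x - 2 * ka * E2 x * cr x -
    (1 - x ^ 2) * (vr x * (dy x * yr x))); [rewrite Ec; ring|].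
  unfold E1; simpl; ring. }
set (e := fun x => exp (2 * ka * Derive s x)).
assert (Ee : forall x, -1 < x < 1 -> E1 x = e x * E2 x).
{ intros x Hx; unfold e.
  assert (D : Derive s x = / 2 * (ln (1 + x) - ln (1 - x)) + Derive h x).
  { rewrite (Derive_ext_loc s (fun x => fubini_study x + h x)).
    - apply is_derive_unique, (is_derive_plus fubini_study h);
        [now apply fubini_study_derive1 | now apply Sm_is_derive].
    - apply (filter_imp (fun y => -1 < y < 1)); [exact Es | now apply locally_inside]. }
  rewrite D; unfold E1, E2, X1, X2; rewrite !pow_exp_ln by lra; fold ka.
  rewrite <- !exp_plus; f_equal; field. }
assert (Dp : forall x, -1 < x < 1 ->
  is_derive p x ((ka ^ 2 - p x ^ 2) * Derive_n s 2 x - lam)).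
{ set (pe := fun x => - ka * ((e x - 1) / (e x + 1)) + (e x + 1) ^ 2 / e x * (Phi x / y x)).
  assert (PE2 : forall x, -1 < x < 1 -> 0 < E2 x).
  { intros x Hx; apply Rmult_lt_0_compat; [apply pow_lt; lra | apply PX2]. }
  assert (Pe : forall x, 0 < e x) by (intros; apply exp_pos).
  assert (Ec : forall x, -1 < x < 1 -> c x = (e x + 1) * E2 x).
  { intros x Hx; unfold c; rewrite Ee by exact Hx; ring. }
  assert (Er : forall x, -1 < x < 1 -> (1 - x ^ 2) ^ S j = e x * E2 x * E2 x).
  { intros x Hx; rewrite <- Ee by exact Hx; unfold E1, E2.
    transitivity ((1 + x) ^ S j * (1 - x) ^ S j * (X1 x * X2 x)); [|ring].
    rewrite X12, Rmult_1_r, <- Rpow_mult_distr; f_equal; ring. }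
  assert (Eq : forall x, -1 < x < 1 -> p x = pe x).
  { intros x Hx; unfold p, kp, pe.
    pose proof (PE2 x Hx); pose proof (Pe x); pose proof (Py x ltac:(lra)).
    pose proof (Pv x ltac:(lra)); pose proof (rho_pos x Hx).
    unfold dy; rewrite (is_derive_unique _ _ _ (proj1 (Dy x Hx))).
    change ((1 - x ^ 2) ^ S (S j)) with ((1 - x ^ 2) * (1 - x ^ 2) ^ S j).
    rewrite Er, Ecr, Evr, Eyr, Ec by lra.
    transitivity (2 * ka * E2 x * / ((e x + 1) * E2 x) - ka +
      (1 - x ^ 2) * (/ v x * (v x * ((e x + 1) * E2 x) ^ 2 * Phi x /
      ((1 - x ^ 2) * (e x * E2 x * E2 x)) * / y x))); [unfold E2; simpl; ring|].
    field; repeat split; lra. }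
  intros x Hx.
  apply (is_derive_ext_loc pe).
  { apply (filter_imp (fun y => -1 < y < 1)); [|now apply locally_inside].
    intros z Hz; symmetry; now apply Eq. }
  pose proof (PE2 x Hx); pose proof (Pe x); pose proof (Py x ltac:(lra)).
  pose proof (Pv x ltac:(lra)); pose proof (rho_pos x Hx).
  rewrite Eq by exact Hx.
  destruct (Dy x Hx) as [D1 D2].
  apply (riccati_from_ground_state e y Phi ka (Derive_n s 2 x) lam x); auto.
  - apply (is_derive_eq _ _ (2 * ka * Derive_n s 2 x * exp (2 * ka * Derive s x))); [|reflexivity].
    apply (is_derive_comp exp (fun x => 2 * ka * Derive s x)); [apply is_derive_exp|].
    apply (is_derive_scal (Derive s)); now apply Derive_n_2_is_derive.
  - apply (is_derive_eq _ _ _ _ D1).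
    change ((1 - x ^ 2) ^ S (S j)) with ((1 - x ^ 2) * (1 - x ^ 2) ^ S j).
    rewrite Er, Ec, Ds by exact Hx; eqR; field; repeat split; lra.
  - apply (is_derive_eq _ _ _ _ D2).
    assert (Er' : (1 - x ^ 2) ^ j = e x * E2 x * E2 x / (1 - x ^ 2)).
    { rewrite <- (Er x Hx); simpl; field; lra. }
    unfold q; rewrite Er', Er, Ecr, Ec, Ds by lra.
    eqR; field; repeat split; lra. }
assert (Cp : forall x, continuous p x) by (intros; now apply Sm_continuous).
assert (p1 : p 1 = - ka) by (unfold p; ring).
assert (pm1 : p (-1) = ka) by (pose proof (Km (-1) ltac:(lra)); lra).
assert (Sig : forall x, -1 < x < 1 -> 0 < Derive_n s 2 x) by apply Hs.
(* [p] starts from [ka], and wherever [p >= ka] the Riccati equation gives [p' <= - lam < 0]. The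
   lower bound follows by the symmetry [p |-> - p (- x)]. *)
assert (up : forall x, -1 < x < 1 -> p x < ka).
{ intros x Hx; enough (p x - ka < 0) by lra.
  apply (stays_negative (fun x => p x - ka) (fun x => (ka ^ 2 - p x ^ 2) * Derive_n s 2 x - lam)).
  - intros z; apply (continuous_minus p (fun _ => ka)); [apply Cp | apply continuous_const].
  - rewrite pm1; ring.
  - intros z Hz; apply (is_derive_eq _ _ (((ka ^ 2 - p z ^ 2) * Derive_n s 2 z - lam) - 0)).
    + apply (is_derive_minus p (fun _ => ka)); [now apply Dp | apply (is_derive_const (V := R_NormedModule))].
    + ring.
  - intros z Hz Pz; pose proof (Sig z Hz).
    assert (ka ^ 2 - p z ^ 2 <= 0) by nra; nra.
  - exact Hx. }
assert (down : forall x, -1 < x < 1 -> - ka < p x).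
{ intros x Hx; enough (- p (- - x) - ka < 0) by (rewrite Ropp_involutive in *; lra).
  apply (stays_negative (fun x => - p (- x) - ka)
    (fun x => (ka ^ 2 - p (- x) ^ 2) * Derive_n s 2 (- x) - lam)); [| | | |lra].
  - intros z; apply Sm_continuous; apply smooth_on_minus; [apply open_reals | | apply smooth_on_const].
    apply smooth_on_opp; [apply open_reals|]; apply (Sm_comp p); [exact Sp | smooth_tac].
  - replace (- -1) with 1 by ring; rewrite p1; ring.
  - intros z Hz.
    apply (is_derive_eq _ _ (- - ((ka ^ 2 - p (- z) ^ 2) * Derive_n s 2 (- z) - lam) - 0)).
    + apply (is_derive_minus (fun x => - p (- x)) (fun _ => ka));
        [|apply (is_derive_const (V := R_NormedModule))].
      apply (is_derive_opp (fun x => p (- x))), (is_derive_reflect p), Dp; lra.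
    + ring.
  - intros z Hz Pz; pose proof (Sig (- z) ltac:(lra)).
    assert (ka ^ 2 - p (- z) ^ 2 <= 0) by nra; nra. }
(* The strict bounds on [p] say nothing about [kp] at [1] and [km] at [-1], where their factors
   vanish. The Riccati equation, extended to the poles by continuity, shows that both values are
   [lam / (1 + ka)]. *)
assert (Dend : forall x, -1 <= x <= 1 -> Derive p x = kp x * km x * v x - lam).
{ apply eq_at_endpoints.
  - intros x; apply Sm_continuous; smooth_tac.
  - intros x; apply Sm_continuous; smooth_tac.
  - intros x Hx; rewrite (is_derive_unique _ _ _ (Dp x Hx)), Ds by exact Hx.
    replace (ka ^ 2 - p x ^ 2) with ((ka + p x) * (ka - p x)) by ring.
    rewrite Kp, Km by lra; pose proof (rho_pos x Hx); field; lra. }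
assert (Ekp : kp 1 * (1 + ka) = lam).
{ pose proof (Dend 1 ltac:(lra)) as D.
  assert (D' : Derive p 1 = - kp 1).
  { apply is_derive_unique; unfold p.
    apply (is_derive_eq _ _ (- (1) * kp 1 + (1 - 1) * Derive kp 1 - 0)); [|ring].
    apply (is_derive_minus (fun x => (1 - x) * kp x) (fun _ => ka));
      [|apply (is_derive_const (V := R_NormedModule))].
    apply is_derive_Reals, (derivable_pt_lim_mult (fun x => 1 - x) kp); apply is_derive_Reals.
    - auto_derive; [easy | ring].
    - now apply Sm_is_derive. }
  rewrite D' in D; unfold v in D; pose proof (Km 1 ltac:(lra)) as K; rewrite p1 in K.
  assert (km 1 = ka) by lra; rewrite H in D; nra. }
assert (Ekm : km (-1) * (1 + ka) = lam).
{ pose proof (Dend (-1) ltac:(lra)) as D.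
  (* [p2] agrees with [p] on [[-1,1]] but not necessarily outside; the derivatives at [-1] agree as
     limits from the inside. *)
  set (p2 := fun x => ka - (1 + x) * km x).
  assert (D' : Derive p2 (-1) = - km (-1)).
  { apply is_derive_unique; unfold p2.
    apply (is_derive_eq _ _ (0 - (1 * km (-1) + (1 + -1) * Derive km (-1)))); [|ring].
    apply (is_derive_minus (fun _ => ka) (fun x => (1 + x) * km x));
      [apply (is_derive_const (V := R_NormedModule))|].
    apply is_derive_Reals, (derivable_pt_lim_mult (fun x => 1 + x) km); apply is_derive_Reals.
    - auto_derive; [easy | ring].
    - now apply Sm_is_derive. }
  assert (Sp2 : Sm p2) by (unfold p2; smooth_tac).
  assert (D2 : Derive p (-1) = Derive p2 (-1)).
  { apply (eq_at_endpoints (Derive p) (Derive p2)); [| | |lra].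
    - intros x; apply Sm_continuous; smooth_tac.
    - intros x; apply Sm_continuous; smooth_tac.
    - intros x Hx; apply Derive_ext_loc.
      apply (filter_imp (fun y => -1 < y < 1)); [|now apply locally_inside].
      intros z Hz; unfold p2; rewrite <- Km by lra; ring. }
  rewrite D2, D' in D; unfold v in D; pose proof (Kp (-1)) as K; rewrite pm1 in K.
  assert (kp (-1) = ka) by lra; rewrite H in D; nra. }
exists lam, kp, km, p; repeat (split; [assumption|]).
split; [|split; [|split; [|split]]]; auto.
- intros x Hx.
  destruct (Req_dec x 1) as [->|N1]; [nra|].
  destruct (Req_dec x (-1)) as [->|N2]; [pose proof (Kp (-1)) as K; rewrite pm1 in K; lra|].
  pose proof (down x ltac:(lra)); pose proof (Kp x).
  apply (Rmult_lt_reg_l (1 - x)); lra.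
- intros x Hx.
  destruct (Req_dec x (-1)) as [->|N1]; [nra|].
  destruct (Req_dec x 1) as [->|N2]; [pose proof (Km 1 ltac:(lra)) as K; rewrite p1 in K; lra|].
  pose proof (up x ltac:(lra)); pose proof (Km x Hx).
  apply (Rmult_lt_reg_l (1 + x)); lra.
Qed.

Lemma sqrt_rho_pow_derive (n : nat) (x : R) : -1 < x < 1 ->
  is_derive (fun x => sqrt (1 - x ^ 2) ^ n) x
    (- INR n * x / (1 - x ^ 2) * sqrt (1 - x ^ 2) ^ n).
Proof.
intros Hx; pose proof (rho_pos x Hx) as P; pose proof (sqrt_lt_R0 _ P) as Ps.
pose proof (sqrt_sqrt (1 - x ^ 2) (Rlt_le _ _ P)) as E.
apply (is_derive_eq _ _ _ _ (is_derive_pow _ n x _ (sqrt_rho_derive x Hx))).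
set (r := sqrt (1 - x ^ 2)) in *; rewrite <- E.
destruct n as [|n]; [simpl; eqR; field; lra|].
simpl Init.Nat.pred; simpl pow; eqR; field; lra.
Qed.

Lemma nonzero_case (k : Z) (s : R -> R) : k <> 0%Z -> Spot s -> ~ lambda1_critical k s.
Proof.
intros Nk Hs.
destruct (Spot_density s Hs) as [h [Sh [Es [Ds Pv]]]].
set (v := fun x => 1 + (1 - x ^ 2) * Derive_n h 2 x) in *.
assert (Sv : Sm v) by (unfold v; smooth_tac).
set (n := Z.abs_nat k).
destruct n as [|j] eqn:En; [unfold n in En; lia|].
destruct (riccati_solution s h j Hs Sh Es Ds Pv)
  as [lam [kp [km [p [Plam [Skp [Skm [Pkp [Pkm [Ekp [Ekm Dp]]]]]]]]]]].
rewrite <- En in *; set (ka := INR n) in *.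
assert (Pka : 0 < ka) by (unfold ka; rewrite En; apply lt_0_INR; lia).
assert (Eka : IZR k ^ 2 = ka ^ 2).
{ unfold ka, n; rewrite INR_IZR_INZ, Zabs2Nat.id_abs, abs_IZR; symmetry; apply pow2_abs. }
destruct (recip_extension (-1) 1 kp Skp Pkp) as [kpr [Skpr Ekpr]].
destruct (recip_extension (-1) 1 km Skm Pkm) as [kmr [Skmr Ekmr]].
(* [g1], [g2], [g3] are the changes of the terms in [2], [z] and [1 / z] of
   [lam (z + 2 + 1 / z) / (4 k^2)]. *)
set (q := lam / (4 * ka ^ 2)).
destruct (analytic_exp (fun _ => - 2 * q) (fun _ => -1)) as [g1 [A1 E1]];
  [smooth_tac | smooth_tac |].
(* The new [z] times [exp (- t)] is [z exp (t (x - 1))], so the zero of [x - 1] cancels the pole of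
   [z] at [1]: [- (1 + x) km / kp] is [(x - 1) z]. For [1 / z] the exponent is [- t (x + 1)], with
   its zero at [-1]. *)
destruct (analytic_exp (fun x => - q * ((1 + x) * km x * kpr x)) (fun x => x - 1))
  as [g2 [A2 E2]]; [smooth_tac | smooth_tac |].
destruct (analytic_exp (fun x => - q * ((1 - x) * kp x * kmr x)) (fun x => - (x + 1)))
  as [g3 [A3 E3]]; [smooth_tac | smooth_tac |].
(* The last term is the change of [- 2 |k| z' / z], the logarithmic derivative of [z] growing by
   [t], divided by [4 k^2]. *)
set (g := fun t x => (g1 t x + g2 t x) + (g3 t x + t * - / (2 * ka))).
assert (Ag : analytic_at_zero g).
{ unfold g; apply (analytic_plus (fun t x => g1 t x + g2 t x)); [now apply analytic_plus|].
  apply (analytic_plus g3 (fun t x => t * - / (2 * ka))); [exact A3|].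
  apply analytic_linear; smooth_tac. }
apply (not_critical k s g lam); auto.
intros t s' Hs' Ds'.
set (T := exp (- t)).
assert (PT : 0 < T) by apply exp_pos.
set (X := fun x => exp (t * x)).
assert (PX : forall x, 0 < X x) by (intros; apply exp_pos).
assert (SX : Sm X) by (unfold X; smooth_tac).
set (z := fun x => (ka - p x) / (ka + p x)).
assert (Pp : forall x, -1 < x < 1 -> 0 < ka + p x /\ 0 < ka - p x).
{ intros x Hx; rewrite Ekp, Ekm by lra.
  split; apply Rmult_lt_0_compat; try lra; [apply Pkp | apply Pkm]; lra. }
assert (Pz : forall x, -1 < x < 1 -> 0 < z x).
{ intros x Hx; destruct (Pp x Hx); now apply Rdiv_lt_0_compat. }
assert (Ez : forall x, -1 < x < 1 -> z x = (1 + x) * km x / ((1 - x) * kp x)).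
{ intros x Hx; unfold z; now rewrite Ekp, Ekm by lra. }
assert (Es' : forall x, -1 < x < 1 -> Derive_n s' 2 x = Derive_n s 2 x +
  (2 * lam * (T - 1) + lam * z x * (X x * T - 1) + lam / z x * (T / X x - 1) - 2 * ka * t)
    / (4 * ka ^ 2)).
{ intros x Hx; rewrite Ds' by exact Hx; f_equal.
  specialize (E1 t x); specialize (E2 t x); specialize (E3 t x).
  replace (t * -1) with (- t) in E1 by ring; fold T in E1.
  replace (exp (t * (x - 1))) with (X x * T) in E2
    by (unfold X, T; rewrite <- exp_plus; f_equal; ring).
  replace (exp (t * - (x + 1))) with (T / X x) in E3
    by (unfold X, T, Rdiv; rewrite <- exp_Ropp, <- exp_plus; f_equal; ring).
  rewrite Ekpr in E2 by lra; rewrite Ekmr in E3 by lra.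
  pose proof (Pkp x ltac:(lra)); pose proof (Pkm x ltac:(lra)); pose proof (PX x).
  assert (F1 : g1 t x = 2 * q * (T - 1)) by lra.
  assert (F2 : g2 t x = q * z x * (X x * T - 1)).
  { apply (Rmult_eq_reg_l (x - 1)); [|lra]; rewrite E2, Ez by exact Hx; field; lra. }
  assert (F3 : g3 t x = q / z x * (T / X x - 1)).
  { apply (Rmult_eq_reg_l (- (x + 1))); [|lra]; rewrite E3, Ez by exact Hx; field; lra. }
  unfold g; rewrite F1, F2, F3; unfold q; pose proof (Pz x Hx); field; lra. }
assert (Dz : forall x, -1 < x < 1 ->
  is_derive z x (lam * (1 + z x) ^ 2 / (2 * ka) - 2 * ka * Derive_n s 2 x * z x)).
{ intros x Hx; destruct (Pp x Hx) as [P1 P2]; pose proof (Dp x Hx) as D.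
  unfold z at 1; auto_derive.
  - repeat split; try lra; eexists; eassumption.
  - change (fun x => p x) with p; rewrite (is_derive_unique _ _ _ D); unfold z.
    eqR; field; lra. }
(* [p = ka (1 - z) / (1 + z)] inverts the definition of [z]. *)
set (pt := fun x => ka * ((1 - z x * X x) / (1 + z x * X x))).
assert (PzX : forall x, -1 < x < 1 -> 0 < z x * X x).
{ intros x Hx; apply Rmult_lt_0_compat; auto. }
assert (DX : forall x, is_derive X x (t * X x)).
{ intros x; unfold X; auto_derive; [easy | ring]. }
assert (Dpt : forall x, -1 < x < 1 ->
  is_derive pt x ((ka ^ 2 - pt x ^ 2) * Derive_n s' 2 x - lam * T)).
{ intros x Hx; pose proof (PzX x Hx); pose proof (Pz x Hx); pose proof (PX x).
  unfold pt at 1; auto_derive.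
  - repeat split; try lra; eexists; auto.
  - change (fun x => z x) with z; change (fun x => X x) with X.
    rewrite (is_derive_unique _ _ _ (Dz x Hx)), (is_derive_unique _ _ _ (DX x)).
    rewrite Es' by exact Hx; unfold pt; eqR; field; repeat split; lra. }
split; [now apply Rmult_lt_0_compat | split].
(* [z X = Z1 / Z2], so [pt = ka (Z2 - Z1) / (Z1 + Z2)], which is smooth up to the poles although [z]
   is not. *)
- set (Z1 := fun x => (1 + x) * km x * X x); set (Z2 := fun x => (1 - x) * kp x).
  assert (SZ1 : Sm Z1) by (unfold Z1; smooth_tac).
  assert (SZ2 : Sm Z2) by (unfold Z2; smooth_tac).
  assert (PZ : forall x, -1 <= x <= 1 -> 0 < Z1 x + Z2 x).
  { intros x Hx; unfold Z1, Z2; pose proof (Pkp x Hx); pose proof (Pkm x Hx); pose proof (PX x).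
    assert (0 < km x * X x) by now apply Rmult_lt_0_compat.
    rewrite Rmult_assoc; destruct (Rle_dec 0 x).
    - apply Rplus_lt_le_0_compat; [apply Rmult_lt_0_compat | apply Rmult_le_pos]; lra.
    - apply Rplus_le_lt_0_compat; [apply Rmult_le_pos | apply Rmult_lt_0_compat]; lra. }
  destruct (recip_extension (-1) 1 (fun x => Z1 x + Z2 x)) as [Zr [SZr EZr]];
    [smooth_tac | exact PZ |].
  set (pb := fun x => ka * ((Z2 x - Z1 x) * Zr x)).
  assert (Spb : Sm pb) by (unfold pb; smooth_tac).
  assert (Epb : forall x, -1 < x < 1 -> pb x = pt x).
  { intros x Hx; unfold pb, pt; rewrite EZr, Ez by lra; unfold Z1, Z2.
    pose proof (PZ x ltac:(lra)) as PZx; unfold Z1, Z2 in PZx.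
    pose proof (Pkp x ltac:(lra)); field; repeat split; lra. }
  set (vt := fun x => v x + (1 - x ^ 2) * g t x).
  assert (Sg : Sm (g t)) by apply (an_smooth _ Ag).
  assert (Svt : Sm vt) by (unfold vt; smooth_tac).
  (* The eigenfunction satisfies [f' / f = pt vt / (1 - x^2)]. Its factor [sqrt (1 - x^2)^|k|]
     accounts for [- ka x / (1 - x^2)]; the rest is the smooth [L], because [pt] is [ka] at [-1],
     [- ka] at [1], and [vt] is [1] at both. *)
  destruct (hadamard_division2 (fun x => pb x * vt x + ka * x)) as [L [SL EL]].
  { smooth_tac. }
  { assert (E : Z1 (-1) = 0) by (unfold Z1; ring).
    pose proof (PZ (-1) ltac:(lra)) as P; rewrite E in P.
    unfold pb, vt, v; rewrite EZr, E by lra; field; lra. }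
  { assert (E : Z2 1 = 0) by (unfold Z2; ring).
    pose proof (PZ 1 ltac:(lra)) as P; rewrite E in P.
    unfold pb, vt, v; rewrite EZr, E by lra; field; lra. }
  set (ht := fun x => exp (RInt L 0 x)).
  assert (Sht : Sm ht).
  { apply (Sm_comp exp); [apply smooth_on_exp | now apply Sm_RInt]. }
  assert (Dht : forall x, is_derive ht x (L x * ht x)).
  { intros x; apply (is_derive_comp exp (fun x => RInt L 0 x)); [apply is_derive_exp|].
    apply is_derive_RInt0; intros y; now apply Sm_continuous. }
  set (f := fun x => sqrt (1 - x ^ 2) ^ n * ht x).
  assert (Df : forall x, -1 < x < 1 -> is_derive f x (Derive_n s' 2 x * (pt x * f x))).
  { intros x Hx; pose proof (rho_pos x Hx).
    pose proof (sqrt_rho_pow_derive n x Hx) as D1; pose proof (Dht x) as D2.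
    apply is_derive_Reals in D1, D2.
    apply (is_derive_eq _ _ ((- ka * x / (1 - x ^ 2) * sqrt (1 - x ^ 2) ^ n) * ht x +
      sqrt (1 - x ^ 2) ^ n * (L x * ht x))).
    - apply is_derive_Reals, (derivable_pt_lim_mult (fun x => sqrt (1 - x ^ 2) ^ n) ht); [exact D1 | exact D2].
    - assert (E : L x = (pb x * vt x + ka * x) / (1 - x ^ 2)) by (rewrite EL; field; lra).
      rewrite E, <- Epb, Ds', Ds by exact Hx; unfold f, vt; fold (v x); field; lra. }
  apply (is_eigenvalue_intro k s' ht (fun x => pt x * f x) (lam * T) 0); fold n; auto; try lra.
  + intros x Hx; change (is_derive (fun x => pt x * f x) x
      ((IZR k ^ 2 * Derive_n s' 2 x - lam * T) * f x)).
    pose proof (Dpt x Hx) as D1; pose proof (Df x Hx) as D2.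
    apply is_derive_Reals in D1, D2.
    apply (is_derive_eq _ _ (((ka ^ 2 - pt x ^ 2) * Derive_n s' 2 x - lam * T) * f x +
      pt x * (Derive_n s' 2 x * (pt x * f x)))).
    * apply is_derive_Reals, (derivable_pt_lim_mult pt f); [exact D1 | exact D2].
    * rewrite Eka; ring.
  + replace (1 - 0 ^ 2) with 1 by ring; rewrite sqrt_1, pow1, Rmult_1_l.
    unfold ht; pose proof (exp_pos (RInt L 0 0)); lra.
- intros m Pm Hm.
  destruct (is_eigenvalue_profile k s' m Hs' Hm) as [psi [om [Hp Np]]].
  apply (eigenvalue_ge_nonzero k s' pt psi om (lam * T) m ka Nk Hs' Hp); [| |exact Np].
  + intros x Hx; rewrite Eka; now apply Dpt.
  + intros x Hx; pose proof (PzX x Hx).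
    assert (0 < / (1 + z x * X x)) by (apply Rinv_0_lt_compat; lra).
    assert (E : pt x = ka - 2 * ka * (z x * X x * / (1 + z x * X x)))
      by (unfold pt; field; lra).
    assert (z x * X x * / (1 + z x * X x) = 1 - / (1 + z x * X x)) by (field; lra).
    assert (0 < z x * X x * / (1 + z x * X x)) by now apply Rmult_lt_0_compat.
    apply Rabs_le_between; rewrite E; split; nra.
Qed.

Theorem theorem1p4 (k : Z) :
  ~ exists s : R -> R, Spot s /\ lambda1_critical k s.
Proof.
intros [s [Hs Crit]]; revert Crit.
destruct (Z.eq_dec k 0) as [->|Nk]; [now apply zero_case | now apply nonzero_case].
Qed.
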